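(* Let $\alpha>0$, $C>0$ and $\sigma>0$ be fixed, and let $p_j=-C\exp(-\sigma(\sqrt{N_1}-\sqrt{j}))$, $1\le j\le N_1$. There exist rational functions $$r_N(z)=\sum_{j=1}^{N_1}\frac{a_j}{z-p_j}+P_{N_2}(z),\qquad \widetilde r_N(z)=\sum_{j=1}^{N_1}\frac{\widetilde a_j}{z-p_j}+\widetilde P_{N_2}(z),\qquad N=N_1+N_2,$$ with $P_{N_2},\widetilde P_{N_2}$ polynomials of degree $N_2=\mathcal{O}(\sqrt{N_1})$ (namely the approximants to $z^\alpha$ and to $z^\alpha\log z$ on $[0,1]$ described in the context), such that the rational functions $r_N(x^2)$ and $\widetilde r_N(x^2)$ of $x$, whose poles are the tapered lightning poles $$\widetilde p_{\pm j}=\pm i\sqrt{C}\exp\left(-\frac{\sigma}{2}(\sqrt{N_1}-\sqrt{j})\right),\qquad 1\le j\le N_1,$$ satisfy $$\left|r_N(x^2)-|x|^{2\alpha}\right|=\max\left\{\frac{|\sin(\alpha\pi)|}{\alpha\pi},\frac{|\sin(\alpha\pi)|}{(1-(\alpha))\pi}\right\}\cdot\begin{cases}\mathcal{O}\left(e^{-\sigma\alpha\sqrt{N}}\right),&\sigma\le\frac{2\pi}{\sqrt{\alpha}},\\[4pt] \dfrac{\mathcal{O}(1)}{e^{\frac{4\pi^2}{\sigma}\sqrt{N}}-1},&\sigma>\frac{2\pi}{\sqrt{\alpha}},\end{cases}$$ and $$\left|\widetilde r_N(x^2)-2|x|^{2\alpha}\log|x|\right|=\begin{cases}\mathcal{O}\left(\sqrt{N}e^{-\sigma\alpha\sqrt{N}}\right),&\sigma\le\frac{2\pi}{\sqrt{\alpha}},\\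 \mathcal{O}\left(e^{-\frac{4\pi^2}{\sigma}\sqrt{N}}\right),&\sigma>\frac{2\pi}{\sqrt{\alpha}},\end{cases}$$ as $N\to\infty$, uniformly for $x\in[-1,1]$.
   Context: $(\alpha)\in[0,1)$ is the fractional part of $\alpha$, and $|x|^{2\alpha}\log|x|$ is given the value $0$ at $x=0$. The functions $r_N$ and $\widetilde r_N$ are approximants of the stated form, with poles $p_j$, satisfying the following. With $\sigma_{\rm opt}=\frac{2\pi}{\sqrt\alpha}$ and $\eta=\sigma_{\rm opt}/\sigma$, uniformly for $z\in[0,1]$ as $N\to\infty$: $|r_N(z)-z^\alpha|$ equals $\max\{\frac{|\sin(\alpha\pi)|}{\alpha\pi},\frac{|\sin(\alpha\pi)|}{(1-(\alpha))\pi}\}$ times $\mathcal{O}(e^{-\sigma\alpha\sqrt N})$ if $\sigma\le\sigma_{\rm opt}$ and times $\mathcal{O}(e^{-2\pi\eta\sqrt{N\alpha}})$ if $\sigma>\sigma_{\rm opt}$; and $|\widetilde r_N(z)-z^\alpha\log z|$ is $\mathcal{O}(\sqrt N e^{-\sigma\alpha\sqrt N})$ if $\sigma\le\sigma_{\rm opt}$ and $\mathcal{O}(e^{-2\pi\eta\sqrt{N\alpha}})$ if $\sigma>\sigma_{\rm opt}$. Implied constants do not depend on $x$ or $N$. *)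

(* Defs.v *)
From mathcomp Require Import all_boot all_order all_algebra.
From mathcomp Require Import complex.
From mathcomp Require Import all_classical all_reals all_analysis.

Set Implicit Arguments.
Unset Strict Implicit.
Unset Printing Implicit Defensive.

Import Order.TTheory GRing.Theory Num.Theory.
Import numFieldNormedType.Exports.
Import ComplexField.Normc.

Local Open Scope classical_set_scope.
Local Open Scope complex_scope.
Local Open Scope ring_scope.

Definition frac_part (R : realType) (x : R) : R := x - (Num.floor x)%:~R.

Definition tapered_pole (R : realType) (C sigma : R) (n1 j : nat) : R :=
  - C * expR (- sigma * (Num.sqrt n1%:R - Num.sqrt j%:R)).

(* The sign is [+] for [s = false] and [-] for [s = true]. *)
Definition tapered_lightning_pole (R : realType) (C sigma : R) (n1 : nat)
    (s : bool) (j : nat) : R[i] :=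
  (-1) ^+ s * 'i%C *
  (Num.sqrt C * expR (- (sigma / 2) * (Num.sqrt n1%:R - Num.sqrt j%:R)))%:C.

Definition lightning_fun (R : realType) (C sigma : R) (n1 : nat)
    (a : nat -> R[i]) (P : {poly R[i]}) (z : R[i]) : R[i] :=
  \sum_(1 <= j < n1.+1) a j / (z - (tapered_pole C sigma n1 j)%:C) + P.[z].

(* [R[i]^o] is [R[i]] with the topology of its modulus. *)
Definition is_pole (R : realType) (f : R[i] -> R[i]) (z0 : R[i]) : Prop :=
  normc (f z) @[z --> (z0 : R[i]^o)^'] --> +oo.

(* [f N x = O(g N)] as [N --> oo], uniformly for [x] in [D]: [M] and
   the threshold on [N] do not depend on [x]. [normc] is the real-valued
   modulus. *)
Definition uniform_bigO (R : realType) (D : set R) (f : nat -> R -> R[i])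
    (g : nat -> R) : Prop :=
  exists M : R, \forall N \near \oo,
    forall x, D x -> normc (f N x) <= M * `|g N|.

(* Main.v *)
Require Import Defs.
From mathcomp Require Import all_boot all_order all_algebra.
From mathcomp Require Import complex.
From mathcomp Require Import all_classical all_reals all_analysis.
From mathcomp Require Import ring lra.
Import Order.TTheory GRing.Theory Num.Theory.
Import numFieldNormedType.Exports.
Import ComplexField.Normc.
Local Open Scope classical_set_scope.
Local Open Scope complex_scope.
Local Open Scope ring_scope.
Local Notation Re := complex.Re.
Local Notation Im := complex.Im.
Set Implicit Arguments.
Unset Strict Implicit.
Unset Printing Implicit Defensive.

(** Write the poles as p_j = - y_j, put S = sqrt N1 and let y(s) = C exp (sigma (s - S)),
so that y_j = y(sqrt j).  Both approximants are quadrature sums.  For e = 0 or 1 put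

  q(s) = sigma y^alpha (log y)^e z / (z + y),   y = y(s).

The sum of q(sqrt j) / (2 sqrt j) over 1 <= j <= M is a linear combination of the fractions
z / (z + y_j), and it is close to the integral of q over s.  The theorem follows from an analysis
of this integral, of the quadrature error, and of the degree of the polynomial part.

The integral is a power up to a polynomial.  With x = log y it is the integral of
exp (alpha x) x^e z / (z + exp x).  By y z / (z + y) = z - z * z / (z + y), lowering alpha by 1
only adds multiples of z and a factor - z, which reduces alpha = m + beta to beta in ]0, 1].
Over the whole line, beta < 1 gives a nonzero constant times z^beta when e = 0, and
z^beta (A1 + A0 log z) when e = 1 ([full_line_frac]); for beta = 1 and e = 0 the integral
diverges, but by a multiple of z only, and leaves - z log z ([full_line_one]).  What lies below
the first node costs O(S^e exp (- sigma alpha S)).  What lies beyond the last node is analytic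
in z near [0, 1], hence a polynomial of degree n up to a geometrically small error
([J_polyz], [sum_to_rational]); the same holds for the fractions with N1 < j <= M, so that M
may be taken a bounded amount beyond N1 on the scale of square roots.

The quadrature error.  Summation over the integers is integration against the limit of the
Fejer kernels in s^2 ([fejer_sum]).  Apart from its constant term such a kernel is the real part
of a power series in exp (2 pi i s^2), which decays like exp (- 4 pi Re s Im s) in the first
quadrant.  So the segment of integration is pushed up to the height 3 pi / (2 sigma).  The only
obstruction is the pole of q where y = - z, at height pi / sigma; the path passes below it, at a
distance of order 1 / Re s ([contour_near], [contour_far]).  The integral over the path is
at most a constant times the largest value of

  exp (alpha log y(t) - (4 pi^2 / sigma) t) (1 + |log y(t)|)^e

for t in the segment.  The exponent is affine in t.  Up to a constant, its maximum is
- sigma alpha S, reached on the left, when sigma alpha <= 4 pi^2 / sigma, that is when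
sigma <= 2 pi / sqrt alpha, and - (4 pi^2 / sigma) S, reached on the right, otherwise: this is the
dichotomy of the statement.  The path ends on a vertical segment above the right end, whose
contribution is again analytic in z and absorbed in the polynomial ([right_polyz]).

The degrees.  A multiple of sqrt N for the degree N2 makes the geometric errors negligible, and
sqrt N - sqrt (N - N2) stays bounded, so replacing S by sqrt N only changes constants
([err_asym]).

For an integer alpha the factor sin (alpha pi) vanishes, and r_N is z^alpha itself once
N2 >= alpha; otherwise that factor is a nonzero constant.  The approximants of z^alpha log z
combine those with e = 1 and e = 0, and when alpha is an integer come from e = 0 alone.  The
statements in x are those in z = x^2.

Integrals of complex functions along segments are increments of primitives, a primitive being
understood with a quadratic error bound.  Lipschitz functions have such primitives, and for
functions that are complex differentiable in the same uniform sense Cauchy's theorem on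
rectangles is an identity between two primitives ([cauchy_rect]). *)

(** * Moduli of complex numbers *)
Section Modulus.
Context {R : realType}.
Implicit Types (z w : R[i]) (x y : R).

Lemma normc_ge0 z : 0 <= normc z.
Proof. by case: z => a b; rewrite /normc sqrtr_ge0. Qed.

Lemma normcD z w : normc (z + w) <= normc z + normc w.
Proof. exact: le_normcD. Qed.

Lemma normcB z w : normc (z - w) <= normc z + normc w.
Proof. by rewrite (le_trans (normcD _ _))// normcN. Qed.

Lemma normc_sub_ge z w : normc z - normc w <= normc (z - w).
Proof. by have := normcD (z - w) w; rewrite subrK; lra. Qed.

Lemma normcR x : normc x%:C = `|x|.
Proof. by rewrite /normc /= expr0n /= addr0 sqrtr_sqr. Qed.

Lemma normci : normc ('i%C : R[i]) = 1.
Proof. by rewrite /normc /= expr0n expr1n /= add0r sqrtr1. Qed.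

Lemma normc_1 : normc (1 : R[i]) = 1. Proof. exact: normc1. Qed.

Lemma normcX z n : normc (z ^+ n) = normc z ^+ n.
Proof. by elim: n => [|n IH]; rewrite ?expr0 ?normc_1// !exprS normcM IH. Qed.

Lemma normc_eq0 z : (normc z == 0) = (z == 0).
Proof. by apply/eqP/eqP => [/eq0_normc//|->]; exact: normc0. Qed.

Lemma normc_gt0 z : (0 < normc z) = (z != 0).
Proof. by rewrite lt_neqAle normc_ge0 andbT eq_sym normc_eq0. Qed.

Lemma Re_le_normc z : `|Re z| <= normc z.
Proof.
case: z => a b; rewrite /normc/= -sqrtr_sqr ler_wsqrtr// lerDl sqr_ge0//.
Qed.

Lemma Im_le_normc z : `|Im z| <= normc z.
Proof.
case: z => a b; rewrite /normc/= -sqrtr_sqr ler_wsqrtr// lerDr sqr_ge0//.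
Qed.

Lemma normc_le_ReIm z : normc z <= `|Re z| + `|Im z|.
Proof.
have {1}-> : z = (Re z)%:C + 'i%C * (Im z)%:C.
  by case: z => a b; apply/eqP; rewrite eq_complex /=; apply/andP; split; apply/eqP; ring.
by rewrite (le_trans (normcD _ _))// normcM normci mul1r !normcR.
Qed.

Lemma normc_sum (I : Type) (r : seq I) (P : pred I) (F : I -> R[i]) :
  normc (\sum_(i <- r | P i) F i) <= \sum_(i <- r | P i) normc (F i).
Proof.
elim/big_ind2 : _ => //; first by rewrite normc0.
by move=> z x w y zx wy; rewrite (le_trans (normcD _ _))// lerD.
Qed.

Lemma ReD z w : Re (z + w) = Re z + Re w.
Proof. by case: z; case: w. Qed.
Lemma ImD z w : Im (z + w) = Im z + Im w.
Proof. by case: z; case: w. Qed.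
Lemma ReN z : Re (- z) = - Re z. Proof. by case: z. Qed.
Lemma ImN z : Im (- z) = - Im z. Proof. by case: z. Qed.
Lemma ReM z w : Re (z * w) = Re z * Re w - Im z * Im w.
Proof. by case: z; case: w. Qed.
Lemma ImM z w : Im (z * w) = Re z * Im w + Im z * Re w.
Proof. by case: z; case: w. Qed.

End Modulus.

(** * The complex exponential *)
Section Cexp.
Context {R : realType}.
Implicit Types (z w : R[i]) (x y : R).

Definition cexp z : R[i] :=
  (expR (Re z) * cos (Im z)) +i* (expR (Re z) * sin (Im z)).

Lemma cexpD z w : cexp (z + w) = cexp z * cexp w.
Proof.
apply/eqP; rewrite eq_complex /cexp /= ReD ImD expRD cosD sinD.
by apply/andP; split; apply/eqP; ring.
Qed.

Lemma cexp0 : cexp 0 = 1.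
Proof. by rewrite /cexp /= expR0 cos0 sin0 mulr1 mulr0. Qed.

Lemma cexpR x : cexp x%:C = (expR x)%:C.
Proof. by rewrite /cexp /= cos0 sin0 mulr1 mulr0. Qed.

Lemma normc_cexp z : normc (cexp z) = expR (Re z).
Proof.
rewrite /cexp /normc !exprMn -mulrDr cos2Dsin2 mulr1 sqrtr_sqr ger0_norm//.
Qed.

Lemma cexp_neq0 z : cexp z != 0.
Proof. by rewrite -normc_gt0 normc_cexp expR_gt0. Qed.

Lemma cexpN z : cexp (- z) = (cexp z)^-1.
Proof.
apply: (mulfI (cexp_neq0 z)); rewrite -cexpD subrr cexp0 divff//.
exact: cexp_neq0.
Qed.

Lemma cexpMn z n : cexp (z *+ n) = cexp z ^+ n.
Proof. by elim: n => [|n IH]; rewrite ?cexp0 ?mulr0n// mulrS exprS cexpD IH. Qed.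

Lemma expR_quad x : `|expR x - 1 - x| <= x ^+ 2 * expR `|x|.
Proof.
have h0 := expR_ge1Dx x; have e0 := expR_gt0 x.
have h1 : 1 - x <= expR (- x) by have := expR_ge1Dx (- x).
have h2 : expR x - 1 <= x * expR x.
  have : (1 - x) * expR x <= 1.
    by rewrite (le_trans (ler_wpM2r (ltW e0) h1))// mulrC expRxMexpNx_1.
  lra.
rewrite ger0_norm; last lra.
have [x0|x0] := leP 0 x.
  rewrite ger0_norm//; nra.
rewrite ltr0_norm//.
have e1 : expR x <= 1 by rewrite expR_le1 ltW.
have e2 : 1 <= expR (- x) by lra.
have : expR x - 1 - x <= x ^+ 2 by nra.
have := sqr_ge0 x; nra.
Qed.

Lemma sin_le_id x : 0 <= x -> sin x <= x.
Proof.
move=> x0.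
have [c _] := @MVT_segment R sin cos 0 x x0 (fun y _ => is_derive_sin y)
   (continuous_subspaceT (@continuous_sin R)).
rewrite sin0 !subr0 => ->; rewrite ler_piMl//; exact: cos_le1.
Qed.

Lemma norm_sin_le x : `|sin x| <= `|x|.
Proof.
have H (y : R) : 0 <= y -> `|sin y| <= `|y|.
  move=> y0; rewrite (ger0_norm y0) ler_norml sin_le_id// andbT.
  have := sin_le_id y0; have [y1|y1] := leP y pi.
    by move=> _; rewrite (@le_trans _ _ 0)// ?oppr_le0// sin_ge0_pi// y0.
  have := sin_geN1 y; have := @pi_ge2 R; lra.
have [x0|/ltW x0] := leP 0 x; first exact: H.
by rewrite -normrN -sinN -(normrN x) H// oppr_ge0.
Qed.

Lemma cos_quad x : `|cos x - 1| <= x ^+ 2.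
Proof.
have -> : cos x = 1 - 2 * sin (x / 2) ^+ 2.
  have {1}-> : x = (x / 2) *+ 2 by rewrite mulr2n; lra.
  by rewrite cos_mulr2n cos2sin2 !mulr2n; ring.
have := norm_sin_le (x / 2); rewrite -(@ler_pXn2r _ 2)// ?nnegrE//.
rewrite !real_normK ?num_real// => h.
rewrite addrAC subrr add0r normrN ger0_norm ?(mulr_ge0 _ (sqr_ge0 _))//.
by move: h (sqr_ge0 x); rewrite exprMn exprVn; nra.
Qed.

Lemma sin_quad x : `|sin x - x| <= x ^+ 2.
Proof.
have C1 (y : R) : `|cos y - 1| <= `|y|.
  have [y1|y1] := leP 2 `|y|.
    have := cos_geN1 y; have := cos_le1 y.
    by move=> ? ?; rewrite ler_norml; apply/andP; split; lra.
  have -> : cos y = 1 - 2 * sin (y / 2) ^+ 2.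
    have {1}-> : y = (y / 2) *+ 2 by rewrite mulr2n; lra.
    by rewrite cos_mulr2n cos2sin2 !mulr2n; ring.
  have := norm_sin_le (y / 2); rewrite -(@ler_pXn2r _ 2)// ?nnegrE//.
  rewrite !real_normK ?num_real// => h.
  rewrite addrAC subrr add0r normrN ger0_norm ?(mulr_ge0 _ (sqr_ge0 _))//.
  move: h; rewrite exprMn exprVn -(real_normK (num_real y)).
  have := normr_ge0 y; nra.
have H (y : R) : 0 <= y -> `|sin y - y| <= y ^+ 2.
  move=> y0.
  have [c] := @MVT_segment R sin cos 0 y y0 (fun y _ => is_derive_sin y)
    (continuous_subspaceT (@continuous_sin R)).
  rewrite in_itv/= => /andP[c0 cy]; rewrite sin0 !subr0 => ->.
  rewrite -{2}(mul1r y) -mulrBl normrM (ger0_norm y0).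
  have := C1 c; rewrite (ger0_norm c0); have := normr_ge0 (cos c - 1); nra.
have [x0|/ltW x0] := leP 0 x; first exact: H.
have := H (- x); rewrite oppr_ge0 => /(_ x0).
by rewrite sinN -opprD normrN sqrrN.
Qed.

(** Uniformity in h is what lets the exponential act on functions that are differentiable with
a uniform quadratic error. *)
Lemma cexp_quad (K : R) : exists2 C : R, 0 <= C & forall h : R[i], normc h <= K ->
  normc (cexp h - 1 - h) <= C * normc h ^+ 2.
Proof.
exists (2 * expR `|K| + `|K| + 2).
  by have := expR_ge0 `|K|; have := normr_ge0 K; lra.
move=> h hK.
have aK := Re_le_normc h; have bK := Im_le_normc h.
set a := Re h in aK *; set b := Im h in bK *.
have h0 := normc_ge0 h.
have hK' : normc h <= `|K| by rewrite (le_trans hK)// ler_norm.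
have e1 : expR `|a| <= expR `|K| by rewrite ler_expR; lra.
have e0 : 1 <= expR `|K| by have := expR_ge1Dx `|K|; have := normr_ge0 K; lra.
have a2 : a ^+ 2 <= normc h ^+ 2.
  by rewrite -(real_normK (num_real a)) lerXn2r ?nnegrE.
have b2 : b ^+ 2 <= normc h ^+ 2.
  by rewrite -(real_normK (num_real b)) lerXn2r ?nnegrE.
have ea := expR_quad a.
have ea1 : `|expR a - 1 - a| <= normc h ^+ 2 * expR `|K|.
  by rewrite (le_trans ea)// ler_pM// ?sqr_ge0// expR_ge0.
have ea2 : `|expR a - 1| <= normc h * expR `|K|.
  have l1 := expR_ge1Dx a; have l2 := expR_ge1Dx (- a).
  have e2 := expR_gt0 a.
  have h2 : expR a - 1 <= a * expR a.
    have : (1 - a) * expR a <= 1.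
      by rewrite (le_trans (ler_wpM2r (ltW e2) l2))// mulrC expRxMexpNx_1.
    lra.
  have e3 : expR a <= expR `|K| by rewrite (le_trans _ e1)// ler_expR ler_norm.
  move: aK; rewrite ler_norml => /andP[aK1 aK2].
  rewrite ler_norml; apply/andP; split; first nra.
  have [a0|a0] := leP 0 a; last nra.
  rewrite (le_trans h2)// ler_pM//; lra.
rewrite (le_trans (normc_le_ReIm _))// !ReD !ImD !ReN !ImN /cexp /= -/a -/b.
rewrite oppr0 addr0.
have -> : expR a * cos b - 1 - a =
   (expR a - 1 - a) * cos b + (1 + a) * (cos b - 1) by ring.
have -> : expR a * sin b - b = (expR a - 1) * sin b + (sin b - b) by ring.
have t1 : `|(expR a - 1 - a) * cos b + (1 + a) * (cos b - 1)| <=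
   normc h ^+ 2 * expR `|K| + (1 + `|K|) * normc h ^+ 2.
  rewrite (le_trans (ler_normD _ _))// !normrM lerD//.
    rewrite (le_trans _ ea1)// ler_piMr//; exact: cos_max.
  rewrite ler_pM//.
    by rewrite (le_trans (ler_normD _ _))// normr1; lra.
  by rewrite (le_trans (cos_quad _)).
have t2 : `|(expR a - 1) * sin b + (sin b - b)| <=
   normc h * expR `|K| * normc h + normc h ^+ 2.
  rewrite (le_trans (ler_normD _ _))// normrM lerD//.
    by rewrite ler_pM// (le_trans (norm_sin_le _)).
  by rewrite (le_trans (sin_quad _)).
by rewrite (le_trans (lerD t1 t2))//; nra.
Qed.

End Cexp.

(** * Complex differentiability with a uniform quadratic error *)
Section Hol.
Context {R : realType}.
Implicit Types (Om : R[i] -> Prop) (G D H E : R[i] -> R[i]).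

(** D is the derivative of G on Om.  Asking for one constant that bounds G, D and the Taylor
remainder makes the class stable under sums, products, inverses and exponentials, and needs no
limits. *)
Definition holD Om G D := exists2 K : R, 0 <= K & forall w w', Om w -> Om w' ->
  [/\ normc (G w) <= K, normc (D w) <= K &
      normc (G w' - G w - D w * (w' - w)) <= K * normc (w' - w) ^+ 2].

Lemma holD_sub Om Om' G D : (forall w, Om' w -> Om w) ->
  holD Om G D -> holD Om' G D.
Proof. by move=> sub [K K0 H]; exists K => // w w' /sub ? /sub ?; exact: H. Qed.

Lemma holD_lip Om G D : holD Om G D -> exists2 L : R, 0 <= L &
  forall w w', Om w -> Om w' -> normc (G w' - G w) <= L * normc (w' - w).
Proof.
move=> [K K0 H]; exists (2 * K); first lra.
move=> w w' ww ww'.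
have [h1 h2 h3] := H _ _ ww ww'; have [h4 _ _] := H _ _ ww' ww.
have d0 := normc_ge0 (w' - w).
have [d1|d1] := leP (normc (w' - w)) 1.
  have -> : G w' - G w = (G w' - G w - D w * (w' - w)) + D w * (w' - w) by ring.
  rewrite (le_trans (normcD _ _))// normcM.
  have b1 : normc (D w) * normc (w' - w) <= K * normc (w' - w) by rewrite ler_wpM2r.
  have b2 : K * normc (w' - w) ^+ 2 <= K * normc (w' - w).
    by rewrite ler_wpM2l// expr2 ler_piMr.
  lra.
rewrite (le_trans (normcB _ _))//; nra.
Qed.

Lemma holD_cst Om (c : R[i]) : holD Om (fun=> c) (fun=> 0).
Proof.
exists (normc c); first exact: normc_ge0.
move=> w w' _ _; split => //; first by rewrite normc0 normc_ge0.
by rewrite subrr mul0r subrr normc0 mulr_ge0 ?normc_ge0 ?exprn_ge0 ?normc_ge0.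
Qed.

Lemma holD_id Om (B : R) : (forall w, Om w -> normc w <= B) -> holD Om id (fun=> 1).
Proof.
move=> HB; exists (`|B| + 1); first by have := normr_ge0 B; lra.
have B0 := normr_ge0 B; have BB := ler_norm B.
move=> w w' /HB ww /HB ww'; split; [by rewrite /=; lra|by rewrite normc_1; lra|].
by rewrite mul1r subrr normc0 mulr_ge0 ?exprn_ge0 ?normc_ge0; lra.
Qed.

Lemma holDD Om G D H E : holD Om G D -> holD Om H E ->
  holD Om (fun w => G w + H w) (fun w => D w + E w).
Proof.
move=> [K K0 h] [L L0 k]; exists (K + L); first lra.
move=> w w' ww ww'; have [h1 h2 h3] := h _ _ ww ww'; have [k1 k2 k3] := k _ _ ww ww'.
split; first by rewrite (le_trans (normcD _ _))// lerD.
  by rewrite (le_trans (normcD _ _))// lerD.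
have -> : G w' + H w' - (G w + H w) - (D w + E w) * (w' - w) =
  (G w' - G w - D w * (w' - w)) + (H w' - H w - E w * (w' - w)) by ring.
by rewrite (le_trans (normcD _ _))// mulrDl lerD.
Qed.

Lemma holDM Om G D H E : holD Om G D -> holD Om H E ->
  holD Om (fun w => G w * H w) (fun w => D w * H w + G w * E w).
Proof.
move=> hG hH; have [L L0 lip] := holD_lip hH.
case: hG hH => [K K0 h] [M M0 k].
exists (2 * K * M + K * L); first by rewrite addr_ge0 ?mulr_ge0.
move=> w w' ww ww'; have [h1 h2 h3] := h _ _ ww ww'; have [k1 k2 k3] := k _ _ ww ww'.
have [k4 _ _] := k _ _ ww' ww; have l := lip _ _ ww ww'.
have KL : 0 <= K * L by rewrite mulr_ge0.
have KM : 0 <= K * M by rewrite mulr_ge0.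
have b1 : normc (G w) * normc (H w) <= K * M by rewrite ler_pM ?normc_ge0.
have b2 : normc (D w) * normc (H w) <= K * M by rewrite ler_pM ?normc_ge0.
have b3 : normc (G w) * normc (E w) <= K * M by rewrite ler_pM ?normc_ge0.
split; first by rewrite normcM; lra.
  by rewrite (le_trans (normcD _ _))// !normcM; lra.
have -> : G w' * H w' - G w * H w - (D w * H w + G w * E w) * (w' - w) =
  (G w' - G w - D w * (w' - w)) * H w' + D w * (w' - w) * (H w' - H w) +
  G w * (H w' - H w - E w * (w' - w)) by ring.
set d := normc (w' - w) in h3 k3 l *.
have d0 : 0 <= d by exact: normc_ge0.
have e1 : normc ((G w' - G w - D w * (w' - w)) * H w') <= K * d ^+ 2 * M.
  by rewrite normcM ler_pM ?normc_ge0.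
have e2 : normc (D w * (w' - w) * (H w' - H w)) <= K * d * (L * d).
  by rewrite !normcM ler_pM ?mulr_ge0 ?normc_ge0// ler_pM ?normc_ge0.
have e3 : normc (G w * (H w' - H w - E w * (w' - w))) <= K * (M * d ^+ 2).
  by rewrite normcM ler_pM ?normc_ge0.
have := normcD ((G w' - G w - D w * (w' - w)) * H w' + D w * (w' - w) * (H w' - H w))
  (G w * (H w' - H w - E w * (w' - w))).
have := normcD ((G w' - G w - D w * (w' - w)) * H w') (D w * (w' - w) * (H w' - H w)).
move: e1 e2 e3; move: (normc _) (normc _) (normc _) (normc _) (normc _) => *; lra.
Qed.

Lemma holDZ Om (c : R[i]) G D : holD Om G D ->
  holD Om (fun w => c * G w) (fun w => c * D w).
Proof.
move=> h; have := holDM (holD_cst Om c) h.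
by rewrite (_ : (fun w => _ + _) = fun w => c * D w)//; apply/funext => w; ring.
Qed.

Lemma holDV Om G D (c : R) : 0 < c -> (forall w, Om w -> c <= normc (G w)) ->
  holD Om G D -> holD Om (fun w => (G w)^-1) (fun w => - (D w / (G w) ^+ 2)).
Proof.
move=> c0 Gc hG; have [L L0 lip] := holD_lip hG; case: hG => [K K0 h].
have ci : 0 < c^-1 by rewrite invr_gt0.
exists (c^-1 + K * c^-1 ^+ 2 + K * L * c^-1 ^+ 3).
  by rewrite !addr_ge0 ?mulr_ge0 ?exprn_ge0// ltW.
move=> w w' ww ww'; have [h1 h2 h3] := h _ _ ww ww'.
have l := lip _ _ ww ww'.
have I x : Om x -> normc (G x)^-1 <= c^-1 /\ G x != 0.
  move=> xx; have g := Gc _ xx; have gx : 0 < normc (G x) by lra.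
  by rewrite normcV lef_pV2 ?posrE//; split => //; rewrite -normc_gt0.
have [i1 n1] := I _ ww; have [i2 n2] := I _ ww'.
have p1 : 0 <= K * c^-1 ^+ 2 by rewrite mulr_ge0 ?exprn_ge0// ltW.
have p2 : 0 <= K * L * c^-1 ^+ 3 by rewrite !mulr_ge0 ?exprn_ge0// ltW.
split; first by lra.
  rewrite normcN normcM normcV normcX -exprVn -normcV.
  have : normc (D w) * normc (G w)^-1 ^+ 2 <= K * c^-1 ^+ 2.
    by rewrite ler_pM ?exprn_ge0 ?normc_ge0// lerXn2r ?nnegrE ?normc_ge0// ltW.
  lra.
have -> : (G w')^-1 - (G w)^-1 - - (D w / G w ^+ 2) * (w' - w) =
  - ((G w' - G w - D w * (w' - w)) * (G w)^-1 * (G w')^-1) +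
  D w * (w' - w) * (G w' - G w) * ((G w)^-1 ^+ 2 * (G w')^-1).
  by field; rewrite n1 n2.
set d := normc (w' - w) in h3 l *.
have d0 : 0 <= d by exact: normc_ge0.
have e1 : normc (- ((G w' - G w - D w * (w' - w)) * (G w)^-1 * (G w')^-1)) <=
  K * d ^+ 2 * c^-1 * c^-1.
  by rewrite normcN !normcM !ler_pM ?mulr_ge0 ?normc_ge0.
have e2 : normc (D w * (w' - w) * (G w' - G w) * ((G w)^-1 ^+ 2 * (G w')^-1)) <=
  K * d * (L * d) * (c^-1 ^+ 2 * c^-1).
  rewrite !expr2 !normcM !ler_pM ?mulr_ge0 ?normc_ge0//.
rewrite (le_trans (normcD _ _))// (le_trans (lerD e1 e2))//.
have : 0 <= c^-1 * d ^+ 2 by rewrite mulr_ge0 ?exprn_ge0// ltW.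
move: (c^-1) => e; lra.
Qed.

Lemma holD_cexp Om G D : holD Om G D ->
  holD Om (fun w => cexp (G w)) (fun w => cexp (G w) * D w).
Proof.
move=> hG; have [L L0 lip] := holD_lip hG; case: hG => [K K0 h].
have [C C0 q] := @cexp_quad R (2 * K).
have eK := expR_ge0 K.
exists (expR K + expR K * K + expR K * (C * L ^+ 2)).
  by rewrite !addr_ge0 ?mulr_ge0 ?exprn_ge0.
move=> w w' ww ww'; have [h1 h2 h3] := h _ _ ww ww'; have [h4 _ _] := h _ _ ww' ww.
have l := lip _ _ ww ww'.
have E1 : normc (cexp (G w)) <= expR K.
  by rewrite normc_cexp ler_expR (le_trans _ h1)// (le_trans (ler_norm _))// Re_le_normc.
have p1 : 0 <= expR K * K by rewrite mulr_ge0.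
have p2 : 0 <= expR K * (C * L ^+ 2) by rewrite !mulr_ge0 ?exprn_ge0.
split; first by lra.
  rewrite normcM.
  have : normc (cexp (G w)) * normc (D w) <= expR K * K by rewrite ler_pM ?normc_ge0.
  lra.
have -> : cexp (G w') = cexp (G w) * cexp (G w' - G w).
  by rewrite -cexpD; congr cexp; ring.
set d := G w' - G w in h3 l *.
have -> : cexp (G w) * cexp d - cexp (G w) - cexp (G w) * D w * (w' - w) =
  cexp (G w) * ((cexp d - 1 - d) + (d - D w * (w' - w))) by ring.
have dK : normc d <= 2 * K by rewrite (le_trans (normcB _ _))//; lra.
have := q _ dK => qd.
rewrite normcM.
have d2 : normc d ^+ 2 <= L ^+ 2 * normc (w' - w) ^+ 2.
  by rewrite -exprMn lerXn2r ?nnegrE ?mulr_ge0 ?normc_ge0.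
have -> : (expR K + expR K * K + expR K * (C * L ^+ 2)) * normc (w' - w) ^+ 2 =
  expR K * (normc (w' - w) ^+ 2 + (C * (L ^+ 2 * normc (w' - w) ^+ 2) +
   K * normc (w' - w) ^+ 2)) by ring.
rewrite ler_pM ?normc_ge0// (le_trans (normcD _ _))//.
have := ler_wpM2l C0 d2; have := sqr_ge0 (normc (w' - w)); lra.
Qed.

Definition hol Om G := exists D, holD Om G D.

Lemma hol_sub Om Om' G : (forall w, Om' w -> Om w) -> hol Om G -> hol Om' G.
Proof. by move=> s [D h]; exists D; exact: holD_sub s h. Qed.

Lemma hol_cst Om c : hol Om (fun=> c).
Proof. by exists (fun=> 0); exact: holD_cst. Qed.

Lemma hol_add Om G H : hol Om G -> hol Om H -> hol Om (fun w => G w + H w).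
Proof. by move=> [D h] [E k]; eexists; exact: holDD h k. Qed.

Lemma hol_mul Om G H : hol Om G -> hol Om H -> hol Om (fun w => G w * H w).
Proof. by move=> [D h] [E k]; eexists; exact: holDM h k. Qed.

Lemma hol_inv Om G (c : R) : 0 < c -> (forall w, Om w -> c <= normc (G w)) ->
  hol Om G -> hol Om (fun w => (G w)^-1).
Proof. by move=> c0 Gc [D h]; eexists; exact: holDV c0 Gc h. Qed.

Lemma hol_cexp Om G : hol Om G -> hol Om (fun w => cexp (G w)).
Proof. by move=> [D h]; eexists; exact: holD_cexp h. Qed.

Lemma hol_exp Om G n : hol Om G -> hol Om (fun w => G w ^+ n).
Proof.
move=> hG; elim: n => [|n IH]; first exact: hol_cst.
under eq_fun do rewrite exprS.
exact: hol_mul.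
Qed.

Lemma hol_sum Om (I : Type) (r : seq I) (F : I -> R[i] -> R[i]) :
  (forall i, hol Om (F i)) -> hol Om (fun w => \sum_(i <- r) F i w).
Proof.
move=> hF; elim: r => [|i r IH].
  by under eq_fun do rewrite big_nil; exact: hol_cst.
by under eq_fun do rewrite big_cons; exact: hol_add.
Qed.

End Hol.

(** * Integrals as increments of primitives *)
Section Primitive.
Context {R : realType}.
Implicit Types (f g F : R -> R[i]) (a b c x y : R).

(** A pointwise derivative with a uniform quadratic error; it determines increments of F by
subdivision, see [uprim_le]. *)
Definition uprim a b f F := exists2 K : R, 0 <= K & forall x y,
  a <= x <= b -> a <= y <= b ->
  normc (F y - F x - f x * (y - x)%:C) <= K * (y - x) ^+ 2.

Definition lip a b f := exists2 L : R, 0 <= L & forall x y,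
  a <= x <= b -> a <= y <= b -> normc (f y - f x) <= L * `|y - x|.

Lemma le_arch (u v M : R) : (forall n, u <= v + M / n.+1%:R) -> u <= v.
Proof.
move=> h; rewrite leNgt; apply/negP => vu.
have M0 : 0 < M.
  have := h 0%N; rewrite divr1 => ?; lra.
pose n := Num.truncn (M / (u - v)).
have := truncnS_gt (M / (u - v)); rewrite -/n ltr_pdivrMr ?subr_gt0// => hn.
have := h n; rewrite -lerBlDl ler_pdivlMr ?ltr0n//; lra.
Qed.

Lemma uprim_ext a b f g F : (forall x, a <= x <= b -> f x = g x) ->
  uprim a b f F -> uprim a b g F.
Proof. by move=> e [K K0 h]; exists K => // x y xx yy; rewrite -e// h. Qed.

Lemma uprim_sub a b c d f F : a <= c -> d <= b -> uprim a b f F -> uprim c d f F.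
Proof.
move=> ac db [K K0 h]; exists K => // x y /andP[? ?] /andP[? ?].
by apply: h; apply/andP; split; lra.
Qed.

Lemma uprimD a b f F g H : uprim a b f F -> uprim a b g H ->
  uprim a b (fun x => f x + g x) (fun x => F x + H x).
Proof.
move=> [K K0 h] [L L0 k]; exists (K + L); first lra.
move=> x y xx yy.
have -> : F y + H y - (F x + H x) - (f x + g x) * (y - x)%:C =
  (F y - F x - f x * (y - x)%:C) + (H y - H x - g x * (y - x)%:C) by ring.
by rewrite (le_trans (normcD _ _))// mulrDl lerD// ?h ?k.
Qed.

Lemma uprimZ a b f F (c : R[i]) : uprim a b f F ->
  uprim a b (fun x => c * f x) (fun x => c * F x).
Proof.
move=> [K K0 h]; exists (normc c * K); first by rewrite mulr_ge0 ?normc_ge0.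
move=> x y xx yy.
have -> : c * F y - c * F x - c * f x * (y - x)%:C =
  c * (F y - F x - f x * (y - x)%:C) by ring.
by rewrite normcM -mulrA ler_wpM2l ?normc_ge0// h.
Qed.

Lemma uprim_cst a b (c : R[i]) : uprim a b (fun=> c) (fun x => c * x%:C).
Proof.
exists 0 => // x y _ _; rewrite mul0r.
have -> : c * y%:C - c * x%:C - c * (y - x)%:C = 0 by rewrite rmorphB /=; ring.
by rewrite normc0.
Qed.

(** On n equal pieces of [a, b] the two quadratic errors add up to O(1 / n), so the
comparison of the derivatives passes to the increments. *)
Lemma uprim_le a b f F g H : a <= b -> uprim a b f F -> uprim a b g H ->
  (forall x, a <= x <= b -> normc (f x) <= Re (g x)) ->
  normc (F b - F a) <= Re (H b - H a).
Proof.
move=> ab [K K0 h] [L L0 k] fg.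
apply: (@le_arch _ _ ((K + L) * (b - a) ^+ 2)) => n.
pose h0 := (b - a) / n.+1%:R; pose t m : R := a + m%:R * h0.
have n0 : (0 : R) < n.+1%:R by rewrite ltr0n.
have h00 : 0 <= h0 by rewrite divr_ge0// ?subr_ge0// ltW.
have tn : t n.+1 = b by rewrite /t /h0 mulrC divfK ?gt_eqF//; ring.
have tab m : (m <= n.+1)%N -> a <= t m <= b.
  move=> mn; rewrite /t lerDl mulr_ge0//= -tn /t lerD2l ler_wpM2r//.
  by rewrite ler_nat.
have step m : (m <= n.+1)%N -> normc (F (t m) - F a) <=
    Re (H (t m) - H a) + m%:R * ((K + L) * h0 ^+ 2).
  elim: m => [_|m IH mn].
    by rewrite /t !mul0r !addr0 !subrr normc0.
  have {}IH := IH (ltnW mn).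
  have d : t m.+1 - t m = h0 by rewrite /t -(natr1 m); ring.
  have := h _ _ (tab _ (ltnW mn)) (tab _ mn); rewrite d => hm.
  have := k _ _ (tab _ (ltnW mn)) (tab _ mn); rewrite d => km.
  have fm := fg _ (tab _ (ltnW mn)).
  have -> : F (t m.+1) - F a = (F (t m) - F a) +
    ((F (t m.+1) - F (t m) - f (t m) * h0%:C) + f (t m) * h0%:C) by ring.
  have n1 := normcD (F (t m) - F a)
    ((F (t m.+1) - F (t m) - f (t m) * h0%:C) + f (t m) * h0%:C).
  have n2 := normcD (F (t m.+1) - F (t m) - f (t m) * h0%:C) (f (t m) * h0%:C).
  have n3 : normc (f (t m) * h0%:C) <= Re (g (t m)) * h0.
    by rewrite normcM normcR (ger0_norm h00) ler_wpM2r.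
  have n4 : - (L * h0 ^+ 2) <= Re (H (t m.+1) - H (t m) - g (t m) * h0%:C).
    have := Re_le_normc (H (t m.+1) - H (t m) - g (t m) * h0%:C).
    by rewrite ler_norml => /andP[]; lra.
  have e : m.+1%:R * ((K + L) * h0 ^+ 2) = m%:R * ((K + L) * h0 ^+ 2) + (K + L) * h0 ^+ 2.
    by rewrite -(natr1 m); ring.
  rewrite e; move: n4 IH; rewrite !ReD !ReN ReM /= mulr0 subr0; lra.
have := step _ (leqnn _); rewrite tn.
have -> : n.+1%:R * ((K + L) * h0 ^+ 2) = (K + L) * (b - a) ^+ 2 / n.+1%:R.
  by rewrite /h0; field; rewrite gt_eqF.
by [].
Qed.

Lemma uprim_uniq a b f F H : a <= b -> uprim a b f F -> uprim a b f H ->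
  F b - F a = H b - H a.
Proof.
move=> ab uF uH; apply/eqP; rewrite -subr_eq0 -normc_eq0 eq_le normc_ge0 andbT.
have u := uprimD uF (uprimZ (-1) uH).
have := uprim_le ab u (uprim_cst a b 0).
rewrite !mul0r subrr /= => hh; apply: le_trans (hh _).
  by rewrite le_eqVlt; apply/orP; left; apply/eqP; congr normc; ring.
by move=> x _; rewrite mulN1r subrr normc0.
Qed.

Definition cint a b f : R[i] :=
  let F := xget (fun=> 0) [set F | uprim a b f F] in F b - F a.

Lemma cintE a b f F : a <= b -> uprim a b f F -> cint a b f = F b - F a.
Proof.
move=> ab uF; rewrite /cint; case: xgetP => [H _ uH|/(_ F)//].
exact: uprim_uniq ab uH uF.
Qed.

(** Extend f beyond [a, b] by constants, and use the fundamental theorem of calculus for the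
Lebesgue integral together with the mean value theorem. *)
Lemma real_prim a b (f : R -> R) (L : R) : a <= b -> 0 <= L ->
  (forall x y, a <= x <= b -> a <= y <= b -> `|f y - f x| <= L * `|y - x|) ->
  exists F : R -> R, forall x y, a <= x <= b -> a <= y <= b ->
   `|F y - F x - f x * (y - x)| <= L * (y - x) ^+ 2.
Proof.
move=> ab L0 hf.
pose cl (x : R) := Num.max a (Num.min b x).
have clab x : a <= cl x <= b.
  by rewrite /cl le_max lexx /= ge_max ab ge_min lexx.
have clid x : a <= x <= b -> cl x = x.
  by move=> /andP[ax xb]; rewrite /cl min_r// max_r.
have cllip x y : `|cl y - cl x| <= `|y - x|.
  have hm (u v : R) : u <= v -> `|cl v - cl u| <= `|v - u|.
    move=> uv; rewrite (@ger0_norm _ (v - u)) ?subr_ge0//.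
    rewrite ger0_norm /cl ?subr_ge0.
      have [bv|bv] := leP b v; have [bu|bu] := leP b u; rewrite ?(max_r ab); try lra.
        by have [au|au] := leP a u; lra.
      by have [av|av] := leP a v; have [au|au] := leP a u; lra.
    by rewrite le_max2// le_min2.
  have [xy|/ltW yx] := leP x y; first exact: hm.
  by rewrite distrC (distrC y) hm.
pose ft x := f (cl x).
have ftl x y : `|ft y - ft x| <= L * `|y - x|.
  by rewrite (le_trans (hf _ _ (clab _) (clab _)))// ler_wpM2l.
have ftc : continuous ft.
  move=> x; apply/cvgrPdist_lt => e e0.
  have L1 : 0 < L + 1 by lra.
  near=> y; rewrite distrC (le_lt_trans (ftl _ _))//.
  have : `|x - y| < e / (L + 1).
    by near: y; exact: (nbhsx_ballx x _ (divr_gt0 e0 L1)).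
  rewrite distrC.
  rewrite ltr_pdivlMr// => ?; have := normr_ge0 (y - x); nra.
pose F x := (\int[@lebesgue_measure R]_(t in `[(a - 1), x]) ft t)%R.
have itg : (@lebesgue_measure R).-integrable `[(a - 1), (b + 1)] (EFin \o ft).
  apply: continuous_compact_integrable; first exact: segment_compact.
  exact: continuous_subspaceT.
have dF x : a <= x <= b -> is_derive x 1 F (ft x).
  move=> /andP[ax xb].
  have xb1 : x < b + 1 by lra.
  have ax1 : a - 1 < x by lra.
  have [d e] := continuous_FTC1_closed xb1 itg ax1 (ftc x).
  exact: (DeriveDef d (etrans (esym (derive1E F x)) e)).
exists F.
have H x y : a <= x -> x <= y -> y <= b -> exists2 c, x <= c <= y & F y - F x = ft c * (y - x).
  move=> ax xy yb; have [c cx ->] : exists2 c, c \in `[x, y]%R & F y - F x = ft c * (y - x).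
    apply: MVT_segment => //.
      move=> z; rewrite in_itv/= => /andP[? ?]; apply: dF; apply/andP; split; lra.
    apply: derivable_within_continuous => z; rewrite in_itv/= => /andP[? ?].
    have [] : is_derive z 1 F (ft z) by apply: dF; apply/andP; split; lra.
    by [].
  by exists c.
move=> x y xab yab; move: (xab) (yab) => /andP[ax xb] /andP[ay yb].
have fx : ft x = f x by rewrite /ft clid.
rewrite -fx.
have [xy|/ltW yx] := leP x y.
  have [c /andP[xc cy] ->] := H _ _ ax xy yb.
  rewrite -mulrBl normrM expr2 mulrA.
  have := ftl x c; rewrite (ger0_norm (_ : 0 <= y - x)) ?subr_ge0// (ger0_norm (_ : 0 <= c - x)) ?subr_ge0//.
  move=> h; rewrite ler_wpM2r ?subr_ge0// (le_trans h)// ler_wpM2l//; lra.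
have [c /andP[yc cx] e] := H _ _ ay yx xb.
have -> : F y - F x - ft x * (y - x) = (ft c - ft x) * (y - x).
  by rewrite mulrBl; congr (_ - _); rewrite -(opprB (F x)) e; ring.
rewrite normrM expr2 mulrA.
have := ftl x c; rewrite (ler0_norm (_ : y - x <= 0)) ?subr_le0// (ler0_norm (_ : c - x <= 0)) ?subr_le0//.
move=> h; have -> : L * (y - x) * (y - x) = L * - (y - x) * - (y - x) by ring.
rewrite ler_wpM2r ?oppr_ge0 ?subr_le0// (le_trans h)// ler_wpM2l//; lra.
Unshelve. all: by end_near. Qed.

Lemma lip_prim a b f : a <= b -> lip a b f -> exists F, uprim a b f F.
Proof.
move=> ab [L L0 hf].
have [|F1 h1] := @real_prim a b (fun x => Re (f x)) L ab L0.
  move=> x y xx yy; rewrite -ReN -ReD (le_trans (Re_le_normc _))// hf//.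
have [|F2 h2] := @real_prim a b (fun x => Im (f x)) L ab L0.
  move=> x y xx yy; rewrite -ImN -ImD (le_trans (Im_le_normc _))// hf//.
exists (fun x => F1 x +i* F2 x), (2 * L); first lra.
move=> x y xx yy; rewrite (le_trans (normc_le_ReIm _))// !ReD !ImD !ReN !ImN ReM ImM /=.
rewrite !mulr0 subr0 add0r.
have := h1 _ _ xx yy; have := h2 _ _ xx yy; lra.
Qed.

Lemma cint_split a c b f : a <= c -> c <= b -> lip a b f ->
  cint a b f = cint a c f + cint c b f.
Proof.
move=> ac cb lf; have ab := le_trans ac cb; have [F uF] := lip_prim ab lf.
rewrite (cintE ab uF) (cintE ac (uprim_sub (lexx _) cb uF)).
by rewrite (cintE cb (uprim_sub ac (lexx _) uF)); ring.
Qed.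

Lemma cintD a b f g : a <= b -> lip a b f -> lip a b g ->
  cint a b (fun x => f x + g x) = cint a b f + cint a b g.
Proof.
move=> ab lf lg; have [F uF] := lip_prim ab lf; have [H uH] := lip_prim ab lg.
by rewrite (cintE ab uF) (cintE ab uH) (cintE ab (uprimD uF uH)); ring.
Qed.

Lemma cintZ a b f (c : R[i]) : a <= b -> lip a b f ->
  cint a b (fun x => c * f x) = c * cint a b f.
Proof.
move=> ab lf; have [F uF] := lip_prim ab lf.
by rewrite (cintE ab uF) (cintE ab (uprimZ c uF)); ring.
Qed.

Lemma cint_ext a b f g : a <= b -> (forall x, a <= x <= b -> f x = g x) -> lip a b f ->
  cint a b f = cint a b g.
Proof.
move=> ab e lf; have [F uF] := lip_prim ab lf.
by rewrite (cintE ab uF) (cintE ab (uprim_ext e uF)).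
Qed.

Lemma cint_le a b f g H : a <= b -> lip a b f -> uprim a b g H ->
  (forall x, a <= x <= b -> normc (f x) <= Re (g x)) ->
  normc (cint a b f) <= Re (H b - H a).
Proof.
move=> ab lf uH fg; have [F uF] := lip_prim ab lf.
by rewrite (cintE ab uF); exact: uprim_le ab uF uH fg.
Qed.

Lemma cint_le_cst a b f (B : R) : a <= b -> lip a b f ->
  (forall x, a <= x <= b -> normc (f x) <= B) ->
  normc (cint a b f) <= B * (b - a).
Proof.
move=> ab lf fB; have := cint_le ab lf (uprim_cst a b B%:C).
by rewrite -!rmorphM -rmorphB /= -mulrBr; apply.
Qed.

End Primitive.

(** * Cauchy's theorem on rectangles *)
Section Cauchy.
Context {R : realType}.
Implicit Types (a b c d x v : R) (G D : R[i] -> R[i]).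

Definition rect a b c d (w : R[i]) := (a <= Re w <= b) /\ (c <= Im w <= d).

Lemma rect_bound a b c d w : rect a b c d w ->
  normc w <= `|a| + `|b| + (`|c| + `|d|).
Proof.
move=> [/andP[h1 h2] /andP[h3 h4]]; rewrite (le_trans (normc_le_ReIm _))//.
have B (u v t : R) : u <= t -> t <= v -> `|t| <= `|u| + `|v|.
  move=> ut tv; have := ler_norm v; have := ler_norm (- u); rewrite normrN.
  have := normr_ge0 u; have := normr_ge0 v.
  by move=> *; rewrite ler_norml; apply/andP; split; lra.
by rewrite lerD// B.
Qed.

Lemma hol_id_rect a b c d : hol (rect a b c d) id.
Proof. by exists (fun=> 1); apply: holD_id => w; exact: rect_bound. Qed.

Lemma holD_line (Om : R[i] -> Prop) G D (w0 u : R[i]) a b : holD Om G D ->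
  (forall t, a <= t <= b -> Om (w0 + u * t%:C)) ->
  uprim a b (fun t => u * D (w0 + u * t%:C)) (fun t => G (w0 + u * t%:C)).
Proof.
move=> [K K0 h] s; exists (K * normc u ^+ 2).
  by rewrite mulr_ge0 ?exprn_ge0 ?normc_ge0.
move=> x y xx yy; have [_ _] := h _ _ (s _ xx) (s _ yy).
have -> : w0 + u * y%:C - (w0 + u * x%:C) = u * (y - x)%:C.
  by rewrite rmorphB /=; ring.
rewrite normcM normcR exprMn real_normK ?num_real// !mulrA.
by rewrite (mulrC _ u).
Qed.

Lemma hol_lip_line (Om : R[i] -> Prop) G (w0 u : R[i]) a b : hol Om G ->
  (forall t, a <= t <= b -> Om (w0 + u * t%:C)) ->
  lip a b (fun t => G (w0 + u * t%:C)).
Proof.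
move=> [D /holD_lip[L L0 h]] s; exists (L * normc u).
  by rewrite mulr_ge0// normc_ge0.
move=> x y xx yy; rewrite (le_trans (h _ _ (s _ xx) (s _ yy)))//.
have -> : w0 + u * y%:C - (w0 + u * x%:C) = u * (y - x)%:C.
  by rewrite rmorphB /=; ring.
by rewrite normcM normcR mulrA.
Qed.

Lemma xyE x v : x +i* v = v *i + 1 * x%:C.
Proof. by apply/eqP; rewrite eq_complex /=; apply/andP; split; apply/eqP; ring. Qed.

Lemma yxE x v : x +i* v = x%:C + 'i%C * v%:C.
Proof. by apply/eqP; rewrite eq_complex /=; apply/andP; split; apply/eqP; ring. Qed.

Lemma hol_lip_h (Om : R[i] -> Prop) G a b v : hol Om G ->
  (forall t, a <= t <= b -> Om (t +i* v)) -> lip a b (fun t => G (t +i* v)).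
Proof.
move=> hG s; under eq_fun do rewrite xyE.
by apply: hol_lip_line hG _ => t tt; rewrite -xyE; exact: s.
Qed.

Lemma hol_lip_v (Om : R[i] -> Prop) G a b x : hol Om G ->
  (forall t, a <= t <= b -> Om (x +i* t)) -> lip a b (fun t => G (x +i* t)).
Proof.
move=> hG s; under eq_fun do rewrite yxE.
by apply: hol_lip_line hG _ => t tt; rewrite -yxE; exact: s.
Qed.

(** The integral of G over the horizontal segment at height v, as a function of v, has the
primitive property with derivative i (G (b + i v) - G (a + i v)): the quadratic error of G
integrates to a quadratic error. *)
Lemma cauchy_rect a b c d G : a <= b -> c <= d -> hol (rect a b c d) G ->
  cint a b (fun x => G (x +i* c)) + 'i%C * cint c d (fun v => G (b +i* v)) =
  cint a b (fun x => G (x +i* d)) + 'i%C * cint c d (fun v => G (a +i* v)).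
Proof.
move=> ab cd [D hG].
have hG' : hol (rect a b c d) G by exists D.
have inr v x : c <= v <= d -> a <= x <= b -> rect a b c d (x +i* v) by [].
have lx v : c <= v <= d -> lip a b (fun x => G (x +i* v)).
  by move=> vv; apply: hol_lip_h hG' _ => t; exact: inr.
have lv x : a <= x <= b -> lip c d (fun v => G (x +i* v)).
  by move=> xx; apply: hol_lip_v hG' _ => t tt; exact: inr.
pose A v := cint a b (fun x => G (x +i* v)).
have aa : a <= a <= b by rewrite lexx.
have bb : a <= b <= b by rewrite lexx andbT.
have cc : c <= c <= d by rewrite lexx.
have dd : c <= d <= d by rewrite lexx andbT.
have uA : uprim c d (fun v => 'i%C * (G (b +i* v) + -1 * G (a +i* v))) A.
  case: (hG) => K K0 h; exists (K * (b - a)); first by rewrite mulr_ge0// subr_ge0.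
  move=> v v' vv vv'.
  have [F uF] := lip_prim ab (lx _ vv); have [F' uF'] := lip_prim ab (lx _ vv').
  have uG : uprim a b (fun x => D (x +i* v)) (fun x => G (x +i* v)).
    have := @holD_line _ _ _ (v *i) 1 a b hG.
    move=> /(_ _)/(uprim_ext _) H.
    have -> : (fun x => G (x +i* v)) = (fun x => G (v *i + 1 * x%:C)).
      by apply/funext => x; rewrite xyE.
    apply: H; first by move=> x xx; rewrite mul1r -xyE.
    by move=> t tt; rewrite -xyE; exact: inr.
  have uS := uprimD (uprimD uF' (uprimZ (-1) uF)) (uprimZ (- ('i%C * (v' - v)%:C)) uG).
  have := uprim_le ab uS (uprim_cst a b (K * (v' - v) ^+ 2)%:C).
  rewrite -!rmorphM -rmorphB /=.
  have -> : F' b + -1 * F b + - ('i%C * (v' - v)%:C) * G (b +i* v) -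
    (F' a + -1 * F a + - ('i%C * (v' - v)%:C) * G (a +i* v)) =
    A v' - A v - 'i%C * (G (b +i* v) + -1 * G (a +i* v)) * (v' - v)%:C.
    by rewrite /A (cintE ab uF) (cintE ab uF'); ring.
  have -> : K * (v' - v) ^+ 2 * b - K * (v' - v) ^+ 2 * a = K * (b - a) * (v' - v) ^+ 2 by ring.
  apply => x xx.
  have [_ _] := h _ _ (inr _ _ vv xx) (inr _ _ vv' xx).
  have -> : x +i* v' - x +i* v = 'i%C * (v' - v)%:C.
    by apply/eqP; rewrite eq_complex /=; apply/andP; split; apply/eqP; ring.
  rewrite normcM normci mul1r normcR real_normK ?num_real//.
  congr (_ <= _); congr normc; ring.
have := cintE cd uA; rewrite cintZ//; last first.
  have [L L0 h] := lv _ bb; have [L' L0' h'] := lv _ aa.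
  exists (L + L'); first lra.
  move=> x y xx yy.
  have -> : G (b +i* y) + -1 * G (a +i* y) - (G (b +i* x) + -1 * G (a +i* x)) =
    (G (b +i* y) - G (b +i* x)) - (G (a +i* y) - G (a +i* x)) by ring.
  by rewrite (le_trans (normcB _ _))// mulrDl lerD// ?h ?h'.
rewrite cintD//; last 2 first.
- exact: lv.
- have [L L0 h] := lv _ aa; exists L => // x y xx yy.
  by rewrite -mulrBr normcM normcN normc_1 mul1r h.
- rewrite cintZ//; last exact: lv.
  rewrite /A mulrDr => e.
  have -> : cint a b (fun x => G (x +i* d)) =
    cint a b (fun x => G (x +i* c)) +
    ('i%C * cint c d (fun v => G (b +i* v)) + 'i%C * (-1 * cint c d (fun v => G (a +i* v)))).
    by rewrite e; ring.
  ring.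
Qed.

End Cauchy.

(** * Lipschitz functions *)
Section LipMore.
Context {R : realType}.
Implicit Types (f g F : R -> R[i]) (a b c x y : R).

Lemma lip_sub a b c d f : a <= c -> d <= b -> lip a b f -> lip c d f.
Proof.
move=> ac db [K K0 h]; exists K => // x y /andP[? ?] /andP[? ?].
by apply: h; apply/andP; split; lra.
Qed.

Lemma lip_cst a b (z : R[i]) : lip a b (fun=> z).
Proof. by exists 0 => // x y _ _; rewrite subrr normc0 mul0r. Qed.

Lemma lipD a b f g : lip a b f -> lip a b g -> lip a b (fun x => f x + g x).
Proof.
move=> [K K0 h] [L L0 k]; exists (K + L); first lra.
move=> x y xx yy; have -> : f y + g y - (f x + g x) = (f y - f x) + (g y - g x) by ring.
by rewrite (le_trans (normcD _ _))// mulrDl lerD// ?h ?k.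
Qed.

Lemma lip_bounded a b f : lip a b f -> exists2 K : R, 0 <= K &
  forall x, a <= x <= b -> normc (f x) <= K.
Proof.
move=> [L L0 h]; exists (normc (f a) + L * `|b - a|).
  by rewrite addr_ge0 ?mulr_ge0 ?normc_ge0.
move=> x /andP[ax xb]; have ab := le_trans ax xb.
have -> : f x = f a + (f x - f a) by ring.
rewrite (le_trans (normcD _ _))// lerD2l (le_trans (h _ _ _ _))//; first by rewrite lexx.
  by rewrite ax.
by rewrite ler_wpM2l// !ger0_norm ?subr_ge0// lerB.
Qed.

Lemma lipM a b f g : lip a b f -> lip a b g -> lip a b (fun x => f x * g x).
Proof.
move=> lf lg; have [K K0 fK] := lip_bounded lf; have [M M0 gM] := lip_bounded lg.
case: lf lg => [L L0 h] [N N0 k]; exists (L * M + K * N).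
  by rewrite addr_ge0 ?mulr_ge0.
move=> x y xx yy.
have -> : f y * g y - f x * g x = (f y - f x) * g y + f x * (g y - g x) by ring.
rewrite (le_trans (normcD _ _))// !normcM mulrDl lerD//.
  by rewrite mulrAC ler_pM ?normc_ge0 ?h ?gM.
by rewrite -mulrA ler_pM ?normc_ge0 ?k ?fK.
Qed.

Lemma lip_sum a b (I : Type) (r : seq I) (F : I -> R -> R[i]) :
  (forall i, lip a b (F i)) -> lip a b (fun x => \sum_(i <- r) F i x).
Proof.
move=> hF; elim: r => [|i r IH].
  by under eq_fun do rewrite big_nil; exact: lip_cst.
by under eq_fun do rewrite big_cons; exact: lipD.
Qed.

Lemma uprim_sum a b (I : Type) (r : seq I) (f F : I -> R -> R[i]) :
  (forall i, uprim a b (f i) (F i)) ->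
  uprim a b (fun x => \sum_(i <- r) f i x) (fun x => \sum_(i <- r) F i x).
Proof.
move=> hF; elim: r => [|i r IH].
  under eq_fun do rewrite big_nil.
  under [X in uprim _ _ _ X]eq_fun do rewrite big_nil.
  by exists 0 => // x y _ _; rewrite !subrr mul0r subrr normc0 mul0r.
under eq_fun do rewrite big_cons.
under [X in uprim _ _ _ X]eq_fun do rewrite big_cons.
exact: uprimD.
Qed.

Lemma cint_sum a b (I : Type) (r : seq I) (f : I -> R -> R[i]) : a <= b ->
  (forall i, lip a b (f i)) ->
  cint a b (fun x => \sum_(i <- r) f i x) = \sum_(i <- r) cint a b (f i).
Proof.
move=> ab hf; elim: r => [|i r IH].
  rewrite big_nil; under eq_fun do rewrite big_nil.
  by rewrite (cintE ab (uprim_cst a b 0)) !mul0r subrr.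
rewrite big_cons; under eq_fun do rewrite big_cons.
by rewrite cintD ?IH//; exact: lip_sum.
Qed.

Lemma holD_real (Om : R[i] -> Prop) (G D : R[i] -> R[i]) a b : holD Om G D ->
  (forall t, a <= t <= b -> Om t%:C) ->
  uprim a b (fun t => D t%:C) (fun t => G t%:C).
Proof.
move=> h s; have := @holD_line _ _ _ _ 0 1 a b h.
have E (t : R) : 0 + 1 * t%:C = t%:C by rewrite add0r mul1r.
have -> : (fun t => G t%:C) = (fun t : R => G (0 + 1 * t%:C)).
  by apply/funext => t; rewrite E.
move=> /(_ _)/(uprim_ext _); apply.
  by move=> x xx; rewrite E mul1r.
by move=> t tt; rewrite E; exact: s.
Qed.

Lemma hol_lip_real (Om : R[i] -> Prop) (G : R[i] -> R[i]) a b : hol Om G ->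
  (forall t, a <= t <= b -> Om t%:C) -> lip a b (fun t => G t%:C).
Proof.
move=> h s; have := @hol_lip_line _ _ _ 0 1 a b h.
have E (t : R) : 0 + 1 * t%:C = t%:C by rewrite add0r mul1r.
have -> : (fun t => G t%:C) = (fun t : R => G (0 + 1 * t%:C)).
  by apply/funext => t; rewrite E.
by apply => t tt; rewrite E; exact: s.
Qed.

End LipMore.

(** * Fejer kernels *)
Section Fejer.
Context {R : realType}.
Implicit Types (q : R[i]) (s t u : R).

(** The Cesaro mean of the partial sums of the series of q^k, k >= 1; it tends to q / (1 - q)
for |q| <= 1, q <> 1, and on the unit circle its real part is half the Fejer kernel minus 1/2. *)
Definition cesaro (n : nat) q : R[i] :=
  n%:R^-1 * \sum_(m < n) \sum_(k < m) q ^+ k.+1.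

Lemma geom_tail q m : q != 1 ->
  \sum_(k < m) q ^+ k.+1 = (q - q ^+ m.+1) / (1 - q).
Proof.
move=> q1; have d : 1 - q != 0 by rewrite subr_eq0 eq_sym.
elim: m => [|m IH]; first by rewrite big_ord0 expr1 subrr mul0r.
by rewrite big_ord_recr /= IH !exprS; field.
Qed.

Lemma normc_natr (n : nat) : normc (n%:R : R[i]) = n%:R.
Proof.
have -> : (n%:R : R[i]) = (n%:R : R)%:C by rewrite rmorph_nat.
by rewrite normcR ger0_norm.
Qed.

Lemma cesaro_bound n q : q != 1 -> normc q <= 1 ->
  normc (cesaro n q) <= 2 * normc q / normc (1 - q).
Proof.
move=> q1 qle; have d : 0 < normc (1 - q) by rewrite normc_gt0 subr_eq0 eq_sym.
have q0 := normc_ge0 q.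
have B0 : 0 <= 2 * normc q / normc (1 - q) by rewrite divr_ge0 ?mulr_ge0// ltW.
case: n => [|n]; first by rewrite /cesaro big_ord0 mulr0 normc0.
rewrite /cesaro normcM normcV normc_natr mulrC ler_pdivrMr ?ltr0n//.
rewrite (le_trans (normc_sum _ _ _))//.
rewrite (@le_trans _ _ (\sum_(i < n.+1) (2 * normc q / normc (1 - q))))//.
  apply: ler_sum => m _; rewrite geom_tail// normcM normcV ler_wpM2r ?invr_ge0 ?(ltW d)//.
  rewrite (le_trans (normcB _ _))// normcX exprS.
  have : normc q * normc q ^+ m <= normc q by rewrite ler_piMr// exprn_ile1.
  lra.
by rewrite sumr_const card_ord mulr_natr.
Qed.

Lemma cesaro_limit n q : q != 1 -> normc q <= 1 ->
  normc (cesaro n.+1 q - q / (1 - q)) <= 2 / normc (1 - q) ^+ 2 / n.+1%:R.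
Proof.
move=> q1 qle; have d : 1 - q != 0 by rewrite subr_eq0 eq_sym.
have n0 : (n.+1%:R : R[i]) != 0 by rewrite pnatr_eq0.
have -> : cesaro n.+1 q - q / (1 - q) =
   - (n.+1%:R^-1 * ((q - q ^+ n.+2) / (1 - q) ^+ 2)).
  rewrite /cesaro (eq_bigr (fun m : 'I_n.+1 => q / (1 - q) - q ^+ m.+1 / (1 - q))).
    rewrite sumrB sumr_const card_ord -mulr_suml geom_tail// -(mulr_natr (q / (1 - q))).
    by move: n0; move: (n.+1%:R : R[i]) (q ^+ n.+2) => N Q n0; field; rewrite d n0.
  by move=> m _; rewrite geom_tail// mulrBl.
rewrite normcN !normcM !normcV normc_natr normcX mulrC.
rewrite ler_wpM2r ?invr_ge0// ler_wpM2r ?invr_ge0 ?exprn_ge0 ?normc_ge0//.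
rewrite (le_trans (normcB _ _))// normcX.
have : normc q ^+ n.+2 <= 1 by rewrite exprn_ile1 ?normc_ge0.
by lra.
Qed.

(** The classical formula for the Fejer kernel as a square modulus, valid for any nonzero q;
it gives positivity on the unit circle. *)
Lemma fejer_square n q : q != 0 ->
  n%:R + \sum_(m < n) \sum_(k < m) (q ^+ k.+1 + q^-1 ^+ k.+1) =
  (\sum_(m < n) q ^+ m) * (\sum_(m < n) q^-1 ^+ m).
Proof.
move=> q0; elim: n => [|n IH]; first by rewrite !big_ord0 addr0 mul0r.
rewrite !big_ord_recr /= -natr1 addrACA IH.
have flip (x : R[i]) : x != 0 -> x ^+ n * \sum_(m < n) x^-1 ^+ m = \sum_(k < n) x ^+ k.+1.
  move=> x0; rewrite mulr_sumr (reindex_inj rev_ord_inj) /=.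
  apply: eq_bigr => k _; rewrite exprVn -expfB//; last by rewrite ltn_subrL /= (leq_ltn_trans _ (ltn_ord k)).
  congr (_ ^+ _); have := ltn_ord k; move=> kn; by rewrite subKn.
have f1 := flip _ q0; have := flip _ (invr_neq0 q0); rewrite invrK => f2.
rewrite mulrDl !mulrDr f1 (mulrC (\sum_(m < n) q ^+ m) (q^-1 ^+ n)) f2 big_split /=.
by rewrite -exprMn divff// expr1n; ring.
Qed.

(** exp (2 pi i c w^2), an entire function of w that equals 1 at the square roots of natural
numbers when c is an integer. *)
Definition expsq (c : R) (w : R[i]) : R[i] := cexp ('i%C * (2 * pi * c)%:C * w ^+ 2).
Definition nome (w : R[i]) := expsq 1 w.
Definition Fej (n : nat) (w : R[i]) : R[i] := 1 + (cesaro n (nome w) + cesaro n (nome w)^-1).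

Lemma expsq_neq0 c w : expsq c w != 0. Proof. exact: cexp_neq0. Qed.

Lemma expsqN c w : expsq (- c) w = (expsq c w)^-1.
Proof. by rewrite -cexpN; congr cexp; rewrite mulrN rmorphN; ring. Qed.

Lemma expsqX c n w : expsq c w ^+ n = expsq (n%:R * c) w.
Proof.
by rewrite -cexpMn; congr cexp; rewrite -mulr_natr !rmorphM /= rmorph_nat; ring.
Qed.

Lemma normc_expsq c x v : normc (expsq c (x +i* v)) = expR (- (4 * pi * c * x * v)).
Proof.
rewrite /expsq normc_cexp; congr expR.
by rewrite expr2 !ReM !ImM /=; ring.
Qed.

Lemma normc_expsqR c x : normc (expsq c x%:C) = 1.
Proof. by rewrite (_ : x%:C = x +i* 0)// normc_expsq mulr0 oppr0 expR0. Qed.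

Lemma hol_expsq (Om : R[i] -> Prop) (c : R) : hol Om id -> hol Om (expsq c).
Proof.
move=> h; apply: hol_cexp; apply: hol_mul; first exact: hol_cst.
exact: hol_exp.
Qed.

(** The weight 2 s comes from the change of variable u = s^2. *)
Lemma expsq_prim a b (c : R) : c != 0 ->
  uprim a b (fun s => 2 * s%:C * expsq c s%:C)
            (fun s => ('i%C * (2 * pi * c)%:C)^-1 * expsq c s%:C).
Proof.
move=> c0.
have hid : holD (rect a b 0 0) id (fun=> 1) by apply: holD_id => w; exact: rect_bound.
have h := holD_cexp (holDZ ('i%C * (2 * pi * c)%:C) (holDM hid hid)).
have := holDZ ('i%C * (2 * pi * c)%:C)^-1 h => h1.
have := holD_real h1 => /(_ a b)/(_ _)/(uprim_ext _) h2.
have E : (fun s : R => ('i%C * (2 * pi * c)%:C)^-1 * expsq c s%:C) =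
  (fun t : R => ('i%C * (2 * pi * c)%:C)^-1 * cexp ('i%C * (2 * pi * c)%:C * (t%:C * t%:C))).
  by apply/funext => t; rewrite /expsq expr2.
rewrite E; apply: h2; last by move=> t tt; split => //=; rewrite lexx.
move=> x _; rewrite /expsq expr2.
have n1 : (2 * pi * c)%:C != 0 :> R[i].
  by rewrite fmorph_eq0 !mulf_neq0// ?gt_eqF ?pi_gt0//.
have n2 : 'i%C != 0 :> R[i] by rewrite -normc_gt0 normci.
have key (I C E0 X : R[i]) : C != 0 -> I != 0 ->
    (I * C)^-1 * (E0 * (I * C * (1 * X + X * 1))) = 2 * X * E0.
  by move=> C0 I0; field; rewrite I0 C0.
exact: key.
Qed.

End Fejer.

(** * Sums over square roots of integers as integrals *)
Section FejerSum.
Context {R : realType}.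
Implicit Types (s t u x y d e : R) (j n : nat).

Lemma sin_ge4 x : 0 <= x -> x <= pi / 2 -> x / 4 <= sin x.
Proof.
move=> x0 xp; set t := x / 2.
have t0 : 0 <= t by rewrite /t; lra.
have tp : t <= pi / 4 by rewrite /t; lra.
have p0 := @pi_gt0 R.
have ch y : 0 <= y -> y <= pi / 4 -> 1 / 2 <= cos y.
  move=> y0 yp.
  have c0 : 0 <= cos y by apply: cos_ge0_pihalf; apply/andP; split; lra.
  have : 0 <= cos (y *+ 2) by apply: cos_ge0_pihalf; rewrite (mulr2n y); apply/andP; split; lra.
  rewrite cos_mulr2n mulr2n; nra.
have -> : x = t *+ 2 by rewrite /t mulr2n; lra.
rewrite sin_mulr2n !mulr2n.
have st : t / 2 <= sin t.
  have [c] := @MVT_segment R sin cos 0 t t0 (fun y _ => is_derive_sin y)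
    (continuous_subspaceT (@continuous_sin R)).
  rewrite in_itv/= => /andP[c0 ct]; rewrite sin0 !subr0 => ->.
  have := ch c c0 (le_trans ct tp); nra.
have := ch t t0 tp; nra.
Qed.

Lemma normc_1subee u : normc (1 - cexp ('i%C * (2 * pi * u)%:C)) = 2 * `|sin (pi * u)|.
Proof.
have -> : 1 - cexp ('i%C * (2 * pi * u)%:C) =
  (2 * sin (pi * u))%:C * (sin (pi * u) -i* cos (pi * u)).
  rewrite /cexp !ReM !ImM /=.
  have -> : 0 * (2 * pi * u) - 1 * 0 = 0 :> R by ring.
  rewrite expR0 (_ : 0 * 0 + 1 * (2 * pi * u) = (pi * u) *+ 2); last by rewrite mulr2n; ring.
  rewrite cos_mulr2n sin_mulr2n !mulr2n.
  apply/eqP; rewrite eq_complex /=; apply/andP; split; apply/eqP.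
    have := cos2Dsin2 (pi * u); lra.
  ring.
rewrite normcM normcR normrM (ger0_norm (_ : 0 <= 2))//.
rewrite (_ : normc _ = 1) ?mulr1// /normc sqrrN addrC cos2Dsin2 sqrtr1//.
Qed.

Lemma ee_nat j u : cexp ('i%C * (2 * pi * (j%:R + u))%:C) = cexp ('i%C * (2 * pi * u)%:C).
Proof.
have -> : 'i%C * (2 * pi * (j%:R + u))%:C = 'i%C * (2 * pi * u)%:C + ('i%C * (2 * pi)%:C) *+ j :> R[i].
  by rewrite -mulr_natr !(rmorphM, rmorphD) /= !rmorph_nat; ring.
rewrite cexpD cexpMn (_ : cexp ('i%C * (2 * pi)%:C) = 1) ?expr1n ?mulr1//.
rewrite /cexp !ReM !ImM /=.
have -> : 0 * (2 * pi) - 1 * 0 = 0 :> R by ring.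
rewrite expR0 (_ : 0 * 0 + 1 * (2 * pi) = pi *+ 2); last by rewrite mulr2n; ring.
by rewrite cos2pi sin2pi !mul1r.
Qed.

Lemma nomeR s : nome s%:C = cexp ('i%C * (2 * pi * s ^+ 2)%:C).
Proof. by rewrite /nome /expsq mulr1; congr cexp; rewrite !expr2 !rmorphM /=; ring. Qed.

Lemma nome_conj s : ((nome s%:C)^*)%C = (nome s%:C)^-1.
Proof.
rewrite nomeR -cexpN; apply/eqP; rewrite eq_complex /cexp !ReN !ImN !ReM !ImM /=.
by rewrite !(mul0r, mulr0, mul1r, subrr, oppr0, expR0, addr0, add0r, cosN, sinN) !eqxx.
Qed.

Lemma Fej_real n s : Fej n.+1 s%:C =
  (n.+1%:R^-1 * normc (\sum_(m < n.+1) nome s%:C ^+ m) ^+ 2)%:C.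
Proof.
have q0 : nome s%:C != 0 by exact: expsq_neq0.
have n0 : (n.+1%:R : R[i]) != 0 by rewrite pnatr_eq0.
have -> : Fej n.+1 s%:C = n.+1%:R^-1 * ((\sum_(m < n.+1) nome s%:C ^+ m) *
   (\sum_(m < n.+1) (nome s%:C)^-1 ^+ m)).
  rewrite -fejer_square// /Fej /cesaro -mulrDr -big_split /=.
  rewrite mulrDr mulVf//; congr (_ + _ * _); apply: eq_bigr => m _.
  by rewrite big_split.
have -> : \sum_(m < n.+1) (nome s%:C)^-1 ^+ m = ((\sum_(m < n.+1) nome s%:C ^+ m)^*)%C.
  rewrite (raddf_sum (@conjc R)); apply: eq_bigr => m _.
  have cX (z : R[i]) k : ((z ^+ k)^*)%C = (z^*)%C ^+ k.
    elim: k => [|k IH]; first by rewrite !expr0; apply/eqP; rewrite eq_complex /= oppr0 !eqxx.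
    rewrite !exprS -IH; move: (z ^+ k) => [u v]; case: z {IH} => a b.
    by apply/eqP; rewrite eq_complex /=; apply/andP; split; apply/eqP; ring.
  by rewrite -nome_conj; exact: esym (cX _ _).
move: (\sum_(m < n.+1) _) => [a b].
rewrite rmorphM /= fmorphV rmorph_nat; congr (_ * _).
rewrite /normc sqr_sqrtr ?addr_ge0 ?sqr_ge0//.
by apply/eqP; rewrite eq_complex /=; apply/andP; split; apply/eqP; ring.
Qed.

Lemma Fej_ge0 n s : 0 <= complex.Re (Fej n.+1 s%:C).
Proof. by rewrite Fej_real /= mulr_ge0 ?invr_ge0 ?exprn_ge0 ?normc_ge0. Qed.

(** The square of the modulus of the geometric sum is at most 4 / |1 - nome|^2, and
|1 - nome| = 2 |sin (pi (s^2 - j))| is at least |s^2 - j|. *)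
Lemma Fej_decay n s j : `|s ^+ 2 - j%:R| <= 1 / 2 ->
  (s ^+ 2 - j%:R) ^+ 2 * complex.Re (Fej n.+1 s%:C) <= 4 / n.+1%:R.
Proof.
move=> sj; rewrite Fej_real /=; set S := \sum_(m < _) _; set u := s ^+ 2 - j%:R in sj *.
have q1 : normc (nome s%:C) = 1 by exact: normc_expsqR.
have e : S * (1 - nome s%:C) = 1 - nome s%:C ^+ n.+1.
  have := subrX1 (nome s%:C) n.+1; rewrite -/S => e.
  by rewrite -[LHS]opprK -mulrN opprB mulrC -e opprB.
have e1 : normc S * normc (1 - nome s%:C) <= 2.
  rewrite -normcM e (le_trans (normcB _ _))// normc_1 normcX q1 expr1n; lra.
have e2 : `|u| <= normc (1 - nome s%:C).
  rewrite nomeR (_ : s ^+ 2 = j%:R + u) ?ee_nat ?normc_1subee; last by rewrite /u; ring.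
  have H (x : R) : 0 <= x -> x <= 1 / 2 -> x <= 2 * `|sin (pi * x)|.
    move=> x0 x2; have p := @pi_ge2 R.
    have : (pi * x) / 4 <= sin (pi * x) by apply: sin_ge4; nra.
    have := ler_norm (sin (pi * x)); nra.
  have [u0|/ltW u0] := leP 0 u; first by move: sj; rewrite ger0_norm//; exact: H.
  by move: sj; rewrite ler0_norm// -normrN -sinN -mulrN; apply: H; rewrite oppr_ge0.
have S0 := normc_ge0 S; have u0 := normr_ge0 u.
have e3 : normc S * `|u| <= 2 by rewrite (le_trans _ e1)// ler_wpM2l.
have e4 : (normc S * `|u|) ^+ 2 <= 4.
  have : 0 <= normc S * `|u| by rewrite mulr_ge0.
  nra.
rewrite mulrCA mulrC ler_wpM2r ?invr_ge0//.
by move: e4; rewrite exprMn real_normK ?num_real// mulrC.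
Qed.

(** The cells [sq j, sq j.+1] are those on which s^2 is closest to j + 1. *)
Definition sq (j : nat) : R := Num.sqrt (j%:R + 2^-1).

Lemma sq2 j : sq j ^+ 2 = j%:R + 2^-1.
Proof. by rewrite /sq sqr_sqrtr// addr_ge0// invr_ge0. Qed.

Lemma sq_ge0 j : 0 <= sq j. Proof. exact: sqrtr_ge0. Qed.

Lemma sq_le i j : (i <= j)%N -> sq i <= sq j.
Proof. by move=> ij; rewrite ler_wsqrtr// lerD2r ler_nat. Qed.

Lemma sq0_ge : 1 / 2 <= sq 0.
Proof. by rewrite -(@ler_pXn2r _ 2)// ?nnegrE ?sq_ge0// ?sq2; lra. Qed.

Lemma sq0_le : sq 0 <= 1.
Proof. rewrite -(@ler_pXn2r _ 2)// ?nnegrE ?sq_ge0// ?sq2; lra. Qed.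

Lemma expsq_end (k : nat) j : expsq k%:R (sq j.+1)%:C = expsq k%:R (sq j)%:C.
Proof.
have e i : expsq k%:R (sq i)%:C = nome (sq i)%:C ^+ k by rewrite expsqX mulr1.
rewrite !e !nomeR !sq2; congr (_ ^+ _).
by rewrite -natr1 -(ee_nat 1 (j%:R + 2^-1)); congr (cexp (_ * (_ * _)%:C)); ring.
Qed.

Lemma sqr_prim a b : uprim a b (fun s : R => 2 * s%:C) (fun s : R => s%:C ^+ 2).
Proof.
exists 1 => // x y _ _.
have -> : y%:C ^+ 2 - x%:C ^+ 2 - 2 * x%:C * (y - x)%:C = (y - x)%:C ^+ 2 :> R[i].
  by rewrite rmorphB /=; ring.
by rewrite normcX normcR mul1r real_normK ?num_real.
Qed.

(** Every nonconstant term of the kernel has a primitive that takes equal values at the two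
ends of a cell, so each cell has mass 1. *)
Lemma Fej_prim a b n : exists2 P : R -> R[i],
  uprim a b (fun s => 2 * s%:C * Fej n s%:C) P &
  forall j, P (sq j.+1) - P (sq j) = 1.
Proof.
have u0 := sqr_prim a b.
pose T (k : nat) (s : R) : R[i] := ('i%C * (2 * pi * k.+1%:R)%:C)^-1 * expsq k.+1%:R s%:C +
  ('i%C * (2 * pi * (- k.+1%:R))%:C)^-1 * expsq (- k.+1%:R) s%:C.
have uT k : uprim a b (fun s => 2 * s%:C * expsq k.+1%:R s%:C + 2 * s%:C * expsq (- k.+1%:R) s%:C) (T k).
  by apply: uprimD; apply: expsq_prim; rewrite ?oppr_eq0 pnatr_eq0.
have u1 (m : nat) := @uprim_sum _ a b _ (index_enum 'I_m) _ _ (fun k : 'I_m => uT k).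
have u2 := @uprim_sum _ a b _ (index_enum 'I_n) _ _ (fun m : 'I_n => u1 m).
have uS := uprimD u0 (uprimZ n%:R^-1 u2).
exists (fun s => s%:C ^+ 2 + n%:R^-1 * \sum_(m < n) \sum_(k < m) T k s).
  apply: uprim_ext uS => x _.
  rewrite /Fej /cesaro -mulrDr -big_split /= mulrDr mulr1; congr (_ + _).
  rewrite mulrCA; congr (_ * _); rewrite mulr_sumr; apply: eq_bigr => m _.
  rewrite -big_split /= mulr_sumr; apply: eq_bigr => k _.
  by rewrite -mulrDr expsqN /nome exprVn expsqX mulr1.
move=> j.
have TE k : T k (sq j.+1) = T k (sq j) by rewrite /T !expsqN expsq_end.
under eq_bigr do under eq_bigr do rewrite TE.
rewrite opprD addrACA subrr addr0 -!rmorphXn !sq2 -rmorphB /=.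
by rewrite -natr1 (_ : _ - _ = 1)//; ring.
Qed.

Lemma hol_cesaro (Om : R[i] -> Prop) n (G : R[i] -> R[i]) : hol Om G ->
  hol Om (fun w => cesaro n (G w)).
Proof.
move=> hG; apply: hol_mul; first exact: hol_cst.
by apply: hol_sum => m; apply: hol_sum => k; exact: hol_exp.
Qed.

Lemma hol_nome a b c d : hol (@rect R a b c d) (@nome R).
Proof. by apply: hol_expsq => //; exact: hol_id_rect. Qed.

Lemma lip_cesaro_nome a b n : lip a b (fun s => cesaro n (nome s%:C)).
Proof.
apply: (hol_lip_real (hol_cesaro n (hol_nome a b 0 0))) => t tt; split => //=; by rewrite lexx.
Qed.

Lemma lip_cesaro_nomeV a b n : lip a b (fun s => cesaro n (nome s%:C)^-1).
Proof.
have E (w : R[i]) : (nome w)^-1 = expsq (-1) w by rewrite expsqN.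
have h : hol (@rect R a b 0 0) (fun w => cesaro n (nome w)^-1).
  under eq_fun do rewrite E.
  by apply: hol_cesaro; apply: hol_expsq => //; exact: hol_id_rect.
by apply: (hol_lip_real h) => t tt; split => //=; rewrite lexx.
Qed.

Lemma lip_id a b : lip a b (fun s : R => s%:C : R[i]).
Proof.
by exists 1 => // x y _ _; rewrite -rmorphB normcR mul1r.
Qed.

Lemma lip_Fej a b n : lip a b (fun s => Fej n s%:C : R[i]).
Proof.
apply: lipD; first exact: lip_cst.
by apply: lipD; [exact: lip_cesaro_nome|exact: lip_cesaro_nomeV].
Qed.

(** Since |s - sqrt (j + 1)| <= |t| with t = s^2 - (j + 1), and |t| <= d + t^2 / d, the unit
mass of the kernel and its decay t^2 F <= 4 / (n + 1) bound the two parts. *)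
Lemma fejer_cell (g : R -> R[i]) (B d : R) n j : 0 < d -> 0 <= B ->
  lip (sq j) (sq j.+1) g ->
  (forall s, sq j <= s <= sq j.+1 ->
     normc (g s - g (Num.sqrt j.+1%:R)) <= B * `|s - Num.sqrt j.+1%:R|) ->
  normc (cint (sq j) (sq j.+1) (fun s => 2 * s%:C * g s * Fej n.+1 s%:C) -
     g (Num.sqrt j.+1%:R)) <= B * (d + 4 / (n.+1%:R * d)).
Proof.
move=> d0 B0 lg gB; set c := Num.sqrt j.+1%:R in gB *.
have ab : sq j <= sq j.+1 by exact: sq_le.
have n0 : (0 : R) < n.+1%:R by rewrite ltr0n.
have [P uP P1] := @Fej_prim (sq j) (sq j.+1) n.+1.
have l2 : lip (sq j) (sq j.+1) (fun s => 2 * s%:C * Fej n.+1 s%:C : R[i]).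
  apply: lipM; last exact: lip_Fej.
  by apply: lipM; [exact: lip_cst|exact: lip_id].
have lm : lip (sq j) (sq j.+1) (fun s => (2 * s%:C * Fej n.+1 s%:C) * (g s - g c)).
  by apply: lipM => //; apply: lipD => //; exact: lip_cst.
have c1 : 1 <= c by rewrite /c -{1}(sqrtr1 R) ler_wsqrtr// ler1n.
have c2 : c ^+ 2 = j.+1%:R by rewrite /c sqr_sqrtr.
have -> : cint (sq j) (sq j.+1) (fun s => 2 * s%:C * g s * Fej n.+1 s%:C) - g c =
  cint (sq j) (sq j.+1) (fun s => (2 * s%:C * Fej n.+1 s%:C) * (g s - g c)).
  rewrite [X in X - _](@cint_ext _ _ _ _ (fun s => (2 * s%:C * Fej n.+1 s%:C) * (g s - g c) +
     g c * (2 * s%:C * Fej n.+1 s%:C)))//; last 2 first.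
  - by move=> x _; ring.
  - apply: lipM; last exact: lip_Fej.
    by do 2 apply: lipM => //; [exact: lip_cst|exact: lip_id].
  rewrite cintD//; last by apply: lipM => //; exact: lip_cst.
  by rewrite cintZ// (cintE ab uP) P1 mulr1 addrK.
have u0 := sqr_prim (sq j) (sq j.+1).
have uB := uprimD (uprimZ (B * d)%:C uP) (uprimZ (B * 4 / (n.+1%:R * d))%:C u0).
have := cint_le ab lm uB.
have -> : forall x y z w u v : R[i], x * y + z * u - (x * w + z * v) = x * (y - w) + z * (u - v).
  by move=> *; ring.
rewrite P1 -!rmorphXn -rmorphB /= !sq2 -(natr1 j).
have -> : j%:R + 1 + 2^-1 - (j%:R + 2^-1) = 1 :> R by ring.
have -> : B * (d + 4 / (n.+1%:R * d)) =
  B * d * 1 - 0 * 0 + (B * 4 / (n.+1%:R * d) * 1 - 0 * 0).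
  by rewrite !mulr1 mulr0 !subr0 mulrDr mulrA.
apply.
move=> s /andP[sj sj1].
have s0 : 0 <= s by rewrite (le_trans _ sj)// sq_ge0.
have s2 : `|s ^+ 2 - j.+1%:R| <= 1 / 2.
  have h1 : sq j ^+ 2 <= s ^+ 2 by rewrite lerXn2r ?nnegrE ?sq_ge0.
  have h2 : s ^+ 2 <= sq j.+1 ^+ 2 by rewrite lerXn2r ?nnegrE ?sq_ge0.
  move: h1 h2; rewrite !sq2 -(natr1 j) => h1 h2.
  by rewrite ler_norml; apply/andP; split; lra.
have D := Fej_decay n s2.
have F0 := Fej_ge0 n s.
set F := complex.Re (Fej n.+1 s%:C) in D F0 *.
have FE : Fej n.+1 s%:C = F%:C by rewrite /F Fej_real.
have gb := gB s; rewrite sj sj1 in gb; have {}gb := gb isT.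
have t1 : `|s - c| <= `|s ^+ 2 - j.+1%:R|.
  rewrite -c2 subr_sqr normrM ler_peMr//.
  rewrite ger0_norm; lra.
set t := s ^+ 2 - j.+1%:R in s2 D t1 *.
have t3 : `|t| <= d + t ^+ 2 / d.
  rewrite -(ler_pM2r d0) mulrDl divfK ?gt_eqF// -(real_normK (num_real t)).
  have := sqr_ge0 (`|t| - d); have := normr_ge0 t; nra.
rewrite FE !normcM !normcR (_ : normc 2 = 2); last by rewrite (normc_natr 2).
rewrite (ger0_norm s0) (ger0_norm F0).
have two : (2 : R[i]) = (2 : R)%:C by rewrite rmorph_nat.
rewrite ReD !ReM !ImM two /= !(mulr0, mul0r, addr0, subr0).
have tF : `|t| * F <= d * F + 4 / n.+1%:R / d.
  apply: (@le_trans _ _ ((d + t ^+ 2 / d) * F)); first by rewrite ler_wpM2r.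
  by rewrite mulrDl lerD2l mulrAC ler_wpM2r// invr_ge0 ltW.
have a1 : F * normc (g s - g c) <= B * (`|t| * F).
  rewrite (le_trans (ler_wpM2l F0 gb))// mulrC -mulrA ler_wpM2l// ler_wpM2r//.
have a2 : B * (`|t| * F) <= B * (d * F + 4 / n.+1%:R / d) by rewrite ler_wpM2l.
have s20 : 0 <= 2 * s by lra.
have a3 := ler_wpM2l s20 (le_trans a1 a2).
rewrite -mulrA (le_trans a3)// le_eqVlt; apply/orP; left; apply/eqP.
by field; rewrite !gt_eqF.
Qed.

(** Poisson summation on a finite range: the kernels concentrate at the square roots of
integers. *)
Lemma fejer_sum (M : nat) (g : R -> R[i]) (e : R) : 0 < e -> lip (sq 0) (sq M) g ->
  exists n0, forall n, (n0 <= n)%N ->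
  normc (cint (sq 0) (sq M) (fun s => 2 * s%:C * g s * Fej n.+1 s%:C) -
    \sum_(j < M) g (Num.sqrt j.+1%:R)) <= e.
Proof.
move=> e0 lg; have [B B0 hB] := lg.
have E1 : 0 < B * M%:R + 1 by rewrite ltr_wpDl// mulr_ge0.
(* each of the M cells will cost at most 2 B d *)
pose d := e / 2 / (B * M%:R + 1).
have d0 : 0 < d by rewrite !divr_gt0.
exists (Num.truncn (4 / d / d)) => n nn0.
have nd : 4 / (n.+1%:R * d) <= d.
  have : 4 / d / d <= n.+1%:R by rewrite (le_trans (ltW (truncnS_gt _)))// ler_nat ltnS.
  rewrite ler_pdivrMr// ler_pdivrMr// => h.
  have nd0 : 0 < n.+1%:R * d by rewrite mulr_gt0 ?ltr0n.
  rewrite ler_pdivrMr//.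
  by rewrite (_ : d * _ = n.+1%:R * d * d)//; ring.
suff : forall m, (m <= M)%N ->
  normc (cint (sq 0) (sq m) (fun s => 2 * s%:C * g s * Fej n.+1 s%:C) -
    \sum_(j < m) g (Num.sqrt j.+1%:R)) <= m%:R * (B * (2 * d)).
  move=> /(_ _ (leqnn M))/le_trans; apply.
  have -> : M%:R * (B * (2 * d)) = e * ((B * M%:R) / (B * M%:R + 1)).
    by rewrite /d; field; rewrite gt_eqF.
  rewrite ler_piMr ?(ltW e0)// ler_pdivrMr// mul1r; lra.
have lf : lip (sq 0) (sq M) (fun s => 2 * s%:C * g s * Fej n.+1 s%:C).
  apply: lipM; last exact: lip_Fej.
  by apply: lipM => //; apply: lipM; [exact: lip_cst|exact: lip_id].
elim=> [_|m IH mM].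
  rewrite big_ord0 subr0 mul0r.
  by rewrite /cint subrr normc0.
have {}IH := IH (ltnW mM).
rewrite (@cint_split _ _ (sq m)); last 3 first.
- exact: sq_le.
- exact: sq_le.
- by apply: lip_sub lf => //; exact: sq_le.
rewrite big_ord_recr /= opprD addrACA (le_trans (normcD _ _))//.
rewrite (_ : m.+1%:R * _ = m%:R * (B * (2 * d)) + B * (2 * d)); last first.
  by rewrite -(natr1 m); ring.
rewrite lerD//.
have inM s : sq m <= s <= sq m.+1 -> sq 0 <= s <= sq M.
  move=> /andP[h1 h2]; rewrite (le_trans _ h1) ?(le_trans h2)//; exact: sq_le.
apply: (le_trans (@fejer_cell g B d n m d0 B0 _ _)).
- by apply: lip_sub lg; exact: sq_le.
- move=> s ss; apply: hB; last exact: inM.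
  apply: inM; rewrite /sq !ler_wsqrtr//; rewrite -(natr1 m); lra.
rewrite ler_wpM2l//.
by rewrite (_ : 2 * d = d + d) ?lerD2l//; ring.
Qed.

End FejerSum.

(** * The integrand and its bounds *)
Section Kernel.
Context {R : realType}.
Implicit Types (sigma alpha lc S s t v x a b c d Lam : R) (w : R[i]) (e n M : nat).

(** The logarithm of y = C exp (sigma (w - S)), with lc = log C. *)
Definition logy lc sigma S w : R[i] := lc%:C + sigma%:C * (w - S%:C).
Definition numer alpha lc sigma S e w : R[i] :=
  cexp (alpha%:C * logy lc sigma S w) * logy lc sigma S w ^+ e.
(** Equal to 1 + y / z when s0 is the point of the real axis where y = z. *)
Definition den sigma s0 w : R[i] := 1 + cexp (sigma%:C * (w - s0%:C)).
Definition qker alpha lc sigma S e s0 w : R[i] :=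
  sigma%:C * numer alpha lc sigma S e w / den sigma s0 w.

(** A bound of the modulus of [logy] at t + i v, as long as sigma v <= 2 pi. *)
Definition logb lc sigma S t : R := `|lc| + sigma * `|t - S| + 2 * pi.

Lemma hol_logy (Om : R[i] -> Prop) lc sigma S : hol Om id -> hol Om (logy lc sigma S).
Proof.
move=> h; apply: hol_add; first exact: hol_cst.
by apply: hol_mul; [exact: hol_cst|apply: hol_add => //; exact: hol_cst].
Qed.

Lemma hol_numer (Om : R[i] -> Prop) alpha lc sigma S e : hol Om id ->
  hol Om (numer alpha lc sigma S e).
Proof.
move=> h; apply: hol_mul; last by apply: hol_exp; exact: hol_logy.
by apply: hol_cexp; apply: hol_mul; [exact: hol_cst|exact: hol_logy].
Qed.

Lemma hol_den (Om : R[i] -> Prop) sigma s0 : hol Om id -> hol Om (den sigma s0).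
Proof.
move=> h; apply: hol_add; first exact: hol_cst.
apply: hol_cexp; apply: hol_mul; first exact: hol_cst.
by apply: hol_add => //; exact: hol_cst.
Qed.

Lemma hol_qker (Om : R[i] -> Prop) alpha lc sigma S e s0 c : hol Om id -> 0 < c ->
  (forall w, Om w -> c <= normc (den sigma s0 w)) ->
  hol Om (qker alpha lc sigma S e s0).
Proof.
move=> h c0 hc; apply: hol_mul; last by apply: hol_inv c0 hc _; exact: hol_den.
by apply: hol_mul; [exact: hol_cst|exact: hol_numer].
Qed.

Lemma normc_numer alpha lc sigma S e t v : 0 < sigma -> 0 <= v -> v * sigma <= 2 * pi ->
  normc (numer alpha lc sigma S e (t +i* v)) <=
  expR (alpha * (lc + sigma * (t - S))) * logb lc sigma S t ^+ e.
Proof.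
move=> s0 v0 vs; rewrite /numer normcM normcX normc_cexp.
have E : logy lc sigma S (t +i* v) = (lc + sigma * (t - S)) +i* (sigma * v).
  by apply/eqP; rewrite eq_complex /=; apply/andP; split; apply/eqP; ring.
rewrite E; apply: ler_pM; rewrite ?expR_ge0 ?exprn_ge0 ?normc_ge0//.
  by rewrite ReM /= mul0r subr0.
rewrite lerXn2r ?nnegrE ?normc_ge0//.
  by rewrite /logb !addr_ge0 ?mulr_ge0 ?pi_ge0// ltW.
rewrite (le_trans (normc_le_ReIm _))//= /logb.
have := ler_normD lc (sigma * (t - S)); rewrite normrM (gtr0_norm s0).
rewrite (@ger0_norm _ (sigma * v)) ?mulr_ge0// ?(ltW s0)//.
lra.
Qed.

Lemma denE sigma s0 t v : den sigma s0 (t +i* v) =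
  1 + (expR (sigma * (t - s0)))%:C * (cos (sigma * v) +i* sin (sigma * v)).
Proof.
congr (1 + _); rewrite /cexp !ReM !ImM /=.
rewrite (_ : sigma * (t - s0) - 0 * (v - 0) = sigma * (t - s0)); last by ring.
rewrite (_ : sigma * (v - 0) + 0 * (t - s0) = sigma * v); last by ring.
by apply/eqP; rewrite eq_complex /=; apply/andP; split; apply/eqP; ring.
Qed.

Lemma den_radial sigma s0 t v :
  `|1 - expR (sigma * (t - s0))| <= normc (den sigma s0 (t +i* v)).
Proof.
rewrite denE; set p := expR _; set z := _ +i* _.
have z1 : normc z = 1 by rewrite /z /normc cos2Dsin2 sqrtr1.
have p0 : 0 <= p by exact: expR_ge0.
have pz : normc (p%:C * z) = p by rewrite normcM z1 mulr1 normcR ger0_norm.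
have := normcD (1 + p%:C * z) (- (p%:C * z)); rewrite addrK normcN pz normc_1.
have := normcD (1 + p%:C * z) (-1); rewrite addrAC subrr add0r normcN pz normc_1.
by move=> *; rewrite ler_norml; apply/andP; split; lra.
Qed.

Lemma den_pos sigma s0 t v : 0 <= cos (sigma * v) ->
  1 <= normc (den sigma s0 (t +i* v)).
Proof.
move=> c0; rewrite denE; set p := expR _.
have p0 : 0 <= p by exact: expR_ge0.
apply: le_trans (Re_le_normc _).
rewrite ReD ReM /= mul0r subr0 ger0_norm ?lerDl ?mulr_ge0//.
by rewrite addr_ge0 ?mulr_ge0.
Qed.

Lemma den_sin sigma s0 t v : `|sin (sigma * v)| <= normc (den sigma s0 (t +i* v)).
Proof.
rewrite denE; set p := expR _; set C := cos _; set Sn := sin _.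
have cs : C ^+ 2 + Sn ^+ 2 = 1 by exact: cos2Dsin2.
rewrite /normc -sqrtr_sqr ler_wsqrtr//= !mul0r subr0 add0r addr0.
have := sqr_ge0 (p + C); nra.
Qed.

Lemma one_sub_expRN x : 0 <= x -> x <= 1 -> x / 2 <= 1 - expR (- x).
Proof.
move=> x0 x1; rewrite expRN.
have e1 := expR_ge1Dx x; have e0 := expR_gt0 x.
have : (expR x)^-1 <= (1 + x)^-1 by rewrite lef_pV2// posrE; lra.
have : (1 + x)^-1 <= 1 - x / 2.
  by rewrite -div1r ler_pdivrMr; nra.
lra.
Qed.

Lemma den_left sigma s0 d t v : 0 < sigma -> t <= s0 - d ->
  1 - expR (- (sigma * d)) <= normc (den sigma s0 (t +i* v)).
Proof.
move=> sg td; apply: le_trans (den_radial _ _ _ _); apply: le_trans (ler_norm _).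
rewrite lerB// ler_expR -mulrN ler_wpM2l ?(ltW sg)//; lra.
Qed.

Lemma den_left_lin sigma s0 d t v : 0 < sigma -> 0 <= d -> sigma * d <= 1 -> t <= s0 - d ->
  sigma * d / 2 <= normc (den sigma s0 (t +i* v)).
Proof.
move=> sg d0 sd td; apply: le_trans (den_left _ sg td).
by apply: one_sub_expRN => //; rewrite mulr_ge0// ltW.
Qed.

Lemma den_right sigma s0 d t v : 0 < sigma -> 0 <= d -> s0 + d <= t ->
  sigma * d <= normc (den sigma s0 (t +i* v)).
Proof.
move=> sg d0 td; apply: le_trans (den_radial _ _ _ _); rewrite distrC.
apply: le_trans (ler_norm _); rewrite lerBrDl; apply: le_trans (expR_ge1Dx _).
by rewrite lerD2l ler_wpM2l ?(ltW sg)//; lra.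
Qed.

(** Below the height pi / sigma - d the argument of y / z stays at a distance sigma d from
that of - 1. *)
Lemma den_slot sigma s0 d t v : 0 < sigma -> 0 <= d -> sigma * d <= 1 -> 0 <= v ->
  sigma * v <= pi - sigma * d -> sigma * d / 4 <= normc (den sigma s0 (t +i* v)).
Proof.
move=> sg d0 sd v0 sv.
have sd0 : 0 <= sigma * d by rewrite mulr_ge0// ltW.
have sv0 : 0 <= sigma * v by rewrite mulr_ge0// ltW.
have [c|c] := leP (sigma * v) (pi / 2).
  apply: le_trans (den_pos _ _ _); first lra.
  by apply: cos_ge0_pihalf; apply/andP; split; lra.
apply: le_trans (den_sin _ _ _ _); apply: le_trans (ler_norm _).
have -> : sin (sigma * v) = sin (pi - sigma * v).
  by rewrite [pi - _]addrC sinDpi sinN opprK.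
apply: le_trans (sin_ge4 _ _); lra.
Qed.

(** The constant of [cesaro_upper].  It is locked because only its sign matters afterwards. *)
Definition cesaro_cst sigma : R := locked (2 / (1 - expR (- (2 * pi / sigma)))).

Lemma cesaro_cst_gt0 sigma : 0 < sigma -> 0 < cesaro_cst sigma.
Proof.
move=> s0; rewrite /cesaro_cst -lock divr_gt0// subr_gt0 expR_lt1 oppr_lt0 divr_gt0//.
by have := @pi_gt0 R; lra.
Qed.

Lemma cesaro_upper sigma n t v : 0 < sigma -> 1 / 2 <= t -> sigma^-1 <= v ->
  normc (cesaro n (nome (t +i* v))) <= cesaro_cst sigma * expR (- (4 * pi * t * v)).
Proof.
move=> s0 t2 vs; have p := @pi_gt0 R.
have si : 0 < sigma^-1 by rewrite invr_gt0.
set E := expR (- (4 * pi * t * v)).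
have nq : normc (nome (t +i* v)) = E by rewrite /nome normc_expsq mulr1.
have EE : E <= expR (- (2 * pi / sigma)).
  rewrite ler_expR lerN2.
  have : 2 * pi * (sigma^-1) <= 2 * pi * (2 * t * v).
    by rewrite ler_wpM2l//; [lra|nra].
  lra.
have e1 : expR (- (2 * pi / sigma)) < 1.
  by rewrite expR_lt1 oppr_lt0 divr_gt0//; lra.
have E0 : 0 <= E by exact: expR_ge0.
have l1 : 1 - expR (- (2 * pi / sigma)) <= normc (1 - nome (t +i* v)).
  by have := normc_sub_ge 1 (nome (t +i* v)); rewrite nq normc_1; lra.
have d0 : 0 < normc (1 - nome (t +i* v)) by lra.
rewrite (le_trans (cesaro_bound _ _ _))//.
- by apply: contraTN d0 => /eqP ->; rewrite subrr normc0 ltxx.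
- by rewrite nq; lra.
rewrite nq /cesaro_cst -lock mulrAC ler_wpM2r// ler_wpM2l// lef_pV2// posrE; lra.
Qed.

(** On the vertical line through sq M the argument of exp (2 pi i w^2) is close to pi for
small Im w, because (sq M)^2 is a half-integer; for large Im w the modulus is small. *)
Lemma nome_vert M v : 0 <= v -> 1 / 2 <= normc (1 - nome (sq M +i* v : R[i])).
Proof.
move=> v0; have p := @pi_ge2 R.
have s1 : 1 / 2 <= sq M :> R.
  apply: (@le_trans _ _ (sq 0)); last exact: sq_le.
  rewrite -(@ler_pXn2r _ 2)// ?nnegrE ?sq_ge0// ?sq2; lra.
have [v2|v2] := leP v (1 / 2).
  have E : nome (sq M +i* v : R[i]) =
     (expR (- (4 * pi * sq M * v)))%:C * cexp ('i%C * (2 * pi * (M%:R + (2^-1 - v ^+ 2)))%:C).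
    rewrite /nome /expsq -cexpR -cexpD addrA -sq2; congr cexp.
    apply/eqP; rewrite eq_complex expr2 !ReD !ImD !ReM !ImM /=.
    by apply/andP; split; apply/eqP; ring.
  rewrite E ee_nat; set e := expR _.
  apply: le_trans (Re_le_normc _); apply: le_trans (ler_norm _).
  rewrite ReD ReN /cexp !ReM !ImM /=.
  rewrite (_ : 0 * _ - 1 * 0 = 0 :> R); last by ring.
  rewrite (_ : 0 * 0 + _ = pi - 2 * pi * v ^+ 2); last by field.
  rewrite expR0 (addrC pi) cosDpi cosN.
  have c0 : 0 <= cos (2 * pi * v ^+ 2).
    have v4 : v ^+ 2 <= 1 / 4 by nra.
    have v20 := sqr_ge0 v.
    apply: cos_ge0_pihalf; apply/andP; split; nra.
  have e0 : 0 <= e by exact: expR_ge0.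
  nra.
have nq : normc (nome (sq M +i* v : R[i])) = expR (- (4 * pi * sq M * v)).
  by rewrite /nome normc_expsq mulr1.
have : expR (- (4 * pi * sq M * v)) <= 1 / 2.
  rewrite expRN -[leRHS]invrK lef_pV2 ?posrE ?expR_gt0 ?invr_gt0//.
  apply: le_trans (expR_ge1Dx _); rewrite div1r invrK.
  have : 1 / 4 <= sq M * v by nra.
  nra.
have := normc_sub_ge 1 (nome (sq M +i* v : R[i])); rewrite nq normc_1; lra.
Qed.

Lemma cesaro_vert n M v : 0 <= v ->
  normc (cesaro n (nome (sq M +i* v : R[i]))) <= 4 * expR (- (4 * pi * sq M * v)).
Proof.
move=> v0; have h := @nome_vert M v v0.
have nq : normc (nome (sq M +i* v : R[i])) = expR (- (4 * pi * sq M * v)).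
  by rewrite /nome normc_expsq mulr1.
have d0 : 0 < normc (1 - nome (sq M +i* v : R[i])) by lra.
rewrite (le_trans (cesaro_bound _ _ _))//.
- by apply: contraTN d0 => /eqP ->; rewrite subrr normc0 ltxx.
- by rewrite nq expR_le1 oppr_le0 !mulr_ge0 ?pi_ge0 ?sq_ge0.
rewrite nq mulrAC ler_wpM2r ?expR_ge0//.
by rewrite ler_pdivrMr//; lra.
Qed.

(** Split exp (- 4 pi t v) as exp (- (4 pi^2 / sigma) t) times
exp (4 pi t (pi / sigma - v)): the first factor enters Lam, and the second is the gain or loss
from being above or below the height of the pole. *)
Lemma qker_bound alpha lc sigma S e s0 t v c k n Lam :
  0 < sigma -> 0 <= v -> v * sigma <= 2 * pi -> 0 < c -> 0 <= k ->
  expR (alpha * (lc + sigma * (t - S)) - 4 * pi ^+ 2 / sigma * t) *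
    logb lc sigma S t ^+ e <= Lam ->
  c <= normc (den sigma s0 (t +i* v)) ->
  normc (cesaro n (nome (t +i* v))) <= k * expR (- (4 * pi * t * v)) ->
  normc (qker alpha lc sigma S e s0 (t +i* v) * cesaro n (nome (t +i* v))) <=
  sigma * k / c * Lam * expR (4 * pi * t * (pi / sigma - v)).
Proof.
move=> sg0 v0 vs c0 k0 hL hc hk.
have h1 := @normc_numer alpha lc sigma S e t v sg0 v0 vs.
rewrite /qker; move: (numer _ _ _ _ _ _) (cesaro _ _) (den _ _ _) h1 hc hk => Nu Kp De h1 hc hk.
rewrite !normcM normcV normcR (gtr0_norm sg0).
have hd : (normc De)^-1 <= c^-1.
  by rewrite lef_pV2// posrE// (lt_le_trans c0).
have ci : 0 < c^-1 by rewrite invr_gt0.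
set E1 := expR (alpha * (lc + sigma * (t - S))) in h1.
set L := logb _ _ _ _ ^+ e in h1 hL.
have -> : expR (4 * pi * t * (pi / sigma - v)) =
  expR (4 * pi ^+ 2 / sigma * t) * expR (- (4 * pi * t * v)).
  by rewrite -expRD; congr expR; field; rewrite gt_eqF.
have hL' : E1 * L <= Lam * expR (4 * pi ^+ 2 / sigma * t).
  have := ler_wpM2r (expR_ge0 (4 * pi ^+ 2 / sigma * t)) hL.
  by rewrite mulrAC -expRD subrK.
set E2 := expR (- _) in hk *; set E3 := expR _ in hL' *.
apply: (@le_trans _ _ (sigma * (Lam * E3) * c^-1 * (k * E2))).
  apply: ler_pM => //; rewrite ?mulr_ge0 ?normc_ge0 ?invr_ge0// ?(ltW sg0) ?normc_ge0//.
  apply: ler_pM => //; rewrite ?mulr_ge0 ?normc_ge0 ?invr_ge0// ?(ltW sg0) ?normc_ge0//.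
  by rewrite ler_wpM2l ?(ltW sg0)// (le_trans h1).
rewrite le_eqVlt; apply/orP; left; apply/eqP; ring.
Qed.

Lemma cint_exp_bound (f : R -> R[i]) a b r K : a <= b -> 0 < r -> lip a b f ->
  (forall x, a <= x <= b -> normc (f x) <= K * expR (- (r * x))) ->
  normc (cint a b f) <= K / r * expR (- (r * a)).
Proof.
move=> ab r0 lf fK.
have K0 : 0 <= K.
  have := fK a; rewrite lexx ab => /(_ isT) h.
  by rewrite -(pmulr_lge0 _ (expR_gt0 (- (r * a)))) (le_trans _ h)// normc_ge0.
have hid : holD (@rect R a b 0 0) id (fun=> 1) by apply: holD_id => w; exact: rect_bound.
have h := holDZ (- (K / r))%:C (holD_cexp (holDZ (- r)%:C hid)).
have rC : r%:C != 0 :> R[i] by rewrite fmorph_eq0 gt_eqF.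
have up : uprim a b (fun x => (K * expR (- (r * x)))%:C)
  (fun x => (- (K / r))%:C * cexp ((- r)%:C * x%:C)).
  apply: uprim_ext (holD_real h _) => /=; last by move=> t tt; split => //=; rewrite lexx.
  move=> x _; rewrite -!rmorphM cexpR -!rmorphM /= mulr1; congr (_%:C).
  by rewrite (_ : - r * x = - (r * x)); [field; rewrite gt_eqF|ring].
have := cint_le ab lf up => /(_ fK) hb; rewrite (le_trans hb)//.
rewrite -!rmorphM !cexpR -!rmorphM -rmorphB /= !mulNr opprK.
have := expR_ge0 (- (r * b)); have : 0 <= K / r by rewrite divr_ge0// ltW.
by move=> k0 e0; have := mulr_ge0 k0 e0; lra.
Qed.

(** Cauchy's theorem in three adjacent rectangles of heights B1, B2 and B3 standing on the
real axis; the low one in the middle leaves room for a pole. *)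
Lemma three_blocks (G : R[i] -> R[i]) a x1 x2 b B1 B2 B3 :
  a <= x1 -> x1 <= x2 -> x2 <= b -> 0 <= B2 -> B2 <= B1 -> B2 <= B3 ->
  hol (rect a b 0 0) G -> hol (rect a x1 0 B1) G -> hol (rect x1 x2 0 B2) G ->
  hol (rect x2 b 0 B3) G ->
  cint a b (fun x => G (x +i* 0)) + 'i%C * cint 0 B3 (fun v => G (b +i* v)) =
  cint a x1 (fun x => G (x +i* B1)) + cint x1 x2 (fun x => G (x +i* B2)) +
  cint x2 b (fun x => G (x +i* B3)) + 'i%C * (cint 0 B1 (fun v => G (a +i* v)) -
  cint B2 B1 (fun v => G (x1 +i* v)) + cint B2 B3 (fun v => G (x2 +i* v))).
Proof.
move=> ax1 x12 x2b B20 B21 B23 h0 h1 h2 h3.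
have B10 := le_trans B20 B21; have B30 := le_trans B20 B23.
have c1 := cauchy_rect ax1 B10 h1; have c2 := cauchy_rect x12 B20 h2.
have c3 := cauchy_rect x2b B30 h3.
have l0 : lip a b (fun x => G (x +i* 0)).
  by apply: hol_lip_h h0 _ => t tt; split => //=; rewrite lexx.
have ax2 := le_trans ax1 x12.
rewrite (cint_split ax2 x2b l0) (cint_split ax1 x12 (lip_sub (lexx _) x2b l0)).
have s1 := @cint_split _ 0 B2 B1 (fun v => G (x1 +i* v)) B20 B21.
have s3 := @cint_split _ 0 B2 B3 (fun v => G (x2 +i* v)) B20 B23.
rewrite s1 in c1; last by apply: hol_lip_v h1 _ => t tt; split => //=; rewrite ax1 lexx.
rewrite s3 in c3; last by apply: hol_lip_v h3 _ => t tt; split => //=; rewrite x2b lexx.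
move: c1 c2 c3.
move: (cint a x1 (fun x => G (x +i* 0))) (cint x1 x2 (fun x => G (x +i* 0)))
  (cint x2 b (fun x => G (x +i* 0))) => A1 A2 A3.
set T1 := cint a x1 _; set T2 := cint x1 x2 _; set T3 := cint x2 b _.
set V0 := cint 0 B1 _; set V1 := cint 0 B2 _; set V2 := cint B2 B1 _.
set V3 := cint 0 B2 _; set V4 := cint B2 B3 _; set V5 := cint 0 B3 _.
move=> c1 c2 c3.
have -> : A1 = T1 + 'i%C * V0 - 'i%C * (V1 + V2) by rewrite -c1 addrK.
have -> : A2 = T2 + 'i%C * V1 - 'i%C * V3 by rewrite -c2 addrK.
have -> : A3 = T3 + 'i%C * (V3 + V4) - 'i%C * V5 by rewrite -c3 addrK.
ring.
Qed.

End Kernel.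

(** * Pushing the path of integration upwards *)
Section Contour.
Context {R : realType}.
Implicit Types (s t v x y a b c d : R) (w : R[i]).
Variables (sigma alpha lc S : R) (e n M : nat) (Lam : R).
Hypothesis sigma_gt0 : 0 < sigma.
Hypothesis M3 : 3 <= @sq R M.
Hypothesis LamP : forall t : R, 0 <= t -> t <= sq M ->
  expR (alpha * (lc + sigma * (t - S)) - 4 * pi ^+ 2 / sigma * t) *
    logb lc sigma S t ^+ e <= Lam.

Let q s0 := qker alpha lc sigma S e s0.
Let G s0 (w : R[i]) := q s0 w * cesaro n (nome w).
(* the height of the top sides, where the argument of y / z is 3 pi / 2 and |1 + y / z| >= 1 *)
Let b' : R := 3 * pi / (2 * sigma).
Let kc := cesaro_cst sigma.

Lemma Lam_ge0 : 0 <= Lam.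
Proof.
apply: le_trans (LamP (lexx 0) (sq_ge0 _)); rewrite mulr_ge0 ?expR_ge0// exprn_ge0//.
by rewrite /logb !addr_ge0 ?mulr_ge0 ?pi_ge0// ltW.
Qed.

Lemma pis : 1 / sigma <= pi / (2 * sigma) /\ (pi / (2 * sigma)) * sigma = pi / 2 /\
  (pi / sigma) * sigma = pi /\ b' * sigma = 3 * pi / 2.
Proof.
have s0 : sigma != 0 by rewrite gt_eqF.
split; last by rewrite /b'; do !split; field.
have p2 := @pi_ge2 R; have si : 0 < sigma^-1 by rewrite invr_gt0.
have -> : pi / (2 * sigma) = (pi / 2) * sigma^-1 :> R by field.
by rewrite ler_wpM2r ?(ltW si)//; lra.
Qed.

Lemma hol_G s0 c (Om : R[i] -> Prop) (a x y d : R) : (forall w, Om w -> rect a x y d w) ->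
  0 < c -> (forall w, Om w -> c <= normc (den sigma s0 w)) -> hol Om (G s0).
Proof.
move=> sub c0 hc.
have hid : hol Om id by apply: hol_sub sub _; exact: hol_id_rect.
apply: hol_mul; first exact: hol_qker c0 hc.
by apply: hol_cesaro; apply: hol_expsq.
Qed.

Lemma G_up s0 c t v : 1 / 2 <= t -> t <= sq M -> 1 / sigma <= v -> v <= b' -> 0 < c ->
  c <= normc (den sigma s0 (t +i* v)) ->
  normc (G s0 (t +i* v)) <= sigma * kc / c * Lam * expR (4 * pi * t * (pi / sigma - v)).
Proof.
move=> t2 tM vs vb c0 hc; have [_ [_ [_ bE]]] := pis.
have si : 0 < sigma^-1 by rewrite invr_gt0.
have p := @pi_gt0 R.
apply: qker_bound => //.
- by apply: le_trans vs; rewrite divr_ge0// ltW.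
- have := ler_wpM2r (ltW sigma_gt0) vb; rewrite bE; lra.
- exact/ltW/cesaro_cst_gt0.
- by apply: LamP => //; lra.
- by apply: cesaro_upper => //; rewrite -div1r.
Qed.

Lemma G_left s0 c v : 0 <= v -> v <= b' -> 0 < c ->
  c <= normc (den sigma s0 (sq 0 +i* v)) ->
  normc (G s0 (sq 0 +i* v)) <= sigma * 4 / c * Lam * expR (4 * pi ^+ 2 / sigma).
Proof.
move=> v0 vb c0 hc; have [_ [_ [_ bE]]] := pis; have s1 := @sq0_ge R; have s2 := @sq0_le R.
have p := @pi_gt0 R.
have si : 0 < sigma^-1 by rewrite invr_gt0.
have H : normc (G s0 (sq 0 +i* v)) <= sigma * 4 / c * Lam * expR (4 * pi * sq 0 * (pi / sigma - v)).
  apply: qker_bound => //.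
  - have := ler_wpM2r (ltW sigma_gt0) vb; rewrite bE; lra.
  - by apply: LamP => //; [exact: sq_ge0|exact: sq_le].
  - exact: cesaro_vert.
rewrite (le_trans H)// ler_wpM2l//.
  by rewrite !mulr_ge0 ?Lam_ge0 ?invr_ge0// ltW.
rewrite ler_expR.
have -> : 4 * pi ^+ 2 / sigma = 4 * pi * 1 * (pi / sigma) :> R by field; rewrite gt_eqF.
have ps : 0 <= pi / sigma by rewrite divr_ge0// ltW.
apply: (@le_trans _ _ (4 * pi * sq 0 * (pi / sigma))).
  rewrite ler_wpM2l//; last lra.
  by rewrite !mulr_ge0 ?sq_ge0// ltW.
rewrite ler_wpM2r// ler_wpM2l//; lra.
Qed.

(** The top sides are above the height of the pole, so the kernel decays like
exp (- (2 pi^2 / sigma) x) along them. *)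
Lemma top_bound s0 a b : 1 / 2 <= a -> a <= b -> b <= sq M ->
  lip a b (fun x => G s0 (x +i* b')) ->
  normc (cint a b (fun x => G s0 (x +i* b'))) <= sigma ^+ 2 * kc / (2 * pi ^+ 2) * Lam.
Proof.
move=> a2 ab bM lf; have p := @pi_gt0 R; have [p1 [p2 [p3 bE]]] := pis.
have si : 0 < sigma^-1 by rewrite invr_gt0.
have sn : sigma != 0 by rewrite gt_eqF.
have bpos : 1 / sigma <= b'.
  rewrite (le_trans p1)// /b' ler_wpM2r ?invr_ge0 ?mulr_ge0 ?(ltW sigma_gt0)//.
  by lra.
have L0 := Lam_ge0.
have r0 : 0 < 2 * pi ^+ 2 / sigma by rewrite !mulr_gt0// exprn_gt0.
have kc0 : 0 < kc by exact: cesaro_cst_gt0.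
have := @cint_exp_bound _ _ a b (2 * pi ^+ 2 / sigma) (sigma * kc / 1 * Lam) ab r0 lf.
move=> /(_ _)/le_trans; apply.
  move=> x /andP[ax xb].
  have -> : - (2 * pi ^+ 2 / sigma * x) = 4 * pi * x * (pi / sigma - b') :> R.
    by rewrite /b'; field.
  apply: G_up => //; try lra.
  apply: le_trans (den_sin _ _ _ _).
  rewrite (mulrC sigma) bE.
  have -> : 3 * pi / 2 = pi / 2 + pi :> R by field.
  by rewrite sinDpi sin_pihalf normrN normr1.
have -> : sigma * kc / 1 * Lam / (2 * pi ^+ 2 / sigma) = sigma ^+ 2 * kc / (2 * pi ^+ 2) * Lam.
  have pn : (pi : R) != 0 by rewrite gt_eqF.
  by move: pn; move: (@pi R) => P Pn; field; rewrite sn Pn.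
rewrite ler_piMr//.
  by rewrite mulr_ge0// divr_ge0 ?mulr_ge0 ?exprn_ge0 ?(ltW p) ?(ltW sigma_gt0) ?(ltW kc0).
rewrite expR_le1 oppr_le0 mulr_ge0 ?(ltW r0)//; lra.
Qed.

Definition bottom_plus_right s0 :=
  cint (sq 0) (sq M) (fun x => G s0 (x +i* 0)) +
  'i%C * cint 0 b' (fun v => G s0 (sq M +i* v)).

Lemma hol_axis s0 : hol (rect (sq 0) (sq M) 0 0) (G s0).
Proof.
apply: (@hol_G s0 1 _ (sq 0) (sq M) 0 0) => //.
move=> [t v] [_ /=]; rewrite -eq_le => /eqP <-; apply: den_pos.
by rewrite mulr0 cos0.
Qed.

(** Near the left end t is bounded, so no decay is needed and [cesaro_vert] suffices. *)
Lemma left_bound s0 c B : 0 <= B -> B <= b' -> 0 < c ->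
  (forall v, 0 <= v -> v <= B -> c <= normc (den sigma s0 (sq 0 +i* v))) ->
  lip 0 B (fun v => G s0 (sq 0 +i* v)) ->
  normc (cint 0 B (fun v => G s0 (sq 0 +i* v))) <=
  6 * pi / c * expR (4 * pi ^+ 2 / sigma) * Lam.
Proof.
move=> B0 Bb c0 hc lf; have [_ [_ [_ bE]]] := pis; have L0 := Lam_ge0.
have bd : normc (cint 0 B (fun v => G s0 (sq 0 +i* v))) <=
    sigma * 4 / c * Lam * expR (4 * pi ^+ 2 / sigma) * (B - 0).
  apply: cint_le_cst => // v /andP[v0 vB]; apply: G_left => //.
    exact: le_trans Bb.
  exact: hc.
apply: (le_trans bd).
have -> : 6 * pi / c * expR (4 * pi ^+ 2 / sigma) * Lam =
  sigma * 4 / c * Lam * expR (4 * pi ^+ 2 / sigma) * b'.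
  rewrite /b'; move: (expR _) => E; field; by rewrite ?(gt_eqF c0) ?(gt_eqF sigma_gt0).
rewrite subr0 ler_wpM2l// !mulr_ge0 ?invr_ge0 ?expR_ge0//; exact: ltW.
Qed.

(** When the pole is above a point near the left end, a block of width 2 and of half the
height of the pole passes below it; t is bounded there, so no decay is lost. *)
Lemma contour_near s0 : s0 <= sq 0 + 1 ->
  normc (bottom_plus_right s0) <=
  (2 * (sigma * kc * expR (6 * pi ^+ 2 / sigma)) +
   sigma ^+ 2 * kc / (2 * pi ^+ 2) +
   (6 * pi / 1 * expR (4 * pi ^+ 2 / sigma) +
   pi / sigma * kc * expR (12 * pi ^+ 2 / sigma))) * Lam.
Proof.
move=> s0a; have p := @pi_gt0 R; have [p1 [p2 _]] := pis.
have sa1 := @sq0_ge R; have sa2 := @sq0_le R.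
have sn : sigma != 0 by rewrite gt_eqF.
have sg0 := sigma_gt0.
pose B : R := pi / (2 * sigma); rewrite -/B in p1 p2.
have B0 : 0 <= B by rewrite /B divr_ge0 ?(ltW p)// mulr_ge0 ?(ltW sg0).
have b3 : b' = 3 * B by rewrite /b' /B; field.
have psB : pi / sigma = 2 * B by rewrite /B; field.
have Bb : B <= b' by rewrite b3; lra.
pose x2 : R := sq 0 + 2; have ax2 : sq 0 <= x2 by rewrite lerDl.
have x2M : x2 <= sq M by apply: le_trans M3; rewrite /x2; lra.
have den1 t v : 0 <= v -> v <= B -> 1 <= normc (den sigma s0 (t +i* v)).
  move=> v0 vB; apply: den_pos; apply: cos_ge0_pihalf.
  have := ler_wpM2l (ltW sg0) vB; rewrite [sigma * B]mulrC p2 => h.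
  rewrite h andbT; apply: le_trans (mulr_ge0 (ltW sg0) v0).
  by rewrite oppr_le0 divr_ge0 ?(ltW p).
have den2 t v : x2 <= t -> sigma <= normc (den sigma s0 (t +i* v)).
  move=> t2; have := @den_right R sigma s0 1 t v sg0 ler01; rewrite mulr1; apply.
  by apply: le_trans t2; rewrite /x2; lra.
have h1 : hol (rect (sq 0) (sq 0) 0 B) (G s0).
  apply: (@hol_G s0 1 _ (sq 0) (sq 0) 0 B) => // -[t v] [_ /= /andP[? ?]].
  exact: den1.
have h2 : hol (rect (sq 0) x2 0 B) (G s0).
  apply: (@hol_G s0 1 _ (sq 0) x2 0 B) => // -[t v] [_ /= /andP[? ?]].
  exact: den1.
have h3 : hol (rect x2 (sq M) 0 b') (G s0).
  apply: (@hol_G s0 sigma _ x2 (sq M) 0 b') => // -[t v] [/= /andP[? ?] _].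
  exact: den2.
have b'0 := le_trans B0 Bb.
rewrite /bottom_plus_right (three_blocks (lexx _) ax2 x2M B0 (lexx B) Bb (hol_axis s0) h1 h2 h3).
set T1 := cint (sq 0) (sq 0) _; set T2 := cint (sq 0) x2 _; set T3 := cint x2 _ _.
set V0 := cint 0 B _; set V1 := cint B B _; set V2 := cint B b' _.
have T10 : T1 = 0 by rewrite /T1 /cint subrr.
have V10 : V1 = 0 by rewrite /V1 /cint subrr.
have bT2 : normc T2 <= 2 * (sigma * kc * expR (6 * pi ^+ 2 / sigma)) * Lam.
  rewrite (_ : _ * Lam = sigma * kc / 1 * Lam * expR (6 * pi ^+ 2 / sigma) * (x2 - sq 0)); last first.
    by rewrite /x2 divr1; move: (expR _) => E; ring.
  apply: cint_le_cst => //.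
    by apply: hol_lip_h h2 _ => t tt; split => //=; rewrite B0 lexx.
  move=> x /andP[xa xb].
  have x3 : x <= 3 by apply: (le_trans xb); rewrite /x2; lra.
  have h : normc (G s0 (x +i* B)) <= sigma * kc / 1 * Lam * expR (4 * pi * x * (pi / sigma - B)).
    apply: G_up => //; [exact: le_trans xa|exact: le_trans x2M|exact: den1].
  rewrite (le_trans h)// ler_wpM2l//.
    by rewrite divr1 !mulr_ge0 ?(ltW sg0) ?(ltW (cesaro_cst_gt0 sg0)) ?Lam_ge0.
  rewrite ler_expR psB.
  have -> : 6 * pi ^+ 2 / sigma = 4 * pi * 3 * (2 * B - B) :> R by rewrite /B; field.
  have eB : 2 * B - B = B by ring.
  by rewrite eB ler_wpM2r// ler_wpM2l// mulr_ge0 ?(ltW p).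
have bT3 : normc T3 <= sigma ^+ 2 * kc / (2 * pi ^+ 2) * Lam.
  apply: top_bound => //; first exact: le_trans ax2.
  by apply: hol_lip_h h3 _ => t tt; split => //=; rewrite b'0 lexx.
have bV0 : normc V0 <= 6 * pi / 1 * expR (4 * pi ^+ 2 / sigma) * Lam.
  apply: left_bound => //; first by move=> v; exact: den1.
  by apply: hol_lip_v h1 _ => t tt; split => //=; rewrite lexx.
have bV2 : normc V2 <= pi / sigma * kc * expR (12 * pi ^+ 2 / sigma) * Lam.
  rewrite (_ : _ * Lam = sigma * kc / sigma * Lam * expR (12 * pi ^+ 2 / sigma) * (b' - B)); last first.
    by rewrite b3 psB; move: (expR _) => E; field.
  apply: cint_le_cst => //.
    apply: hol_lip_v h3 _ => t /andP[? ?]; split => /=; first by rewrite x2M lexx.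
    by apply/andP; split => //; exact: le_trans B0 _.
  move=> v /andP[v0 vB].
  have h : normc (G s0 (x2 +i* v)) <= sigma * kc / sigma * Lam * expR (4 * pi * x2 * (pi / sigma - v)).
    by apply: G_up => //; [exact: le_trans ax2|exact: le_trans v0|exact: den2].
  rewrite (le_trans h)// ler_wpM2l//.
    by rewrite (mulrC sigma) mulfK// mulr_ge0 ?(ltW (cesaro_cst_gt0 sg0)) ?Lam_ge0.
  rewrite ler_expR psB.
  have -> : 12 * pi ^+ 2 / sigma = 4 * pi * 3 * (2 * B) :> R by rewrite /B; field.
  have x20 : 0 <= x2 := le_trans (sq_ge0 0) ax2.
  have x23 : x2 <= 3 by rewrite /x2; lra.
  apply: (@le_trans _ _ (4 * pi * x2 * (2 * B))).
    by rewrite ler_wpM2l// ?mulr_ge0 ?(ltW p)// lerBlDr lerDl (le_trans B0).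
  have B20 : 0 <= 2 * B by rewrite mulr_ge0.
  by apply: ler_wpM2r => //; apply: ler_wpM2l => //; rewrite mulr_ge0 ?(ltW p).
have dist (a b c d : R) : (a + b + (c + d)) * Lam = a * Lam + b * Lam + (c * Lam + d * Lam) by ring.
rewrite T10 V10 add0r subr0 dist.
apply: le_trans (normcD _ _) _; apply: lerD.
  exact: le_trans (normcD _ _) (lerD bT2 bT3).
rewrite normcM normci mul1r.
exact: le_trans (normcD _ _) (lerD bV0 bV2).
Qed.

(** The vertical sides of the block below the pole start at a depth d below the height
pi / sigma, where the denominator is of order d.  The exponential decay along the side has rate
4 pi t, so the integral is of order 1 / (d t), which is bounded since d is of order 1 / s0. *)
Lemma slot_side s0 d d0 t B2 : 0 < d -> d * s0 = d0 -> d0 <= 1 -> d <= 1 -> sigma * d <= 1 ->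
  1 <= s0 -> s0 / 2 <= t -> t <= s0 + 1 -> 1 / 2 <= t -> t <= sq M ->
  B2 = pi / sigma - d -> 1 / sigma <= B2 -> B2 <= b' ->
  (forall v, sigma * d / 4 <= normc (den sigma s0 (t +i* v))) ->
  lip B2 b' (fun v => G s0 (t +i* v)) ->
  normc (cint B2 b' (fun v => G s0 (t +i* v))) <= 2 * kc * expR (8 * pi) / d0 * Lam.
Proof.
move=> dp ds0 d01 d1 sd s01 ts0 t1 t2 tM B2E B2s B2b hden lf.
have p := @pi_gt0 R; have p22 := @pi_ge2 R; have sn : sigma != 0 by rewrite gt_eqF.
have tp : 0 < t by apply: lt_le_trans t2.
have d00 : 0 < d0 by rewrite -ds0 mulr_gt0// (lt_le_trans _ s01).
have sd4 : 0 < sigma * d / 4 by rewrite divr_gt0// mulr_gt0.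
have r0 : 0 < 4 * pi * t by rewrite !mulr_gt0.
have := @cint_exp_bound _ _ B2 b' (4 * pi * t)
  (sigma * kc / (sigma * d / 4) * Lam * expR (4 * pi * t * (pi / sigma))) B2b r0 lf.
move=> /(_ _)/le_trans; apply.
  move=> v /andP[v0 vB]; rewrite -[leRHS]mulrA -expRD -mulrBr.
  by apply: G_up => //; exact: le_trans v0.
have -> : sigma * kc / (sigma * d / 4) * Lam * expR (4 * pi * t * (pi / sigma)) / (4 * pi * t) *
  expR (- (4 * pi * t * B2)) = (kc * Lam / (d * t * pi)) * expR (4 * pi * t * d).
  have -> : expR (4 * pi * t * d) = expR (4 * pi * t * (pi / sigma)) * expR (- (4 * pi * t * B2)).
    by rewrite -expRD B2E; congr expR; ring.
  have pn : (pi : R) != 0 by rewrite gt_eqF.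
  have tn : t != 0 by rewrite gt_eqF.
  have dn : d != 0 by rewrite gt_eqF.
  move: (expR _) (expR _) => E1 E2; move: pn; move: (@pi R) => P Pn.
  by field; rewrite sn Pn tn dn.
have kL : 0 <= kc * Lam by rewrite mulr_ge0 ?(ltW (cesaro_cst_gt0 sigma_gt0)) ?Lam_ge0.
have -> : 2 * kc * expR (8 * pi) / d0 * Lam = (kc * Lam * (2 / d0)) * expR (8 * pi) by ring.
have dt : d * t <= 2.
  apply: (@le_trans _ _ (d * (s0 + 1))); first by rewrite ler_wpM2l ?(ltW dp).
  by rewrite mulrDr mulr1 ds0; lra.
have dt2 : d0 / 2 <= d * t by rewrite -ds0 -mulrA ler_wpM2l ?(ltW dp).
apply: ler_pM; rewrite ?expR_ge0//.
- by rewrite divr_ge0// !mulr_ge0 ?(ltW p) ?(ltW dp) ?(ltW tp).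
- rewrite ler_wpM2l//.
  have -> : 2 / d0 = (d0 / 2)^-1 by rewrite invf_div.
  have dt0 : 0 < d * t by rewrite mulr_gt0.
  rewrite lef_pV2 ?posrE ?divr_gt0// ?mulr_gt0// (le_trans dt2)// ler_peMr ?(ltW dt0)//.
  by rewrite (le_trans _ p22)// ler1n.
- rewrite ler_expR (_ : 8 * pi = 4 * pi * 2); last by ring.
  by rewrite -mulrA ler_wpM2l ?mulr_ge0 ?(ltW p)// mulrC.
Qed.

(** A block of half-width d and height pi / sigma - d passes below the pole, with d of order
1 / s0: then exp (4 pi t d) stays bounded on it, while its width 2 d compensates the size
1 / d of the inverse of the denominator. *)
Lemma contour_far s0 : sq 0 + 1 <= s0 -> s0 + 2 <= sq M ->
  normc (bottom_plus_right s0) <=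
  (sigma ^+ 2 * kc / (2 * pi ^+ 2) + 8 * kc * expR (8 * pi) +
   sigma ^+ 2 * kc / (2 * pi ^+ 2) +
   (6 * pi / (1 - expR (- sigma)) * expR (4 * pi ^+ 2 / sigma) +
   2 * kc * expR (8 * pi) / Num.min 1 sigma^-1 +
   2 * kc * expR (8 * pi) / Num.min 1 sigma^-1)) * Lam.
Proof.
set d0 : R := Num.min 1 sigma^-1; move=> s0a s0M.
have p := @pi_gt0 R; have p22 := @pi_ge2 R; have [p1 [p2 [p3 bE]]] := pis.
have sa1 := @sq0_ge R; have sa2 := @sq0_le R.
have sn : sigma != 0 by rewrite gt_eqF.
have sg0 := sigma_gt0.
have d00 : 0 < d0 by rewrite /d0 lt_min ltr01 invr_gt0.
have d01 : d0 <= 1 by rewrite /d0 ge_min lexx.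
have d0s : d0 * sigma <= 1.
  by rewrite -ler_pdivlMr// div1r /d0 ge_min lexx orbT.
clearbody d0.
have s01 : 3 / 2 <= s0 by lra.
have s00 : 0 < s0 by lra.
have s10 : 1 <= s0 by lra.
(* the half-width of the block below the pole *)
pose d : R := d0 / s0.
have dp : 0 < d by rewrite divr_gt0.
have ds0 : d * s0 = d0 by rewrite /d divfK ?gt_eqF.
have dd0 : d <= d0 by rewrite -ds0 ler_peMr// ltW.
have d1 : d <= 1 by exact: le_trans d01.
have sd1 : sigma * d <= 1.
  by apply: le_trans d0s; rewrite mulrC ler_wpM2r// ltW.
have ds2 : d <= s0 / 2.
  rewrite -(ler_pM2r s00) ds0 (le_trans d01)//.
  have : 3 / 2 * (3 / 2) <= s0 * s0 by apply: ler_pM.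
  lra.
clearbody d.
pose B2 : R := pi / sigma - d; pose x1 : R := s0 - d; pose x2 : R := s0 + d.
have ps : 2 / sigma <= pi / sigma by rewrite ler_wpM2r// invr_ge0 ltW.
have dsi : d <= 1 / sigma by rewrite ler_pdivlMr// mulrC.
have si : 0 < 1 / sigma by rewrite divr_gt0.
have B2s : 1 / sigma <= B2.
  rewrite /B2 lerBrDr (le_trans _ ps)// (_ : 2 / sigma = 1 / sigma + 1 / sigma); last by ring.
  by rewrite lerD2l.
have B20 : 0 <= B2 := le_trans (ltW si) B2s.
have B2b : B2 <= b'.
  rewrite /B2 lerBlDr (_ : b' = pi / sigma + pi / sigma / 2); last by rewrite /b'; field.
  by rewrite -addrA lerDl addr_ge0 ?divr_ge0 ?(ltW p) ?(ltW sg0) ?(ltW dp).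
have b'0 : 0 <= b' := le_trans B20 B2b.
have ax1 : sq 0 <= x1 by rewrite /x1; lra.
have x12 : x1 <= x2 by rewrite /x1 /x2; lra.
have x2M : x2 <= sq M by apply: le_trans s0M; rewrite lerD2l; lra.
have denl2 t v : t <= x1 -> sigma * d / 2 <= normc (den sigma s0 (t +i* v)).
  by apply: den_left_lin => //; exact: ltW.
have denr t v : x2 <= t -> sigma * d <= normc (den sigma s0 (t +i* v)).
  by apply: den_right => //; exact: ltW.
have denm t v : 0 <= v -> v <= B2 -> sigma * d / 4 <= normc (den sigma s0 (t +i* v)).
  move=> v0 vB; apply: den_slot => //; first exact: ltW.
  rewrite (le_trans (ler_wpM2l (ltW sg0) vB))// /B2 mulrBr.
  by rewrite [sigma * (pi / sigma)]mulrC p3.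
have sdp : 0 < sigma * d by rewrite mulr_gt0.
have h1 : hol (rect (sq 0) x1 0 b') (G s0).
  apply: (@hol_G s0 (sigma * d / 2) _ (sq 0) x1 0 b') => //; first by rewrite divr_gt0.
  by move=> [t v] [/= /andP[? ?] _]; exact: denl2.
have h2 : hol (rect x1 x2 0 B2) (G s0).
  apply: (@hol_G s0 (sigma * d / 4) _ x1 x2 0 B2) => //; first by rewrite divr_gt0.
  by move=> [t v] [_ /= /andP[? ?]]; exact: denm.
have h3 : hol (rect x2 (sq M) 0 b') (G s0).
  apply: (@hol_G s0 (sigma * d) _ x2 (sq M) 0 b') => // -[t v] [/= /andP[? ?] _].
  exact: denr.
rewrite /bottom_plus_right (three_blocks ax1 x12 x2M B20 B2b B2b (hol_axis s0) h1 h2 h3).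
set T1 := cint (sq 0) x1 _; set T2 := cint x1 x2 _; set T3 := cint x2 _ _.
set V0 := cint 0 b' _; set V1 := cint B2 b' _; set V2 := cint B2 b' _.
have bT1 : normc T1 <= sigma ^+ 2 * kc / (2 * pi ^+ 2) * Lam.
  apply: top_bound => //; first exact: le_trans x12 x2M.
  by apply: hol_lip_h h1 _ => t tt; split => //=; rewrite b'0 lexx.
have bT3 : normc T3 <= sigma ^+ 2 * kc / (2 * pi ^+ 2) * Lam.
  apply: top_bound => //; first by rewrite (le_trans sa1)// (le_trans ax1).
  by apply: hol_lip_h h3 _ => t tt; split => //=; rewrite b'0 lexx.
have bT2 : normc T2 <= 8 * kc * expR (8 * pi) * Lam.
  rewrite (_ : _ * Lam = sigma * kc / (sigma * d / 4) * Lam * expR (8 * pi) * (x2 - x1)); last first.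
    by rewrite /x2 /x1; move: (expR _) => E; field; rewrite sn gt_eqF.
  apply: cint_le_cst => //.
    by apply: hol_lip_h h2 _ => t tt; split => //=; rewrite B20 lexx.
  move=> x /andP[xa xb].
  have h : normc (G s0 (x +i* B2)) <=
      sigma * kc / (sigma * d / 4) * Lam * expR (4 * pi * x * (pi / sigma - B2)).
    apply: G_up => //; rewrite ?divr_gt0//; last exact: denm.
      by rewrite (le_trans _ xa)// (le_trans sa1).
    exact: le_trans x2M.
  rewrite (le_trans h)// ler_wpM2l//.
    by rewrite mulr_ge0 ?Lam_ge0// divr_ge0 ?mulr_ge0 ?invr_ge0 ?(ltW sg0) ?(ltW dp) ?(ltW (cesaro_cst_gt0 sg0)).
  rewrite ler_expR (_ : pi / sigma - B2 = d); last by rewrite /B2; ring.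
  rewrite (_ : 8 * pi = 4 * pi * 2); last by ring.
  rewrite -mulrA ler_wpM2l ?mulr_ge0 ?(ltW p)//.
  apply: (@le_trans _ _ ((s0 + d) * d)); first by rewrite ler_wpM2r ?(ltW dp).
  rewrite mulrDl mulrC ds0 (_ : 2 = 1 + 1)// lerD// -(mulr1 1) ler_pM// ltW//.
have bV0 : normc V0 <= 6 * pi / (1 - expR (- sigma)) * expR (4 * pi ^+ 2 / sigma) * Lam.
  apply: left_bound => //; first by rewrite subr_gt0 expR_lt1 oppr_lt0.
    move=> v _ _; rewrite -[X in expR (- X)](mulr1 sigma); apply: den_left => //.
    by rewrite lerBrDr.
  by apply: hol_lip_v h1 _ => t tt; split => //=; rewrite ax1 lexx.
have bV1 : normc V1 <= 2 * kc * expR (8 * pi) / d0 * Lam.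
  apply: (@slot_side s0 d) => //; rewrite /x1.
  - by rewrite lerBrDr {2}(splitr s0) lerD2l.
  - by rewrite (le_trans _ (_ : s0 <= s0 + 1))// ?lerDl// gerBl ltW.
  - by rewrite (le_trans sa1).
  - exact: le_trans x12 x2M.
  - move=> v; apply: le_trans (denl2 _ v (lexx x1)).
    by rewrite ler_wpM2l ?(ltW sdp)// lef_pV2 ?posrE// ler_nat.
  - apply: hol_lip_v h1 _ => t /andP[? ?]; split => /=; first by rewrite ax1 lexx.
    by apply/andP; split => //; exact: le_trans B20 _.
have bV2 : normc V2 <= 2 * kc * expR (8 * pi) / d0 * Lam.
  apply: (@slot_side s0 d) => //; rewrite /x2.
  - by rewrite (le_trans (_ : s0 / 2 <= s0))// ?lerDl ?(ltW dp)// ler_pdivrMr// ler_peMr ?(ltW s00)// ler1n.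
  - by rewrite lerD2l.
  - by rewrite (le_trans sa1)// (le_trans ax1 x12).
  - move=> v; apply: le_trans (denr _ v (lexx x2)).
    by rewrite ler_pdivrMr// ler_peMr ?(ltW sdp)// ler1n.
  - apply: hol_lip_v h3 _ => t /andP[? ?]; split => /=; first by rewrite x2M lexx.
    by apply/andP; split => //; exact: le_trans B20 _.
have dist (a b c a' b0 c0 : R) : (a + b + c + (a' + b0 + c0)) * Lam =
  a * Lam + b * Lam + c * Lam + (a' * Lam + b0 * Lam + c0 * Lam) by ring.
rewrite dist.
apply: le_trans (normcD _ _) _; apply: lerD.
  apply: le_trans (normcD _ _) _; apply: lerD bT3.
  exact: le_trans (normcD _ _) (lerD bT1 bT2).
rewrite normcM normci mul1r.
apply: le_trans (normcD _ _) _; apply: lerD bV2.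
exact: le_trans (normcB _ _) (lerD bV0 bV1).
Qed.

End Contour.

(** * Complex conjugation *)
Section Conj.
Context {R : realType}.
Implicit Types (z w : R[i]).

Definition cj z : R[i] := (z^*)%C.

Lemma cjD z w : cj (z + w) = cj z + cj w.
Proof. by case: z => a b; case: w => c d; apply/eqP; rewrite eq_complex /= opprD !eqxx. Qed.

Lemma cjM z w : cj (z * w) = cj z * cj w.
Proof.
case: z => a b; case: w => c d; apply/eqP; rewrite eq_complex /=.
by apply/andP; split; apply/eqP; ring.
Qed.

Lemma cjX z n : cj (z ^+ n) = cj z ^+ n.
Proof.
elim: n => [|n IH]; last by rewrite !exprS cjM IH.
by rewrite !expr0; apply/eqP; rewrite eq_complex /= oppr0 !eqxx.
Qed.

Lemma cjR (x : R) : cj x%:C = x%:C.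
Proof. by apply/eqP; rewrite eq_complex /= oppr0 !eqxx. Qed.

Lemma cjN z : cj (- z) = - cj z.
Proof. by case: z => a b; apply/eqP; rewrite eq_complex /= !eqxx. Qed.

Lemma normc_cj z : normc (cj z) = normc z.
Proof. by case: z => a b; rewrite /normc /= sqrrN. Qed.

Lemma cj_sum (I : Type) (r : seq I) (F : I -> R[i]) :
  cj (\sum_(i <- r) F i) = \sum_(i <- r) cj (F i).
Proof.
elim: r => [|i r IH]; last by rewrite !big_cons cjD IH.
by rewrite !big_nil; apply/eqP; rewrite eq_complex /= oppr0 !eqxx.
Qed.

Lemma cj_addr z : z + cj z = (2 * complex.Re z)%:C.
Proof.
case: z => a b; apply/eqP; rewrite eq_complex /=.
by apply/andP; split; apply/eqP; ring.
Qed.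

Lemma cint_cj (f : R -> R[i]) (a b : R) : a <= b -> lip a b f ->
  cint a b (fun x => cj (f x)) = cj (cint a b f).
Proof.
move=> ab lf; have [F uF] := lip_prim ab lf.
have u2 : uprim a b (fun x => cj (f x)) (fun x => cj (F x)).
  case: uF => K K0 h; exists K => // x y xx yy.
  have -> : cj (F y) - cj (F x) - cj (f x) * (y - x)%:C =
     cj (F y - F x - f x * (y - x)%:C) by rewrite !cjD !cjN cjM cjR.
  by rewrite normc_cj h.
by rewrite (cintE ab uF) (cintE ab u2) cjD cjN.
Qed.

Lemma cesaro_cj n z : cesaro n (cj z) = cj (cesaro n z).
Proof.
rewrite /cesaro cjM cj_sum; congr (_ * _).
  by rewrite (_ : n%:R^-1 = (n%:R^-1 : R)%:C) ?cjR// fmorphV rmorph_nat.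
apply: eq_bigr => m _; rewrite cj_sum; apply: eq_bigr => k _; by rewrite cjX.
Qed.

End Conj.

(** * The quadrature error *)
Section Quadrature.
Context {R : realType}.
Implicit Types (s t v x a b c d : R) (w : R[i]).
Variables (sigma alpha lc S : R) (e M : nat) (Lam : R).
Hypothesis sigma_gt0 : 0 < sigma.
Hypothesis M3 : 3 <= @sq R M.
Hypothesis LamP : forall t : R, 0 <= t -> t <= sq M ->
  expR (alpha * (lc + sigma * (t - S)) - 4 * pi ^+ 2 / sigma * t) *
    logb lc sigma S t ^+ e <= Lam.

Let q s0 := qker alpha lc sigma S e s0.

Definition height : R := 3 * pi / (2 * sigma).

(** The limit of the Cesaro means in the open first quadrant. *)
Definition Kinf (w : R[i]) : R[i] := nome w / (1 - nome w).

(** The sum of the constants of [contour_far] and [contour_near]. *)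
Definition contour_cst : R :=
  (sigma ^+ 2 * cesaro_cst sigma / (2 * pi ^+ 2) + 8 * cesaro_cst sigma * expR (8 * pi) +
   sigma ^+ 2 * cesaro_cst sigma / (2 * pi ^+ 2) +
   (6 * pi / (1 - expR (- sigma)) * expR (4 * pi ^+ 2 / sigma) +
   2 * cesaro_cst sigma * expR (8 * pi) / Num.min 1 sigma^-1 +
   2 * cesaro_cst sigma * expR (8 * pi) / Num.min 1 sigma^-1)) +
  (2 * (sigma * cesaro_cst sigma * expR (6 * pi ^+ 2 / sigma)) +
   sigma ^+ 2 * cesaro_cst sigma / (2 * pi ^+ 2) +
   (6 * pi / 1 * expR (4 * pi ^+ 2 / sigma) +
   pi / sigma * cesaro_cst sigma * expR (12 * pi ^+ 2 / sigma))).

Lemma contour_bound n s0 : s0 + 2 <= sq M ->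
  normc (cint (sq 0) (sq M) (fun t => q s0 t%:C * cesaro n (nome t%:C)) +
    'i%C * cint 0 height (fun v => q s0 (sq M +i* v) * cesaro n (nome (sq M +i* v)))) <=
  contour_cst * Lam.
Proof.
move=> s0M; have L0 : 0 <= Lam by exact: (@Lam_ge0 _ sigma alpha lc S e M).
have k0 := cesaro_cst_gt0 sigma_gt0; have p := @pi_gt0 R.
have e1 : 0 < 1 - expR (- sigma) by rewrite subr_gt0 expR_lt1 oppr_lt0.
have m0 : 0 < Num.min 1 sigma^-1 by rewrite lt_min ltr01 invr_gt0.
rewrite /contour_cst mulrDl.
have [h|h] := leP s0 (sq 0 + 1).
  have := @contour_near _ sigma alpha lc S e n M Lam sigma_gt0 M3 LamP s0 h.
  move=> /le_trans; apply; rewrite lerDr mulr_ge0//.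
  by rewrite !addr_ge0 ?mulr_ge0 ?invr_ge0 ?exprn_ge0 ?mulr_ge0 ?exprn_ge0 ?expR_ge0// ltW.
have := @contour_far _ sigma alpha lc S e n M Lam sigma_gt0 LamP s0 (ltW h) s0M.
move=> /le_trans; apply; rewrite lerDl mulr_ge0//.
by rewrite !addr_ge0 ?mulr_ge0 ?invr_ge0 ?exprn_ge0 ?mulr_ge0 ?exprn_ge0 ?expR_ge0// ltW.
Qed.

Definition qreal (s0 t : R) : R := sigma * (expR (alpha * (lc + sigma * (t - S))) *
  (lc + sigma * (t - S)) ^+ e) / (1 + expR (sigma * (t - s0))).

Lemma q_real s0 t : q s0 t%:C = (qreal s0 t)%:C.
Proof.
rewrite /q /qker /numer /den /logy /qreal.
rewrite -!rmorphB -!rmorphM -rmorphD -!rmorphM !cexpR -rmorphXn -!rmorphM.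
by rewrite (_ : 1 = (1 : R)%:C)// -rmorphD -fmorphV -rmorphM.
Qed.

(** Minus the contribution of the vertical segment above sq M, where the path of integration
ends after the deformation. *)
Definition right_side s0 : R[i] :=
  - ('i%C * cint 0 height (fun v => q s0 (sq M +i* v) * Kinf (sq M +i* v))).

Lemma height_ge0 : 0 <= height.
Proof. by rewrite /height divr_ge0 ?mulr_ge0 ?pi_ge0// ltW. Qed.

Lemma lip_q_axis s0 : lip (sq 0) (sq M) (fun t => q s0 t%:C).
Proof.
have h : hol (rect (sq 0) (sq M) 0 0) (q s0).
  apply: (@hol_qker _ _ alpha lc sigma S e s0 1) => //; first exact: hol_id_rect.
  move=> [t v] [_ /=]; rewrite -eq_le => /eqP <-; apply: den_pos.
  by rewrite mulr0 cos0.
by apply: (hol_lip_real h) => t tt; split => //=; rewrite lexx.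
Qed.

Lemma hol_right (s0 : R) : s0 + 2 <= sq M ->
  hol (rect (sq M) (sq M) 0 height) (q s0).
Proof.
move=> h; apply: (@hol_qker _ _ alpha lc sigma S e s0 sigma) => //; first exact: hol_id_rect.
move=> [t v] [/=]; rewrite -eq_le => /eqP <- _.
by have := @den_right R sigma s0 1 (sq M) v sigma_gt0 ler01; rewrite mulr1; apply; lra.
Qed.

Lemma hol_Kinf : hol (rect (sq M) (sq M) 0 height) Kinf.
Proof.
apply: hol_mul; first exact: hol_nome.
apply: (@hol_inv _ _ _ (1 / 2)) => //.
  by move=> [t v] [/=]; rewrite -eq_le => /eqP <- /andP[v0 _]; exact: nome_vert.
apply: hol_add; first exact: hol_cst.
have -> : (fun w : R[i] => - nome w) = (fun w => (-1) * nome w).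
  by apply/funext => w; rewrite mulN1r.
by apply: hol_mul; [exact: hol_cst|exact: hol_nome].
Qed.

Lemma lip_right (F : R[i] -> R[i]) : hol (rect (sq M) (sq M) 0 height) F ->
  lip 0 height (fun v => F (sq M +i* v)).
Proof. by move=> h; apply: hol_lip_v h _ => t tt; split => //=; rewrite lexx. Qed.

(** The kernel is 1 + k + conj k with k = cesaro n (nome w) on the real axis, so the sum minus the
integral is the limit of twice the real part of the integral of q k, which the deformation
turns into the right side plus O(Lam).  The vertical segment contributes a quantity that is not
small; it is kept, with the limit in n of the kernel, which is uniform there by [nome_vert]. *)
Lemma quadrature_error s0 : s0 + 2 <= sq M ->
  normc (\sum_(j < M) (qreal s0 (Num.sqrt j.+1%:R) / (2 * Num.sqrt j.+1%:R))%:C -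
    cint (sq 0) (sq M) (fun t => q s0 t%:C) - (2 * complex.Re (right_side s0))%:C) <=
  2 * contour_cst * Lam.
Proof.
move=> s0M; apply/ler_addgt0Pr => eta eta0.
have ab : @sq R 0 <= sq M by exact: sq_le.
have lq := lip_q_axis s0.
have hg : hol (rect (sq 0) (sq M) 0 0) (fun w : R[i] => (2 * w)^-1).
  apply: (@hol_inv _ _ _ 1) => //.
    move=> [t v] [/andP[t0 _] hv].
    have -> : v = 0 by apply/eqP; rewrite eq_le andbC; exact: hv.
    rewrite normcM (normc_natr 2) (_ : t +i* 0 = t%:C)// normcR.
    have t1 : sq 0 <= t by [].
    have := @sq0_ge R; have := ler_norm t; lra.
  by apply: hol_mul; [exact: hol_cst|exact: hol_id_rect].
pose g t := q s0 t%:C * (2 * t%:C)^-1.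
have lg : lip (sq 0) (sq M) g.
  apply: lipM => //; apply: (hol_lip_real hg) => t tt; split => //=; by rewrite lexx.
have e2 : 0 < eta / 2 by rewrite divr_gt0.
have [n0 hn0] := fejer_sum e2 lg.
have hv := hol_right s0M.
have lqv := lip_right hv.
have [B B0 hB] := lip_bounded lqv.
have hp := height_ge0.
(* n is large both for the Fejer sum and for the limit of the Cesaro means on the right side *)
pose n := (n0 + Num.truncn (32 * B * height / eta))%N.
have nb : 16 * B * height / n.+1%:R <= eta / 2.
  have : 32 * B * height / eta <= n.+1%:R.
    by rewrite (le_trans (ltW (truncnS_gt _)))// ler_nat ltnS leq_addl.
  rewrite ler_pdivrMr// => h; rewrite ler_pdivrMr ?ltr0n//; lra.
have := hn0 n (leq_addr _ _).
pose I := cint (sq 0) (sq M) (fun t => q s0 t%:C * cesaro n.+1 (nome t%:C)).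
have lI : lip (sq 0) (sq M) (fun t => q s0 t%:C * cesaro n.+1 (nome t%:C)).
  by apply: lipM => //; exact: lip_cesaro_nome.
have -> : cint (sq 0) (sq M) (fun s => 2 * s%:C * g s * Fej n.+1 s%:C) =
   cint (sq 0) (sq M) (fun t => q s0 t%:C) + (I + cj I).
  rewrite -(cint_cj ab lI) -cintD//; last first.
    have [L L0 hL] := lI; exists L => // x y xx yy.
    by rewrite -cjN -cjD normc_cj hL.
  have lI2 : lip (sq 0) (sq M) (fun t => q s0 t%:C * cesaro n.+1 (nome t%:C) + cj (q s0 t%:C * cesaro n.+1 (nome t%:C))).
    apply: lipD => //; have [L L0 hL] := lI; exists L => // x y xx yy.
    by rewrite -cjN -cjD normc_cj hL.
  rewrite -cintD//; symmetry; apply: cint_ext => //; last exact: lipD.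
  move=> t /andP[t0 t1].
  have tn : t%:C != 0 :> R[i].
    by rewrite fmorph_eq0 gt_eqF//; have := @sq0_ge R; lra.
  have n2 : (2 : R[i]) != 0 by rewrite pnatr_eq0.
  have -> : 2 * t%:C * g t = q s0 t%:C by rewrite /g mulrCA divff ?mulf_neq0// mulr1.
  rewrite /Fej cjM q_real cjR -q_real.
  rewrite -cesaro_cj /cj nome_conj; ring.
have -> : \sum_(j < M) g (Num.sqrt j.+1%:R) =
  \sum_(j < M) (qreal s0 (Num.sqrt j.+1%:R) / (2 * Num.sqrt j.+1%:R))%:C.
  apply: eq_bigr => j _; rewrite /g q_real.
  by rewrite !(rmorphM, fmorphV, rmorph_nat).
set Sm := \sum_(j < M) _; set J := cint (sq 0) (sq M) _ => hF.
have hC := @contour_bound n.+1 s0 s0M; rewrite -/I in hC.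
pose Vn := cint 0 height (fun v => q s0 (sq M +i* v) * cesaro n.+1 (nome (sq M +i* v))).
rewrite -/Vn in hC.
have hk : hol (rect (sq M) (sq M) 0 height) (fun w => cesaro n.+1 (nome w)).
  by apply: hol_cesaro; exact: hol_nome.
have lqK : lip 0 height (fun v => q s0 (sq M +i* v) * Kinf (sq M +i* v)).
  exact: (lip_right (hol_mul hv hol_Kinf)).
have lqk : lip 0 height (fun v => q s0 (sq M +i* v) * cesaro n.+1 (nome (sq M +i* v))).
  exact: (lip_right (hol_mul hv hk)).
have hr : normc (- ('i%C * Vn) - right_side s0) <= B * (8 / n.+1%:R) * (height - 0).
  rewrite /right_side opprK addrC -mulrBr normcM normci mul1r.
  have lqk1 : lip 0 height (fun v => -1 * (q s0 (sq M +i* v) * cesaro n.+1 (nome (sq M +i* v)))).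
    by apply: lipM lqk; exact: lip_cst.
  rewrite -mulN1r -(cintZ _ hp lqk) -(cintD hp lqK lqk1).
  apply: cint_le_cst => //; first exact: lipD.
  move=> v vv; have v0 : 0 <= v by case/andP: vv.
  have -> : q s0 (sq M +i* v) * Kinf (sq M +i* v) +
     -1 * (q s0 (sq M +i* v) * cesaro n.+1 (nome (sq M +i* v))) =
     - (q s0 (sq M +i* v) * (cesaro n.+1 (nome (sq M +i* v)) - Kinf (sq M +i* v))) by ring.
  rewrite normcN normcM ler_pM ?normc_ge0 ?hB//.
  have h := @nome_vert R M v v0.
  have d0 : 0 < normc (1 - nome (sq M +i* v : R[i])) by lra.
  rewrite (le_trans (cesaro_limit _ _ _))//.
  - by apply: contraTN d0 => /eqP ->; rewrite subrr normc0 ltxx.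
  - by rewrite /nome normc_expsq expR_le1 oppr_le0 !mulr_ge0 ?pi_ge0 ?sq_ge0.
  rewrite ler_wpM2r ?invr_ge0// ler_pdivrMr ?exprn_gt0//.
  have : (1 / 2) ^+ 2 <= normc (1 - nome (sq M +i* v : R[i])) ^+ 2.
    by rewrite lerXn2r ?nnegrE ?normc_ge0.
  lra.
have hI : normc (I - right_side s0) <= contour_cst * Lam + B * (8 / n.+1%:R) * (height - 0).
  have -> : I - right_side s0 = (I + 'i%C * Vn) + (- ('i%C * Vn) - right_side s0) by ring.
  by rewrite (le_trans (normcD _ _))// lerD.
have -> : Sm - J - (2 * complex.Re (right_side s0))%:C =
  - (J + (I + cj I) - Sm) + ((I - right_side s0) + cj (I - right_side s0)).
  by rewrite -cj_addr cjD cjN; ring.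
rewrite (le_trans (normcD _ _))// normcN.
have := normcD (I - right_side s0) (cj (I - right_side s0)); rewrite normc_cj.
have -> : 2 * contour_cst * Lam = 2 * (contour_cst * Lam) by ring.
rewrite (_ : 16 * B * height / n.+1%:R = 2 * (B * (8 / n.+1%:R) * (height - 0))) in nb.
  move: hF hI nb; clear; move: (B * _ * _) (contour_cst * Lam) (normc (I - _)) (normc (J + _ - Sm)).
  move: (normc (I - right_side s0 + _)) => a1 a2 a3 a4 a5 h1 h2 h3 h4; lra.
by rewrite subr0; ring.
Qed.

End Quadrature.

(** * Approximation by polynomials without constant term *)
Section Polyz.
Context {R : realType}.
Implicit Types (z c E a b : R) (n : nat) (f : R -> R).

Lemma lipV a b (f : R -> R[i]) c : 0 < c -> (forall x, a <= x <= b -> c <= normc (f x)) ->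
  lip a b f -> lip a b (fun x => (f x)^-1).
Proof.
move=> c0 fc [L L0 h]; exists (L * c^-1 ^+ 2); first by rewrite mulr_ge0// exprn_ge0// invr_ge0 ltW.
move=> x y xx yy.
have nz u : a <= u <= b -> f u != 0.
  by move=> uu; apply: contraTneq (fc _ uu) => ->; rewrite normc0 -ltNge.
have -> : (f y)^-1 - (f x)^-1 = - ((f y - f x) * ((f x)^-1 * (f y)^-1)).
  by field; rewrite !nz.
rewrite normcN !normcM mulrAC ler_pM ?mulr_ge0 ?normc_ge0 ?h//.
have V u : a <= u <= b -> normc (f u)^-1 <= c^-1.
  by move=> uu; rewrite normcV lef_pV2 ?posrE ?fc// (lt_le_trans c0)// fc.
by rewrite expr2 ler_pM ?normc_ge0 ?V.
Qed.

Lemma lipRM a b (f g : R -> R) : lip a b (fun x => (f x)%:C) -> lip a b (fun x => (g x)%:C) ->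
  lip a b (fun x => (f x * g x)%:C).
Proof. by move=> lf lg; under eq_fun do rewrite rmorphM; exact: lipM. Qed.

Lemma lipX a b (f : R -> R[i]) n : lip a b f -> lip a b (fun x => f x ^+ n).
Proof.
move=> lf; elim: n => [|n IH]; first exact: lip_cst.
by under eq_fun do rewrite exprS; exact: lipM.
Qed.

Lemma lip_expR a b c : lip a b (fun x => (expR (c * x))%:C).
Proof.
have h : hol (@rect R a b 0 0) (fun w => cexp (c%:C * w)).
  by apply: hol_cexp; apply: hol_mul; [exact: hol_cst|exact: hol_id_rect].
have := hol_lip_real h => /(_ a b)/=.
under eq_fun do rewrite -rmorphM cexpR.
by apply=> t tt; split => //=; rewrite lexx.
Qed.

Lemma geom_expand (F : fieldType) (d u : F) n : d != 0 -> d - u != 0 ->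
  (d - u)^-1 = \sum_(k < n) u ^+ k * d^-1 ^+ k.+1 + (u / d) ^+ n / (d - u).
Proof.
move=> d0 du; elim: n => [|n IH]; first by rewrite big_ord0 add0r mul1r.
rewrite big_ord_recr /= {1}IH -addrA; congr (_ + _).
rewrite !exprS !exprMn; move: (u ^+ n) (d^-1 ^+ n) => p q; field.
by rewrite d0 du.
Qed.

(** The factor z makes the approximation exact at z = 0, where all targets vanish. *)
Definition polyz n f E := exists2 Q : {poly R}, (size Q <= n)%N &
  forall z, 0 < z -> z <= 1 -> `|f z - z * Q.[z]| <= E.

Lemma polyzD n f g E E' : polyz n f E -> polyz n g E' ->
  polyz n (fun z => f z + g z) (E + E').
Proof.
move=> [Q sQ hQ] [Q' sQ' hQ']; exists (Q + Q').
  by rewrite (leq_trans (size_polyD _ _))// geq_max sQ.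
move=> z z0 z1; have -> : f z + g z - z * (Q + Q').[z] = (f z - z * Q.[z]) + (g z - z * Q'.[z]).
  by rewrite hornerD; ring.
by rewrite (le_trans (ler_normD _ _))// lerD ?hQ ?hQ'.
Qed.

Lemma polyzZ n f E c : polyz n f E -> polyz n (fun z => c * f z) (`|c| * E).
Proof.
move=> [Q sQ hQ]; exists (c *: Q); first by rewrite (leq_trans (size_scale_leq _ _)).
move=> z z0 z1; rewrite hornerZ mulrCA -mulrBr normrM ler_wpM2l//; exact: hQ.
Qed.

Lemma polyz_le n f E E' : E <= E' -> polyz n f E -> polyz n f E'.
Proof. by move=> EE [Q sQ h]; exists Q => // z z0 z1; rewrite (le_trans (h _ _ _)). Qed.

Lemma polyz_ext n f g E : (forall z, 0 < z -> z <= 1 -> f z = g z) ->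
  polyz n f E -> polyz n g E.
Proof. by move=> e [Q sQ h]; exists Q => // z z0 z1; rewrite -e// h. Qed.

Lemma polyz_err n f g E E' : (forall z, 0 < z -> z <= 1 -> `|g z - f z| <= E') ->
  polyz n f E -> polyz n g (E + E').
Proof.
move=> e [Q sQ h]; exists Q => // z z0 z1.
have -> : g z - z * Q.[z] = (f z - z * Q.[z]) + (g z - f z) by ring.
by rewrite (le_trans (ler_normD _ _))// lerD ?h ?e.
Qed.

Lemma polyz_sum (I : Type) (r : seq I) (f : I -> R -> R) (E : I -> R) n :
  (forall i, polyz n (f i) (E i)) -> polyz n (fun z => \sum_(i <- r) f i z) (\sum_(i <- r) E i).
Proof.
move=> h; elim: r => [|i r IH].
  exists 0; first by rewrite size_poly0.
  by move=> z _ _; rewrite !big_nil horner0 mulr0 subrr normr0.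
rewrite big_cons; apply: polyz_ext (polyzD (h i) IH).
by move=> z _ _; rewrite big_cons.
Qed.

(** Expansions are taken around 1/2, the centre of [0, 1], from which the poles - y are
farther than the ends. *)
Definition half_poly n (c : nat -> R) : {poly R} :=
  \sum_(k < n) c k *: ((1 / 2)%:P - 'X) ^+ k.

Lemma size_half_poly n (c : nat -> R) : (size (half_poly n c) <= n)%N.
Proof.
apply: (leq_trans (size_sum _ _ _)); apply/bigmax_leqP => k _.
apply: (leq_trans (size_scale_leq _ _)); apply: (leq_trans (size_poly_exp_leq _ _)).
have s2 : (size (((1 / 2)%:P - 'X)%R : {poly R}) <= 2)%N.
  rewrite (leq_trans (size_polyD _ _))// size_polyN size_polyX geq_max andbT.
  exact: leq_trans (size_polyC_leq1 _) _.
rewrite (leq_ltn_trans _ (ltn_ord k))//.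
by case: (size _) s2 => [|[|[|]]]//= _; rewrite ?mul0n ?mul1n.
Qed.

Lemma horner_half_poly n (c : nat -> R) z : (half_poly n c).[z] = \sum_(k < n) c k * (1 / 2 - z) ^+ k.
Proof.
rewrite /half_poly horner_sum; apply: eq_bigr => k _.
by rewrite hornerZ horner_exp hornerD hornerC hornerN hornerX.
Qed.

Lemma ReZ (x : R) (w : R[i]) : complex.Re (x%:C * w) = x * complex.Re w.
Proof. by rewrite ReM /= mul0r subr0. Qed.

Lemma Re_sum (I : Type) (r : seq I) (F : I -> R[i]) :
  complex.Re (\sum_(i <- r) F i) = \sum_(i <- r) complex.Re (F i).
Proof. by elim: r => [|i r IH]; rewrite ?big_nil// !big_cons ReD IH. Qed.

(** Expanding 1 / (z + Y t) in powers of 1/2 - z under the integral sign leaves the last term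
of the geometric series as the only error. *)
Lemma int_polyz a b (h Y : R -> R[i]) c n E : a <= b -> 0 < c -> lip a b h -> lip a b Y ->
  (forall t z, a <= t <= b -> 0 < z -> z <= 1 -> c <= normc (Y t + z%:C)) ->
  (forall z, 0 < z -> z <= 1 -> normc (cint a b (fun t =>
     h t * (((1 / 2 - z)%:C * (Y t + (1 / 2)%:C)^-1) ^+ n * (Y t + z%:C)^-1))) <= E) ->
  polyz n (fun z => complex.Re (cint a b (fun t => h t * (z%:C * (Y t + z%:C)^-1)))) E.
Proof.
move=> ab c0 lh lY Yc hE.
have half0 : 0 < 1 / 2 :> R by lra.
have half1 : 1 / 2 <= 1 :> R by lra.
have lD : lip a b (fun t => (Y t + (1 / 2)%:C)^-1).
  apply: (lipV c0) => [x xx|]; first exact: Yc.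
  by apply: lipD => //; exact: lip_cst.
pose co k := complex.Re (cint a b (fun t => h t * (Y t + (1 / 2)%:C)^-1 ^+ k.+1)).
exists (half_poly n co); first exact: size_half_poly.
move=> z z0 z1.
have lZ : lip a b (fun t => (Y t + z%:C)^-1).
  apply: (lipV c0) => [x xx|]; first exact: Yc.
  by apply: lipD => //; exact: lip_cst.
pose u : R[i] := (1 / 2 - z)%:C.
pose T k t := z%:C * u ^+ k * (h t * (Y t + (1 / 2)%:C)^-1 ^+ k.+1).
pose W t := h t * ((u * (Y t + (1 / 2)%:C)^-1) ^+ n * (Y t + z%:C)^-1).
have lT k : lip a b (fun t => h t * (Y t + (1 / 2)%:C)^-1 ^+ k.+1).
  by apply: lipM => //; exact: lipX.
have lTk k : lip a b (T k) by apply: lipM => //; exact: lip_cst.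
have lW : lip a b W.
  by apply: lipM => //; apply: lipM => //; apply: lipX; apply: lipM => //; exact: lip_cst.
have lzW : lip a b (fun t => z%:C * W t) by apply: lipM => //; exact: lip_cst.
have -> : cint a b (fun t => h t * (z%:C * (Y t + z%:C)^-1)) =
  \sum_(k < n) z%:C * u ^+ k * cint a b (fun t => h t * (Y t + (1 / 2)%:C)^-1 ^+ k.+1)
  + z%:C * cint a b W.
  rewrite -cintZ//.
  have -> : \sum_(k < n) z%:C * u ^+ k * cint a b (fun t => h t * (Y t + (1 / 2)%:C)^-1 ^+ k.+1) =
     \sum_(k < n) cint a b (T k).
    by apply: eq_bigr => k _; rewrite /T cintZ.
  rewrite -(@cint_sum _ _ _ _ _ (fun k : 'I_n => T k))//.
  have ls : lip a b (fun x => \sum_(k < n) T k x) by apply: lip_sum => k; exact: lTk.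
  rewrite -cintD//; symmetry; apply: cint_ext => //; last exact: lipD.
  move=> t tt.
  have d0 : Y t + (1 / 2)%:C != 0.
    by apply: contraTneq (Yc t _ tt half0 half1) => ->; rewrite normc0 -ltNge.
  have dz : Y t + (1 / 2)%:C - u = Y t + z%:C.
    by rewrite /u -addrA -rmorphB; congr (_ + _%:C); ring.
  have d1 : Y t + (1 / 2)%:C - u != 0.
    by rewrite dz; apply: contraTneq (Yc t _ tt z0 z1) => ->; rewrite normc0 -ltNge.
  have := geom_expand n d0 d1; rewrite dz => ->.
  rewrite mulrDr mulrDr; congr (_ + _); last by rewrite /W; ring.
  by rewrite mulr_sumr mulr_sumr; apply: eq_bigr => k _; rewrite /T; ring.
rewrite ReD Re_sum horner_half_poly ReZ.
set s1 := \sum_(k < n) _; set s2 := \sum_(k < n) _.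
have -> : s1 = z * s2.
  rewrite /s1 /s2 mulr_sumr; apply: eq_bigr => k _.
  by rewrite /u -rmorphXn -rmorphM ReZ /co; ring.
rewrite addrAC subrr add0r normrM -[leRHS]mul1r ler_pM//.
  by rewrite ger0_norm// ltW.
exact: le_trans (Re_le_normc _) (hE z z0 z1).
Qed.

(** The extreme case is z = 0 or z = 1 and y = c. *)
Lemma rho_ratio c z y : 0 < c -> 0 < z -> z <= 1 -> c <= y ->
  `|(1 / 2 - z) / (y + 1 / 2)| <= (1 + 2 * c)^-1.
Proof.
move=> c0 z0 z1 cy; have d0 : 0 < y + 1 / 2 by lra.
rewrite normrM normfV (gtr0_norm d0) ler_pdivrMr// [leRHS]mulrC ler_pdivlMr; last lra.
have : `|1 / 2 - z| <= 1 / 2 by rewrite ler_norml; apply/andP; split; lra.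
move=> h; have c2 : 0 <= 1 + 2 * c by lra.
by apply: le_trans (ler_wpM2r c2 h) _; lra.
Qed.

Lemma polyz_frac n y c : 0 < c -> c <= y -> polyz n (fun z => z / (z + y)) (((1 + 2 * c)^-1) ^+ n * c^-1).
Proof.
move=> c0 cy.
exists (half_poly n (fun k => (y + 1 / 2)^-1 ^+ k.+1)); first exact: size_half_poly.
move=> z z0 z1; have d0 : y + 1 / 2 != 0 by apply: lt0r_neq0; lra.
have dz : y + 1 / 2 - (1 / 2 - z) = z + y by ring.
have d1 : y + 1 / 2 - (1 / 2 - z) != 0 by rewrite dz; apply: lt0r_neq0; lra.
have := geom_expand n d0 d1; rewrite dz => ->; rewrite horner_half_poly.
rewrite mulrDr; under eq_bigr do rewrite mulrC.
rewrite addrAC subrr add0r !normrM -[leRHS]mul1r ler_pM//.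
  by rewrite ger0_norm// ltW.
rewrite ler_pM ?normr_ge0//.
  rewrite normrX lerXn2r ?nnegrE ?rho_ratio// invr_ge0; lra.
by rewrite normfV lef_pV2 ?posrE ?normr_gt0 ?ger0_norm//; try lra; apply: lt0r_neq0; lra.
Qed.

End Polyz.

(** * The end of the path is analytic in z *)
Section RightSide.
Context {R : realType}.
Variables (sigma alpha lc S : R) (e M : nat).
Hypothesis sigma_gt0 : 0 < sigma.
Let LY := lc + sigma * (sq M - S).
Hypothesis LY1 : 1 <= LY.
Hypothesis LY2 : 3 * sigma <= LY.
Implicit Types (z : R).

(** The point of the real axis where y = z. *)
Definition s0_of z := S + (ln z - lc) / sigma.

Lemma s0_of_le z : 0 < z -> z <= 1 -> s0_of z + 2 <= sq M.
Proof.
move=> z0 z1; have l0 : ln z <= 0 by rewrite ln_le0.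
rewrite /s0_of -lerBrDr -lerBrDl ler_pdivrMr//; move: LY2; rewrite /LY => h.
apply: (@le_trans _ _ (- lc)); first lra.
have := sigma_gt0; nra.
Qed.

(** The value of y on the vertical segment above sq M; its modulus is constant. *)
Definition Yv (v : R) : R[i] := cexp (logy lc sigma S (sq M +i* v)).

Lemma normc_Yv v : normc (Yv v) = expR LY.
Proof.
rewrite /Yv normc_cexp /logy ReD ReM /=; congr expR.
by rewrite /LY mul0r subr0.
Qed.

Lemma qker_Yv z v : 0 < z ->
  qker alpha lc sigma S e (s0_of z) (sq M +i* v) =
  sigma%:C * numer alpha lc sigma S e (sq M +i* v) * (z%:C * (Yv v + z%:C)^-1).
Proof.
move=> z0; rewrite /qker; congr (_ * _).
have -> : den sigma (s0_of z) (sq M +i* v) = 1 + Yv v * z%:C^-1.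
  have -> : z%:C^-1 = cexp (- (ln z)%:C) by rewrite cexpN cexpR lnK.
  rewrite /den /Yv -cexpD; congr (1 + cexp _).
  rewrite /logy /s0_of rmorphD /= rmorphM rmorphB fmorphV /=.
  have s0 : sigma%:C != 0 :> R[i] by rewrite fmorph_eq0 gt_eqF.
  by field.
have zn : z%:C != 0 :> R[i] by rewrite fmorph_eq0 gt_eqF.
rewrite -[RHS]invrK invfM invrK; congr (_^-1).
by rewrite [RHS]mulrC mulrDl mulfV// addrC.
Qed.

Lemma right_polyz n rho : 1 / 3 <= rho ->
  polyz n (fun z => 2 * complex.Re (right_side sigma alpha lc S e M (s0_of z)))
   (2 * sigma * (expR (alpha * LY) * logb lc sigma S (sq M) ^+ e) * 2 * rho ^+ n * height sigma).
Proof.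
move=> r3; have H0 := height_ge0 sigma_gt0.
have e2 : 2 <= expR LY.
  by rewrite (le_trans _ (expR_ge1Dx LY))// (_ : 2 = 1 + 1 :> R) ?lerD2l//; ring.
pose h v := - (2 * 'i%C * sigma%:C) * (numer alpha lc sigma S e (sq M +i* v) * Kinf (sq M +i* v)).
have hid : hol (@rect R (sq M) (sq M) 0 (height sigma)) id by exact: hol_id_rect.
have lnK : lip 0 (height sigma) (fun v => numer alpha lc sigma S e (sq M +i* v) * Kinf (sq M +i* v)).
  exact: (lip_right (hol_mul (@hol_numer R _ alpha lc sigma S e hid) (@hol_Kinf R sigma M))).
have lh : lip 0 (height sigma) h by apply: lipM => //; exact: lip_cst.
have lY : lip 0 (height sigma) Yv.
  apply: (@lip_right _ sigma M (fun w => cexp (logy lc sigma S w))).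
  by apply: hol_cexp; exact: hol_logy.
have Yz (x : R) v : 0 < x -> x <= 1 -> expR LY - x <= normc (Yv v + x%:C).
  move=> x0 x1; rewrite -(normc_Yv v) -[Yv v in leLHS](addrK x%:C).
  by rewrite lerBlDr (le_trans (normcD _ _))// normcN normcR gtr0_norm.
apply: polyz_ext (@int_polyz R 0 (height sigma) h Yv 1 n _ H0 ltr01 lh lY _ _).
- move=> z z0 z1.
  have s0M : s0_of z + 2 <= sq M by exact: s0_of_le.
  have lqK : lip 0 (height sigma) (fun v => qker alpha lc sigma S e (s0_of z) (sq M +i* v) *
      Kinf (sq M +i* v)).
    exact: (lip_right (hol_mul (hol_right alpha lc S e sigma_gt0 s0M) (@hol_Kinf R sigma M))).
  rewrite -ReZ; congr complex.Re.
  rewrite /right_side -mulN1r !mulrA -cintZ//.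
  symmetry; apply: cint_ext => //; last by apply: lipM => //; exact: lip_cst.
  move=> v vv; rewrite qker_Yv// /h (_ : (2 : R)%:C = 2) ?rmorph_nat//; ring.
- by move=> t z tt z0 z1; apply: le_trans (Yz z t z0 z1); lra.
move=> z z0 z1.
have lZ c : 0 < c -> c <= 1 -> lip 0 (height sigma) (fun t => (Yv t + c%:C)^-1).
  move=> c0 c1; apply: (lipV ltr01) => [x xx|]; last by apply: lipD => //; exact: lip_cst.
  by apply: le_trans (Yz _ x c0 c1); lra.
rewrite -[height sigma in leRHS]subr0; apply: cint_le_cst => //.
  apply: lipM => //; apply: lipM; last exact: lZ.
  by apply: lipX; apply: lipM; [exact: lip_cst|apply: lZ; lra].
move=> v /andP[v0 vH].
have p := @pi_gt0 R.
have vs : v * sigma <= 2 * pi.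
  have : v * sigma <= height sigma * sigma by rewrite ler_wpM2r// ltW.
  have -> : height sigma * sigma = 3 * pi / 2 by rewrite /height; field; rewrite gt_eqF.
  lra.
have hb : normc (h v) <= 2 * sigma * (expR (alpha * LY) * logb lc sigma S (sq M) ^+ e) * 2.
  rewrite /h normcM normcN.
  have -> : normc (2 * 'i * sigma%:C : R[i]) = 2 * sigma.
    by rewrite !normcM normci mulr1 (normc_natr 2) normcR (gtr0_norm sigma_gt0).
  rewrite -[leRHS]mulrA ler_wpM2l// ?mulr_ge0 ?(ltW sigma_gt0)// normcM.
  apply: ler_pM; rewrite ?normc_ge0//; first exact: normc_numer.
  have q := @nome_vert R M v v0.
  rewrite /Kinf normcM normcV ler_pdivrMr; last lra.
  have : normc (nome (sq M +i* v : R[i])) <= 1.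
    by rewrite /nome normc_expsq expR_le1 oppr_le0 !mulr_ge0 ?pi_ge0 ?sq_ge0.
  lra.
rewrite normcM; apply: ler_pM; rewrite ?normc_ge0//.
rewrite normcM -[leRHS]mulr1; apply: ler_pM; rewrite ?normc_ge0//.
  rewrite normcX lerXn2r ?nnegrE ?normc_ge0//; first lra.
  apply: le_trans r3; rewrite normcM normcV normcR.
  have h2 : 3 / 2 <= normc (Yv v + (1 / 2)%:C) by apply: le_trans (Yz _ v _ _); lra.
  rewrite ler_pdivrMr; last lra.
  apply: (@le_trans _ _ (1 / 2)); last lra.
  by rewrite ler_norml; apply/andP; split; lra.
rewrite normcV invf_le1; first by apply: le_trans (Yz _ v z0 z1); lra.
by apply: lt_le_trans (Yz _ v z0 z1); lra.
Qed.

End RightSide.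

(** * From the integral to a rational function *)
Section SumToRational.
Context {R : realType}.
Variables (sigma alpha lc : R) (N1 e M : nat) (Lam c : R).
Let S : R := Num.sqrt N1%:R.
Hypothesis sigma_gt0 : 0 < sigma.
Hypothesis alpha_gt0 : 0 < alpha.
Let LY := lc + sigma * (sq M - S).
Hypothesis LY1 : 1 <= LY.
Hypothesis LY2 : 3 * sigma <= LY.
Hypothesis N1M : (N1 <= M)%N.
Hypothesis M3 : 3 <= @sq R M.
Hypothesis c0 : 0 < c.
Hypothesis c1 : c <= 1.
Hypothesis clc : c <= expR lc.
Hypothesis LamP : forall t : R, 0 <= t -> t <= sq M ->
  expR (alpha * (lc + sigma * (t - S)) - 4 * pi ^+ 2 / sigma * t) *
    logb lc sigma S t ^+ e <= Lam.
Implicit Types (z : R).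

(** The logarithm of the opposite of the pole of index j + 1. *)
Definition lq j : R := lc + sigma * (Num.sqrt j.+1%:R - Num.sqrt N1%:R).
(** The quadrature weight of the fraction z / (z + y). *)
Definition bq j : R := sigma * (expR (alpha * lq j) * lq j ^+ e) / (2 * Num.sqrt j.+1%:R).
Definition Jq z : R := complex.Re (cint (sq 0) (sq M)
   (fun t => qker alpha lc sigma (Num.sqrt N1%:R) e (s0_of sigma lc (Num.sqrt N1%:R) z) t%:C)).

Lemma qreal_frac z j : 0 < z ->
  qreal sigma alpha lc S e (s0_of sigma lc S z) (Num.sqrt j.+1%:R) / (2 * Num.sqrt j.+1%:R) =
  bq j * (z / (z + expR (lq j))).
Proof.
move=> z0; rewrite /qreal /bq -/(lq j).
have -> : expR (sigma * (Num.sqrt j.+1%:R - s0_of sigma lc S z)) = expR (lq j) / z.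
  rewrite -[z in RHS]lnK ?posrE// -expRN -expRD; congr expR.
  by rewrite /lq /s0_of /S; field; rewrite gt_eqF.
have s1 : Num.sqrt j.+1%:R != 0 :> R by rewrite gt_eqF// sqrtr_gt0.
have e0 := expR_gt0 (lq j); set E := expR (lq j) in e0 *; field.
by rewrite s1 /= !gt_eqF// addr_gt0// ?divr_gt0.
Qed.

Lemma bq_bound j : (N1 <= j)%N -> (j < M)%N ->
  `|bq j| <= sigma * (expR (alpha * LY) * logb lc sigma S (sq M) ^+ e).
Proof.
move=> Nj jM; have p := @pi_gt0 R.
have s1 : 1 <= Num.sqrt j.+1%:R :> R by rewrite -{1}(sqrtr1 R) ler_wsqrtr// ler1n.
have sS : S <= Num.sqrt j.+1%:R by rewrite ler_wsqrtr// ler_nat ltnW.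
have sM : Num.sqrt j.+1%:R <= sq M :> R.
  have h : j.+1%:R <= M%:R :> R by rewrite ler_nat.
  by rewrite ler_wsqrtr//; move: h; lra.
rewrite /bq normrM normfV (gtr0_norm (_ : 0 < 2 * _)); last lra.
rewrite ler_pdivrMr; last lra.
apply: (@le_trans _ _ (sigma * (expR (alpha * LY) * logb lc sigma S (sq M) ^+ e))); last first.
  rewrite ler_peMr//; last lra.
  rewrite mulr_ge0 ?mulr_ge0 ?expR_ge0 ?exprn_ge0 ?(ltW sigma_gt0)// /logb.
  by rewrite !addr_ge0 ?mulr_ge0 ?(ltW sigma_gt0) ?(ltW p).
rewrite normrM (gtr0_norm sigma_gt0) ler_wpM2l ?(ltW sigma_gt0)// normrM (gtr0_norm (expR_gt0 _)).
apply: ler_pM; rewrite ?expR_ge0 ?normr_ge0//.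
  rewrite ler_expR ler_wpM2l ?(ltW alpha_gt0)// /lq /LY lerD2l ler_wpM2l ?(ltW sigma_gt0)//.
  by rewrite lerD2r.
rewrite normrX lerXn2r ?nnegrE ?normr_ge0//.
  by rewrite /logb !addr_ge0 ?mulr_ge0 ?(ltW sigma_gt0) ?(ltW p).
rewrite /lq /logb (le_trans (ler_normD _ _))// -addrA lerD2l.
rewrite normrM (gtr0_norm sigma_gt0) -[leLHS]addr0 lerD//; last by rewrite mulr_ge0 ?(ltW p).
rewrite ler_wpM2l ?(ltW sigma_gt0)// -/S ger0_norm ?subr_ge0// ger0_norm ?lerD2r//.
by rewrite subr_ge0 (le_trans sS).
Qed.

(** The M-term sum differs from the integral by the quadrature error and the right side; its
terms with j > N1 have poles at a distance at least c from [0, 1] and are moved to the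
polynomial. *)
Lemma sum_to_rational n :
  polyz n (fun z => Jq z - \sum_(0 <= j < N1) bq j * (z / (z + expR (lq j))))
   (2 * contour_cst sigma * Lam +
    M%:R * (sigma * (expR (alpha * LY) * logb lc sigma S (sq M) ^+ e)) *
      ((1 + 2 * c)^-1 ^+ n * c^-1) +
    2 * sigma * (expR (alpha * LY) * logb lc sigma S (sq M) ^+ e) * 2 *
      (1 + 2 * c)^-1 ^+ n * height sigma).
Proof.
have r3 : 1 / 3 <= (1 + 2 * c)^-1.
  have h1 : 0 < 1 + 2 * c by rewrite addr_gt0 ?mulr_gt0.
  have h2 : 1 + 2 * c <= 3.
    by rewrite (_ : 3 = 1 + 2 * 1 :> R) ?lerD2l ?ler_wpM2l//; ring.
  by rewrite div1r lef_pV2 ?posrE.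
have hR := polyzZ (-1) (right_polyz alpha e sigma_gt0 LY1 LY2 n r3).
rewrite normrN1 mul1r in hR.
set W := sigma * _.
have W0 : 0 <= W.
  rewrite mulr_ge0 ?mulr_ge0 ?expR_ge0 ?exprn_ge0 ?(ltW sigma_gt0)// /logb.
  by rewrite !addr_ge0 ?mulr_ge0 ?(ltW sigma_gt0) ?pi_ge0.
have rc0 : 0 <= (1 + 2 * c)^-1 ^+ n * c^-1.
  by rewrite mulr_ge0 ?exprn_ge0 ?invr_ge0 ?addr_ge0 ?mulr_ge0 ?(ltW c0).
have hP : polyz n (fun z => \sum_(N1 <= j < M) bq j * (z / (z + expR (lq j))))
    (M%:R * W * ((1 + 2 * c)^-1 ^+ n * c^-1)).
  have h : polyz n (fun z => \sum_(j <- index_iota N1 M | (N1 <= j < M)%N) bq j * (z / (z + expR (lq j))))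
      (\sum_(j <- index_iota N1 M) W * ((1 + 2 * c)^-1 ^+ n * c^-1)).
    pose f (j : nat) z := if (N1 <= j < M)%N then bq j * (z / (z + expR (lq j))) else 0.
    apply: (@polyz_ext _ n (fun z => \sum_(j <- index_iota N1 M) f j z)).
      by move=> z _ _; rewrite [RHS]big_mkcond.
    apply: polyz_sum => j; rewrite /f; case: (boolP (N1 <= j < M)%N) => [/andP[Nj jM]|_]; last first.
      exists 0; first by rewrite size_poly0.
      by move=> z _ _; rewrite horner0 mulr0 subrr normr0 mulr_ge0.
    apply: polyz_le (polyzZ (bq j) (polyz_frac n c0 _)).
      by rewrite ler_wpM2r// bq_bound.
    apply: le_trans clc _; rewrite ler_expR /lq lerDl mulr_ge0 ?(ltW sigma_gt0)//.
    by rewrite subr_ge0 ler_wsqrtr// ler_nat (leq_trans Nj).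
  apply: polyz_le (polyz_ext _ h).
    rewrite big_const_seq count_predT size_iota iter_addr_0 -[leRHS]mulrA -[leLHS]mulr_natl.
    by rewrite ler_wpM2r ?(mulr_ge0 W0)// ler_nat leq_subr.
  by move=> z _ _; rewrite -big_nat.
rewrite -addrA addrC; apply: polyz_err (polyzD hP hR) => z z0 z1.
have s0M := s0_of_le sigma_gt0 LY2 z0 z1.
have := quadrature_error sigma_gt0 M3 LamP s0M.
set rs := complex.Re (right_side _ _ _ _ _ _ _).
set J := cint _ _ _; set Sm := \sum_(j < M) _ => hq.
have Sm_E : complex.Re Sm = \sum_(0 <= j < N1) bq j * (z / (z + expR (lq j))) +
    \sum_(N1 <= j < M) bq j * (z / (z + expR (lq j))).
  rewrite -big_cat_nat//= big_mkord Re_sum; apply: eq_bigr => j _.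
  by rewrite -qreal_frac.
have hh0 := le_trans (Re_le_normc _) hq; move: hh0; rewrite ReD ReN ReD ReN Sm_E (_ : complex.Re (2 * rs)%:C = 2 * rs)//.
set s1 := \sum_(0 <= j < N1) _; set s2 := \sum_(N1 <= j < M) _; rewrite -normrN => hh.
have -> : Jq z = complex.Re J by [].
have -> // : complex.Re J - s1 - (s2 + -1 * (2 * rs)) =
  - (s1 + s2 - complex.Re J - 2 * rs) by ring.
Qed.

End SumToRational.

(** * Real integrals and their tails *)
Section RealIntegral.
Context {R : realType}.
Implicit Types (a b c d x : R) (f g : R -> R).

Definition rlip a b f := lip a b (fun x => (f x)%:C).
Definition rint a b f : R := complex.Re (cint a b (fun x => (f x)%:C)).

Lemma rlip_cst a b c : rlip a b (fun=> c).
Proof. exact: lip_cst. Qed.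

Lemma rlip_id a b : rlip a b id.
Proof. exact: lip_id. Qed.

Lemma rlipM a b f g : rlip a b f -> rlip a b g -> rlip a b (fun x => f x * g x).
Proof. exact: lipRM. Qed.

Lemma rlipD a b f g : rlip a b f -> rlip a b g -> rlip a b (fun x => f x + g x).
Proof. by move=> lf lg; rewrite /rlip; under eq_fun do rewrite rmorphD; exact: lipD. Qed.

Lemma rlipX a b f n : rlip a b f -> rlip a b (fun x => f x ^+ n).
Proof. by move=> lf; rewrite /rlip; under eq_fun do rewrite rmorphXn; exact: lipX. Qed.

Lemma rlipV a b f c : 0 < c -> (forall x, a <= x <= b -> c <= f x) ->
  rlip a b f -> rlip a b (fun x => (f x)^-1).
Proof.
move=> c0 fc lf; rewrite /rlip; under eq_fun do rewrite fmorphV.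
by apply: (lipV c0) => // x xx; rewrite normcR (le_trans (fc _ xx))// ler_norm.
Qed.

Lemma rint_split a b c f : a <= c -> c <= b -> rlip a b f ->
  rint a b f = rint a c f + rint c b f.
Proof. by move=> ac cb lf; rewrite /rint (cint_split ac cb lf) ReD. Qed.

Lemma rintD a b f g : a <= b -> rlip a b f -> rlip a b g ->
  rint a b (fun x => f x + g x) = rint a b f + rint a b g.
Proof.
move=> ab lf lg; rewrite /rint -ReD -cintD//; congr (complex.Re (cint _ _ _)).
by apply/funext => x; rewrite rmorphD.
Qed.

Lemma rintZ a b f c : a <= b -> rlip a b f -> rint a b (fun x => c * f x) = c * rint a b f.
Proof.
move=> ab lf; rewrite /rint -ReZ -cintZ//; congr (complex.Re (cint _ _ _)).
by apply/funext => x; rewrite rmorphM.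
Qed.

Lemma rint_ext a b f g : a <= b -> (forall x, a <= x <= b -> f x = g x) -> rlip a b f ->
  rint a b f = rint a b g.
Proof. by move=> ab e lf; rewrite /rint; congr complex.Re; apply: cint_ext => // x xx; rewrite e. Qed.

Lemma rint_cst a b c : a <= b -> rint a b (fun=> c) = c * (b - a).
Proof.
move=> ab; rewrite /rint (cintE ab (uprim_cst a b c%:C)).
by rewrite -!rmorphM -rmorphB /= mulrBr.
Qed.

Lemma rint_ge0 a b f : a <= b -> rlip a b f -> (forall x, a <= x <= b -> 0 <= f x) ->
  0 <= rint a b f.
Proof.
move=> ab lf f0; have [F uF] := lip_prim ab lf.
have := cint_le ab lf uF; rewrite /rint (cintE ab uF) => /(_ _)/(le_trans (normc_ge0 _)); apply.
by move=> x xx; rewrite normcR ger0_norm// f0.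
Qed.

Lemma rint_affine a b c d f : 0 < c -> a <= b -> rlip (c * a + d) (c * b + d) f ->
  rint (c * a + d) (c * b + d) f = rint a b (fun t => c * f (c * t + d)).
Proof.
move=> c0 ab lf.
have ab' : c * a + d <= c * b + d by rewrite lerD2r ler_wpM2l// ltW.
have [F [K K0 hF]] := lip_prim ab' lf.
have u2 : uprim a b (fun t => (c * f (c * t + d))%:C) (fun t => F (c * t + d)).
  exists (K * c ^+ 2); first by rewrite mulr_ge0 ?exprn_ge0// ltW.
  move=> x y /andP[ax xb] /andP[ay yb].
  have I u : a <= u -> u <= b -> c * a + d <= c * u + d <= c * b + d.
    by move=> au ub; rewrite !lerD2r !ler_wpM2l// ltW.
  have := hF (c * x + d) (c * y + d) (I _ ax xb) (I _ ay yb).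
  have -> : c * y + d - (c * x + d) = c * (y - x) by ring.
  by rewrite exprMn mulrA [(c * (y - x))%:C]rmorphM mulrA -rmorphM [f _ * c]mulrC.
by rewrite /rint (cintE ab u2) (cintE ab' (F := F))//; exists K.
Qed.

Lemma rint_refl a b f : a <= b -> rlip a b f ->
  rint a b f = rint (- b) (- a) (fun x => f (- x)).
Proof.
move=> ab lf; have [F [K K0 hF]] := lip_prim ab lf.
have ab' : - b <= - a by rewrite lerN2.
have u2 : uprim (- b) (- a) (fun x => (f (- x))%:C) (fun x => - F (- x)).
  exists K => // x y /andP[bx xa] /andP[by' ya].
  have := hF (- x) (- y).
  have -> : (a <= - x <= b) by rewrite lerNr xa lerNl bx.
  have -> : (a <= - y <= b) by rewrite lerNr ya lerNl by'.
  move=> /(_ isT isT); have -> : - y - - x = - (y - x) by ring.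
  rewrite sqrrN => h; apply: le_trans h; rewrite -normcN rmorphN.
  by rewrite le_eqVlt; apply/orP; left; apply/eqP; congr normc; ring.
rewrite /rint (cintE ab' u2) (cintE ab (F := F)); last by exists K.
by rewrite !opprK addrC.
Qed.

Lemma rlip_refl a b f : rlip a b f -> rlip (- b) (- a) (fun x => f (- x)).
Proof.
move=> [L L0 h]; exists L => // x y /andP[bx xa] /andP[by' ya].
have -> : `|y - x| = `|- y - - x| by rewrite -normrN; congr `|_|; ring.
by apply: h; apply/andP; split; lra.
Qed.

(** A bound of the integral of |x|^e exp (gam x) from minus infinity to X, for e <= 1. *)
Definition tail_bound (e : nat) (gam X : R) : R := (`|X| + 2 / gam) ^+ e * (2 / gam) * expR (gam * X).

Lemma tail_bound_ge0 e (gam X : R) : 0 < gam -> 0 <= tail_bound e gam X.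
Proof.
move=> g0; have g2 : 0 <= 2 / gam by rewrite divr_ge0// ltW.
apply: mulr_ge0 (expR_ge0 _); apply: mulr_ge0 => //.
by apply: exprn_ge0; exact: addr_ge0.
Qed.

(** For e = 1, half of the exponential decay absorbs the growth of |x| beyond a. *)
Lemma high_tail a b f e (gam : R) : (e <= 1)%N -> 0 < gam -> a <= b -> rlip a b f ->
  (forall x, a <= x <= b -> `|f x| <= `|x| ^+ e * expR (- (gam * x))) ->
  `|rint a b f| <= tail_bound e gam (- a).
Proof.
move=> e1 g0 ab lf hf; apply: le_trans (Re_le_normc _) _.
have r0 : 0 < gam / 2 by rewrite divr_gt0.
apply: le_trans (@cint_exp_bound _ _ a b (gam / 2)
   ((`|a| + 2 / gam) ^+ e * expR (- (gam / 2 * a))) ab r0 lf _) _; last first.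
  rewrite /tail_bound normrN le_eqVlt; apply/orP; left; apply/eqP.
  have -> : expR (gam * - a) = expR (- (gam / 2 * a)) * expR (- (gam / 2 * a)).
    by rewrite -expRD; congr expR; lra.
  move: (expR _) (`|a|) => E A; field; exact: lt0r_neq0.
move=> x xx; rewrite normcR; apply: le_trans (hf x xx) _.
have -> : expR (- (gam * x)) = expR (- (gam / 2 * (x - a))) * (expR (- (gam / 2 * a)) * expR (- (gam / 2 * x))).
  by rewrite -!expRD; congr expR; lra.
rewrite -[leRHS]mulrA [leLHS]mulrA.
apply: ler_wpM2r; first by rewrite mulr_ge0 ?expR_ge0.
case/andP: xx => ax xb.
have d0 : 0 <= gam / 2 * (x - a) by rewrite mulr_ge0 ?subr_ge0// ltW.
have E1 : expR (- (gam / 2 * (x - a))) <= 1 by rewrite expR_le1 oppr_le0.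
case: e e1 {hf} => [|[|]]// _; first by rewrite !expr0 mul1r.
rewrite !expr1; apply: (@le_trans _ _ ((`|a| + (x - a)) * expR (- (gam / 2 * (x - a))))).
  rewrite ler_wpM2r ?expR_ge0// -{1}[x](subrK a) addrC (le_trans (ler_normD _ _))//.
  by rewrite lerD2l ger0_norm// subr_ge0.
rewrite mulrDl lerD ?ler_piMr//.
rewrite expRN ler_pdivrMr ?expR_gt0//.
have := expR_ge1Dx (gam / 2 * (x - a)).
have -> : 2 / gam * expR (gam / 2 * (x - a)) = (gam / 2)^-1 * expR (gam / 2 * (x - a)).
  by congr (_ * _); field; exact: lt0r_neq0.
rewrite ler_pdivlMl// => h; lra.
Qed.

Lemma low_tail a b f e (gam : R) : (e <= 1)%N -> 0 < gam -> a <= b -> rlip a b f ->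
  (forall x, a <= x <= b -> `|f x| <= `|x| ^+ e * expR (gam * x)) ->
  `|rint a b f| <= tail_bound e gam b.
Proof.
move=> e1 g0 ab lf hf; rewrite rint_refl// -[b in tail_bound _ _ b]opprK.
apply: (high_tail e1 g0); rewrite ?lerN2//; first exact: rlip_refl.
move=> x /andP[bx xa]; rewrite -[`|x|]normrN -mulrN; apply: hf.
by apply/andP; split; lra.
Qed.

Lemma tail_bound_small e (gam eta : R) : (e <= 1)%N -> 0 < gam -> 0 < eta ->
  exists2 X0, X0 <= 0 & forall X, X <= X0 -> tail_bound e gam X <= eta.
Proof.
move=> e1 g0 eta0.
pose K : R := 4 / gam * (2 / gam) * (2 / gam) + 2 / gam * gam^-1.
have g1 : 0 < gam^-1 by rewrite invr_gt0.
have K0 : 0 < K by rewrite /K addr_gt0 ?mulr_gt0.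
have k1 : 0 <= 2 / gam * gam^-1 by rewrite !mulr_ge0// ltW.
have k2 : 0 <= 4 / gam * (2 / gam) * (2 / gam) by rewrite !mulr_ge0// ltW.
exists (- (K / eta)); first by rewrite oppr_le0 divr_ge0 ?ltW.
move=> X XX; have u0 : 0 < - X.
  by rewrite oppr_gt0 (le_lt_trans XX)// oppr_lt0 divr_gt0.
have hK : K / - X <= eta by rewrite ler_pdivrMr// mulrC -ler_pdivrMr//; lra.
apply: le_trans hK; rewrite /tail_bound -normrN gtr0_norm//; set u := - X in u0 *.
have -> : gam * X = - (gam * u) by rewrite /u mulrN opprK.
have gu : 0 < gam * u by rewrite mulr_gt0.
have ev (v : R) : 0 < v -> expR (- v) <= v^-1.
  by move=> v0; rewrite expRN lef_pV2 ?posrE ?expR_gt0//; have := expR_ge1Dx v; lra.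
rewrite ler_pdivlMr//.
case: e e1 => [|[|]]// _.
  rewrite expr0 mul1r; have h := ev _ gu.
  apply: (@le_trans _ _ (2 / gam * (gam * u)^-1 * u)).
    by rewrite ler_wpM2r ?(ltW u0)// ler_wpM2l// mulr_ge0// ltW.
  have -> : 2 / gam * (gam * u)^-1 * u = 2 / gam * gam^-1 by field; rewrite !gt_eqF.
  by rewrite /K lerDr.
rewrite expr1.
have gu2 : 0 < gam / 2 * u by rewrite mulr_gt0// divr_gt0.
have h := ev _ gu2.
have -> : expR (- (gam * u)) = expR (- (gam / 2 * u)) * expR (- (gam / 2 * u)).
  by rewrite -expRD; congr expR; lra.
have h2 : (u + 2 / gam) * expR (- (gam / 2 * u)) <= 2 / gam.
  rewrite expRN ler_pdivrMr ?expR_gt0//.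
  have := expR_ge1Dx (gam / 2 * u) => h2.
  have -> : u + 2 / gam = 2 / gam * (1 + gam / 2 * u) by field; exact: lt0r_neq0.
  by rewrite ler_wpM2l// mulr_ge0// ltW.
have h3 : (u + 2 / gam) * (2 / gam) * (expR (- (gam / 2 * u)) * expR (- (gam / 2 * u))) * u <=
   2 / gam * (2 / gam) * (gam / 2 * u)^-1 * u.
  rewrite ler_wpM2r ?(ltW u0)//.
  have -> : (u + 2 / gam) * (2 / gam) * (expR (- (gam / 2 * u)) * expR (- (gam / 2 * u))) =
    (u + 2 / gam) * expR (- (gam / 2 * u)) * (2 / gam) * expR (- (gam / 2 * u)) by ring.
  have E0 := expR_ge0 (- (gam / 2 * u)).
  have g2 : 0 <= 2 / gam by rewrite mulr_ge0// ltW.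
  apply: ler_pM => //; last by rewrite ler_wpM2r.
  by apply: mulr_ge0 => //; apply: mulr_ge0 => //; exact: addr_ge0 (ltW u0) g2.
apply: le_trans h3 _.
have -> : 2 / gam * (2 / gam) * (gam / 2 * u)^-1 * u = 2 / gam * (2 / gam) * (2 / gam).
  by field; rewrite !gt_eqF.
rewrite /K -[leLHS]addr0 lerD// !ler_wpM2r//; lra.
Qed.

(** The intervals of radius t p around I p meet pairwise, hence all meet: take the supremum of
their lower ends. *)
Lemma nested (T : Type) (t0 : T) (I t : T -> R) : (forall p q, `|I p - I q| <= t p + t q) ->
  exists A, forall p, `|A - I p| <= t p.
Proof.
move=> h.
pose E := [set x | exists p, x = I p - t p]%classic.
have ub q : ubound E (I q + t q).
  by move=> _ [p ->]; have := h p q; rewrite ler_norml => /andP[]; lra.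
have hs : has_sup E by split; [exists (I t0 - t t0), t0|exists (I t0 + t t0); exact: ub].
exists (sup E) => p; rewrite ler_norml; apply/andP; split.
  have : I p - t p <= sup E by apply: ub_le_sup; [case: hs|exists p].
  lra.
have : sup E <= I p + t p by apply: ge_sup; [case: hs|exact: ub].
lra.
Qed.

(** Convergence at both ends, with explicit rates tl and th, after removing a linear divergence
om b at plus infinity. *)
Lemma nested_integral f om (tl th : R -> R) : (forall a b, rlip a b f) ->
  (forall a b, a <= b -> `|rint a b f| <= tl b) ->
  (forall a b, a <= b -> `|rint a b f - om * (b - a)| <= th a) ->
  exists A, forall a b, a <= b -> `|A - (rint a b f - om * b)| <= tl a + th b.
Proof.
move=> lf hl hh.
pose T := {p : R * R | p.1 <= p.2}.
pose I (p : T) := rint (sval p).1 (sval p).2 f - om * (sval p).2.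
pose t (p : T) := tl (sval p).1 + th (sval p).2.
have t0 : T by exists (0, 0) => /=.
have [|A hA] := @nested T t0 I t; last first.
  by exists A => a b ab; have := hA (exist _ (a, b) ab).
move=> [[a b] /= ab] [[a' b'] /= ab']; rewrite /I /t /=.
have key c d C D : c <= d -> C <= c -> d <= D ->
    `|rint C D f - om * D - (rint c d f - om * d)| <= tl c + th d.
  move=> cd Cc dD; rewrite (rint_split Cc (le_trans cd dD))// (rint_split cd dD)//.
  have -> : rint C c f + (rint c d f + rint d D f) - om * D - (rint c d f - om * d) =
    rint C c f + (rint d D f - om * (D - d)) by ring.
  by rewrite (le_trans (ler_normD _ _))// lerD ?hl ?hh.
have k1 := key a b (Num.min a a') (Num.max b b') ab.
have k2 := key a' b' (Num.min a a') (Num.max b b') ab'.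
move: k1 k2; rewrite !ge_min !le_max !lexx !orbT => /(_ isT isT) k1 /(_ isT isT) k2.
set X := rint (Num.min a a') _ f - _ in k1 k2.
have -> : rint a b f - om * b - (rint a' b' f - om * b') =
  (X - (rint a' b' f - om * b')) - (X - (rint a b f - om * b)) by ring.
by rewrite (le_trans (ler_normB _ _))// addrC lerD.
Qed.

End RealIntegral.

(** * The integral over the line *)
Section LineIntegral.
Context {R : realType}.
Implicit Types (a b c x z al be eta la lb rho : R) (e n m : nat) (Phi : R -> R).

Lemma cint_real a b (f : R -> R) : a <= b -> rlip a b f ->
  cint a b (fun x => (f x)%:C) = (rint a b f)%:C.
Proof.
move=> ab lf; have h := cint_cj ab lf.
have E : (fun x => cj (f x)%:C) = (fun x => (f x)%:C) by apply/funext => x; rewrite cjR.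
move: h; rewrite E /rint; case: (cint _ _ _) => u v /= [] hv.
by apply/eqP; rewrite eq_complex /= eqxx /=; apply/eqP; lra.
Qed.

(** The integrand q in the variable x = log y.  For z = 1, e = 0 and 0 < al < 1 its
integral over the line is the Mellin transform pi / sin (pi al) of 1 / (1 + y). *)
Definition mellin al e z x : R := expR (al * x) * x ^+ e * (z / (z + expR x)).

Lemma rlip_mellin al e z a b : 0 < z -> rlip a b (mellin al e z).
Proof.
move=> z0; apply: rlipM; last first.
  apply: rlipM; first exact: rlip_cst.
  apply: (rlipV z0) => [x _|]; first by rewrite lerDl expR_ge0.
  apply: rlipD; first exact: rlip_cst.
  by have := @lip_expR R a b 1; rewrite /rlip; under eq_fun do rewrite mul1r.
by apply: rlipM; [exact: lip_expR|apply: rlipX; exact: rlip_id].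
Qed.

Lemma frac_bound z x : 0 < z -> [/\ 0 <= z / (z + expR x), z / (z + expR x) <= 1 &
  z / (z + expR x) <= z * expR (- x)].
Proof.
move=> z0; have e0 := expR_gt0 x; have d0 : 0 < z + expR x by rewrite addr_gt0.
split; first by rewrite divr_ge0// ltW.
  by rewrite ler_pdivrMr// mul1r lerDl ltW.
by rewrite ler_wpM2l ?(ltW z0)// expRN lef_pV2 ?posrE// lerDr ltW.
Qed.

Lemma mellin_low al e z x : 0 < z -> `|mellin al e z x| <= `|x| ^+ e * expR (al * x).
Proof.
move=> z0; have [h0 h1 _] := frac_bound x z0.
rewrite /mellin normrM (ger0_norm h0) normrM normrX (ger0_norm (expR_ge0 _)).
by rewrite [leRHS]mulrC ler_piMr// mulr_ge0 ?expR_ge0 ?exprn_ge0.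
Qed.

Lemma mellin_high al e z x : 0 < z -> z <= 1 ->
  `|mellin al e z x| <= `|x| ^+ e * expR (- ((1 - al) * x)).
Proof.
move=> z0 z1; have [h0 _ h1] := frac_bound x z0.
rewrite /mellin normrM (ger0_norm h0) normrM normrX (ger0_norm (expR_ge0 _)).
have -> : expR (- ((1 - al) * x)) = expR (al * x) * expR (- x).
  by rewrite -expRD; congr expR; ring.
rewrite [leRHS]mulrCA mulrA ler_wpM2l ?mulr_ge0 ?expR_ge0 ?exprn_ge0//.
by apply: le_trans h1 _; rewrite ler_piMl ?expR_ge0.
Qed.

Lemma Jq_mellin sigma alpha lc N1 e M z : 0 < sigma -> 0 < z ->
  Jq sigma alpha lc N1 e M z =
  rint (lc + sigma * (sq 0 - Num.sqrt N1%:R)) (lc + sigma * (sq M - Num.sqrt N1%:R))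
    (mellin alpha e z).
Proof.
move=> s0 z0; set S := Num.sqrt N1%:R; have ab : @sq R 0 <= sq M by exact: sq_le.
have E x : lc + sigma * (x - S) = sigma * x + (lc - sigma * S) by ring.
rewrite !E rint_affine//; last exact: rlip_mellin.
rewrite /Jq /rint; congr complex.Re; apply: cint_ext => //; last exact: lip_q_axis.
move=> t _; rewrite q_real /qreal -E -/S; congr (_%:C).
have -> : expR (sigma * (t - s0_of sigma lc S z)) = expR (lc + sigma * (t - S)) / z.
  rewrite -[z in RHS]lnK ?posrE// -expRN -expRD; congr expR.
  by rewrite /s0_of; field; rewrite gt_eqF.
rewrite /mellin; move: (expR_gt0 (lc + sigma * (t - S))); set Y := expR (lc + _) => Y0.
field; rewrite !gt_eqF ?addr_gt0// divr_gt0//.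
Qed.

(** This is y z / (z + y) = z - z * z / (z + y): it lowers the exponent by 1 at the price of a
multiple of z. *)
Lemma mellin_rec al e z x : 0 < z ->
  mellin (1 + al) e z x = z * (expR (al * x) * x ^+ e) - z * mellin al e z x.
Proof.
move=> z0; rewrite /mellin mulrDl mul1r expRD.
have := expR_gt0 x; set Y := expR x => Y0; set X := expR _; set p := x ^+ e; field.
by rewrite gt_eqF// addr_gt0.
Qed.

Lemma polyz_rec n (F Phi : R -> R) E c : polyz n (fun z => F z - Phi z) E ->
  polyz n.+1 (fun z => (z * c - z * F z) - - z * Phi z) E.
Proof.
move=> [Q sQ hQ]; exists (c%:P - 'X * Q).
  rewrite (leq_trans (size_polyD _ _))// geq_max size_polyN.
  rewrite (leq_trans (size_polyC_leq1 _))//= (leq_trans (size_polyMleq _ _))//.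
  by rewrite size_polyX.
move=> z z0 z1; rewrite hornerD hornerN hornerC hornerM hornerX.
have -> : z * c - z * F z - - z * Phi z - z * (c - z * Q.[z]) =
  - (z * (F z - Phi z - z * Q.[z])) by ring.
rewrite normrN normrM -[leRHS]mul1r ler_pM//; first by rewrite ger0_norm// ltW.
exact: hQ.
Qed.

Lemma mellin_polyz_rec m al e a b Phi n E : a <= b ->
  polyz n (fun z => rint a b (mellin al e z) - Phi z) E ->
  polyz (n + m) (fun z => rint a b (mellin (m%:R + al) e z) - (- z) ^+ m * Phi z) E.
Proof.
move=> ab h; elim: m => [|m IH].
  by rewrite addn0; apply: polyz_ext h => z _ _; rewrite add0r expr0 mul1r.
pose c := rint a b (fun x => expR ((m%:R + al) * x) * x ^+ e).
rewrite addnS; apply: polyz_ext (polyz_rec c IH) => z z0 z1.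
have lp : rlip a b (fun x => expR ((m%:R + al) * x) * x ^+ e).
  by apply: rlipM; [exact: lip_expR|apply: rlipX; exact: rlip_id].
rewrite exprS -mulrA; congr (_ - _).
rewrite /c -rintZ// -[- (z * _)]mulNr -rintZ//; last exact: rlip_mellin.
rewrite -rintD//; last 2 first.
- by apply: rlipM => //; exact: rlip_cst.
- by apply: rlipM; [exact: rlip_cst|exact: rlip_mellin].
symmetry; apply: rint_ext => //; last exact: rlip_mellin.
by move=> x _; rewrite -natr1 (addrC m%:R) -addrA mellin_rec// mulNr.
Qed.

(** One of the n + 1 factors of the remainder is used to gain exp (- t), which makes the bound
integrable for every be <= 1. *)
Lemma high_polyz be e lb b n rho : (e <= 1)%N -> be <= 1 -> 1 <= lb -> lb <= b -> 1 / 3 <= rho ->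
  polyz n.+1 (fun z => rint lb b (mellin be e z)) (rho ^+ n * tail_bound e 1 (- lb)).
Proof.
move=> e1 be1 lb1 lbb r3.
have Y1 t : lb <= t <= b -> 2 <= expR t.
  move=> /andP[lt _]; apply: le_trans (expR_ge1Dx t); lra.
have lh : rlip lb b (fun t => expR (be * t) * t ^+ e).
  by apply: rlipM; [exact: lip_expR|apply: rlipX; exact: rlip_id].
have lY : rlip lb b expR.
  by have := @lip_expR R lb b 1; under eq_fun do rewrite mul1r.
apply: polyz_ext (@int_polyz R lb b _ _ 1 n.+1 _ lbb ltr01 lh lY _ _).
- move=> z z0 z1; rewrite /rint; congr (complex.Re (cint _ _ _)).
  have E t : (z / (z + expR t))%:C = z%:C / ((expR t)%:C + z%:C).
    by rewrite rmorphM fmorphV rmorphD [z%:C + _]addrC.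
  by apply/funext => t; rewrite -E -rmorphM.
- by move=> t z tt z0 z1; rewrite -rmorphD normcR ger0_norm; have := Y1 t tt; lra.
move=> z z0 z1.
pose g t := expR (be * t) * t ^+ e * (((1 / 2 - z) / (expR t + 1 / 2)) ^+ n.+1 / (expR t + z)).
have lg : rlip lb b g.
  have lV c : 0 < c -> rlip lb b (fun t => (expR t + c)^-1).
    move=> c0; apply: (rlipV c0) => [t _|]; first by rewrite lerDr expR_ge0.
    by apply: rlipD => //; exact: rlip_cst.
  apply: rlipM => //; apply: rlipM; last exact: lV.
  by apply: rlipX; apply: rlipM; [exact: rlip_cst|apply: lV; lra].
have -> : (fun t : R => (expR (be * t) * t ^+ e)%:C *
     (((1 / 2 - z)%:C / ((expR t)%:C + (1 / 2)%:C)) ^+ n.+1 / ((expR t)%:C + z%:C))) =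
  (fun t => (g t)%:C).
  by apply/funext => t; rewrite /g; rewrite !(rmorphM, rmorphXn, fmorphV, rmorphD).
rewrite cint_real// normcR.
have r0 : 0 <= rho by lra.
have rn : 0 < rho ^+ n by rewrite exprn_gt0//; lra.
have -> : rint lb b g = rho ^+ n * rint lb b (fun t => rho ^- n * g t).
  by rewrite rintZ// mulVKf// gt_eqF.
rewrite normrM (gtr0_norm rn) ler_wpM2l ?(ltW rn)//.
apply: (high_tail e1 ltr01 lbb).
  by apply: rlipM => //; exact: rlip_cst.
move=> t tt; have y2 := Y1 t tt; have t0 : 0 <= t by case/andP: tt => ? _; lra.
rewrite normrM ger0_norm ?invr_ge0 ?(ltW rn)// ler_pdivrMl// /g !normrM normrX.
rewrite (ger0_norm (expR_ge0 _)) normrX normfV.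
have u2 : `|1 / 2 - z| <= 1 / 2 by rewrite ler_norml; apply/andP; split; lra.
have d0 : 0 < expR t + 1 / 2 by lra.
have d1 : 0 < expR t + z by lra.
set w := `|(1 / 2 - z) / _|.
have w0 : 0 <= w by exact: normr_ge0.
have wE : w <= (1 / 2) / (expR t + 1 / 2).
  by rewrite /w normrM normfV (gtr0_norm d0) ler_wpM2r// invr_ge0 ltW.
have w1 : w <= rho.
  apply: le_trans wE (le_trans _ r3); rewrite ler_pdivrMr//; lra.
have w2 : w <= expR (- t).
  apply: le_trans wE _; rewrite ler_pdivrMr// mulrDr -expRD addNr expR0.
  by have := expR_ge0 (- t); lra.
rewrite exprSr (gtr0_norm d1).
have h1 : (expR t + z)^-1 <= expR (- t).
  by rewrite expRN lef_pV2 ?posrE ?expR_gt0//; lra.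
have hb : expR (be * t) * (w * (expR t + z)^-1) <= expR (- (1 * t)).
  have -> : expR (- (1 * t)) = expR t * (expR (- t) * expR (- t)).
    by rewrite -!expRD; congr expR; ring.
  apply: ler_pM; rewrite ?expR_ge0//.
  - by rewrite mulr_ge0// invr_ge0 ltW.
  - by rewrite ler_expR -[leRHS]mul1r ler_wpM2r.
  - by apply: ler_pM; rewrite ?invr_ge0 ?(ltW d1).
have -> : expR (be * t) * `|t| ^+ e * (w ^+ n * w / (expR t + z)) =
  w ^+ n * (`|t| ^+ e * (expR (be * t) * (w * (expR t + z)^-1))) by ring.
apply: ler_pM; rewrite ?exprn_ge0// ?mulr_ge0 ?expR_ge0 ?exprn_ge0 ?invr_ge0 ?(ltW d1)//.
  by rewrite lerXn2r ?nnegrE.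
by rewrite ler_wpM2l ?exprn_ge0.
Qed.

(** The integral over the whole line is Phi, up to the multiples of z which a divergence at plus
infinity produces.  The end points can be taken as far as needed. *)
Definition full_line be e Phi := forall eta la lb, 0 < eta -> exists a b c,
  [/\ a <= la, lb <= b & forall z, 0 < z -> z <= 1 ->
    `|rint a b (mellin be e z) - Phi z - c * z| <= eta].

(** Extend the interval to minus infinity, at the cost of a tail of exponent m + be; lower the
exponent to be by [mellin_polyz_rec]; then extend it to plus infinity, at the cost of the analytic
part of [high_polyz].  The order matters: extending downwards after lowering the exponent would
give the worse error exp (be la). *)
Lemma J_polyz m be e Phi la lb n rho : full_line be e Phi -> (e <= 1)%N -> 0 < be -> be <= 1 ->
  la <= lb -> 1 <= lb -> 1 / 3 <= rho ->
  polyz (n.+1 + m) (fun z => rint la lb (mellin (m%:R + be) e z) - (- z) ^+ m * Phi z)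
    (rho ^+ n * (1 + tail_bound e 1 (- lb)) + tail_bound e (m%:R + be) la).
Proof.
move=> hc e1 be0 be1 lab lb1 r3.
have rn : 0 < rho ^+ n by rewrite exprn_gt0//; lra.
have [a [b [c [ala lbb hcz]]]] := hc _ la lb rn.
have alb := le_trans ala lab.
have hP : polyz n.+1 (fun z => rint a b (mellin be e z) - Phi z) (rho ^+ n).
  exists c%:P; first by rewrite (leq_trans (size_polyC_leq1 _)).
  by move=> z z0 z1; rewrite hornerC mulrC; exact: hcz.
have hH := polyzZ (-1) (high_polyz n e1 be1 lb1 lbb r3).
rewrite normrN1 mul1r in hH.
have h1 : polyz n.+1 (fun z => rint a lb (mellin be e z) - Phi z) (rho ^+ n * (1 + tail_bound e 1 (- lb))).
  rewrite mulrDr mulr1; apply: polyz_ext (polyzD hP hH) => z z0 z1.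
  by rewrite (rint_split alb lbb) ?mulN1r; [ring|exact: rlip_mellin].
apply: polyz_err (mellin_polyz_rec m alb h1) => z z0 z1.
rewrite (rint_split ala lab); last exact: rlip_mellin.
set X := rint a la _; set Y := rint la lb _; set Z := _ * Phi z.
have -> : Y - Z - (X + Y - Z) = - X by ring.
rewrite normrN; apply: low_tail => //; [by rewrite ltr_wpDl// ler0n|exact: rlip_mellin|].
by move=> x _; exact: mellin_low.
Qed.

(** The translation x = t + log z is the scaling y = z exp t. *)
Lemma rint_shift a b z be e : 0 < z -> a <= b ->
  rint a b (mellin be e z) =
  rint (a - ln z) (b - ln z) (fun t => expR (be * ln z) * ((t + ln z) ^+ e * mellin be 0 1 t)).
Proof.
move=> z0 ab; have ab' : a - ln z <= b - ln z by rewrite lerD2r.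
have Ea x : x = 1 * (x - ln z) + ln z by ring.
rewrite {1}(Ea a) {1}(Ea b) rint_affine//; last exact: rlip_mellin.
apply: rint_ext => //.
  move=> t _; rewrite !mul1r /mellin expr0 mulr1.
  have -> : expR (be * (t + ln z)) = expR (be * ln z) * expR (be * t).
    by rewrite -expRD; congr expR; ring.
  rewrite expRD lnK ?posrE//; have := expR_gt0 t; set Y := expR t => Y0.
  by field; rewrite !gt_eqF ?addr_gt0 ?mulr_gt0.
apply: rlipM; first exact: rlip_cst.
have : rlip (1 * (a - ln z) + ln z) (1 * (b - ln z) + ln z) (mellin be e z) by exact: rlip_mellin.
move=> [L L0 h]; exists L => // x y /andP[ax xb] /andP[ay yb].
have -> : y - x = 1 * y + ln z - (1 * x + ln z) by ring.
by apply: h; rewrite !mul1r !lerD2r ?ax ?xb ?ay ?yb.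
Qed.

(** The integral of exp t / (1 + exp t) up to b is asymptotic to b plus a constant, and b stands for
b - log z after the translation. *)
Lemma full_line_one : full_line 1 0 (fun z => - (z * ln z)).
Proof.
have lf a b : rlip a b (mellin 1 0 1 : R -> R) by exact: rlip_mellin.
have [A hA] : exists A, forall a b : R, a <= b ->
    `|A - (rint a b (mellin 1 0 1) - 1 * b)| <= tail_bound 0 1 a + tail_bound 0 1 (- b).
  apply: (@nested_integral _ _ 1 (tail_bound 0 1) (fun a => tail_bound 0 1 (- a))) => // a b ab.
    by apply: low_tail => // x _; exact: mellin_low.
  have -> : rint a b (mellin 1 0 1) - 1 * (b - a) = rint a b (fun x => mellin 1 0 1 x + (- 1)).
    by rewrite rintD// ?rint_cst//; [ring|exact: rlip_cst].
  apply: high_tail => //; first by apply: rlipD => //; exact: rlip_cst.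
  move=> x _; rewrite expr0 mul1r /mellin expr0 mulr1 !mul1r expRN.
  have e0 := expR_gt0 x; have d0 : 0 < 1 + expR x by rewrite addr_gt0.
  have -> : expR x * (1 + expR x)^-1 - 1 = - (1 + expR x)^-1 by field; rewrite gt_eqF.
  by rewrite normrN normfV gtr0_norm// lef_pV2 ?posrE// lerDr.
move=> eta la lb eta0; have e2 : 0 < eta / 2 by rewrite divr_gt0.
have [X0 X00 hX] := @tail_bound_small R 0 1 _ isT ltr01 e2.
pose a := Num.min la X0; pose b := Num.max lb (- X0).
have ab : a <= b by rewrite (@le_trans _ _ X0) ?ge_min ?lexx ?orbT// le_max; apply/orP; right; lra.
have aX : a <= X0 by rewrite /a ge_min lexx orbT.
have bX : - b <= X0 by rewrite lerNl /b le_max lexx orbT.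
exists a, b, (A + b); split; [by rewrite ge_min lexx|by rewrite le_max lexx|].
move=> z z0 z1; have l0 : ln z <= 0 by rewrite ln_le0.
have ab' : a - ln z <= b - ln z by rewrite lerD2r.
rewrite rint_shift// mul1r lnK ?posrE//.
rewrite (_ : (fun t => z * _) = (fun t => z * mellin 1 0 1 t)); last first.
  by apply/funext => t; rewrite expr0 mul1r.
rewrite rintZ//; have h := hA _ _ ab'; set X := rint _ _ _ in h *.
have -> : z * X - - (z * ln z) - (A + b) * z = - (z * (A - (X - 1 * (b - ln z)))) by ring.
rewrite normrN normrM (gtr0_norm z0).
apply: le_trans (ler_wpM2l (ltW z0) h) _; rewrite mulrDr.
have -> : eta = eta / 2 + eta / 2 by lra.
rewrite /tail_bound !expr0 !mul1r; apply: lerD.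
  rewrite expRD expRN lnK ?posrE// mulrCA [z * _]mulrCA mulfV ?gt_eqF// mulr1.
  by have := hX _ aX; rewrite /tail_bound expr0 !mul1r.
apply: le_trans (hX _ bX); rewrite /tail_bound expr0 !mul1r.
rewrite -[leRHS]mul1r ler_pM// ?(ltW z0)// ?mulr_ge0 ?expR_ge0 ?invr_ge0// ler_wpM2l ?invr_ge0 ?mulr_ge0//.
by rewrite ler_expR; lra.
Qed.

Section Fractional.
Variable be : R.
Hypothesis be0 : 0 < be.
Hypothesis be1 : be < 1.
Let be1' : 0 < 1 - be. Proof. by rewrite subr_gt0. Qed.

Lemma line_integral e : (e <= 1)%N -> exists A, forall a b : R, a <= b ->
  `|A - rint a b (mellin be e 1)| <= tail_bound e be a + tail_bound e (1 - be) (- b).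
Proof.
move=> e1; have lf a b : rlip a b (mellin be e 1) by exact: rlip_mellin.
have [|a b ab|A hA] := @nested_integral R (mellin be e 1) 0 (tail_bound e be) (fun a => tail_bound e (1 - be) (- a)) lf.
- by move=> a b ab; apply: low_tail => // x _; exact: mellin_low.
- by rewrite mul0r subr0; apply: high_tail => // x _; exact: mellin_high.
by exists A => a b ab; have := hA a b ab; rewrite mul0r subr0.
Qed.

(** For fixed z it is enough to have convergence, without any uniformity in z: the tails of
the integrals are bounded independently of z. *)
Lemma full_line_limit e Phi : (e <= 1)%N ->
  (forall z eta a0 b0, 0 < z -> z <= 1 -> 0 < eta -> exists a b, [/\ a <= a0, b0 <= b, a <= b &
     `|rint a b (mellin be e z) - Phi z| <= eta]) -> full_line be e Phi.
Proof.
move=> e1 h eta la lb eta0; have e3 : 0 < eta / 3 by rewrite divr_gt0.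
have [X0 X00 hX] := @tail_bound_small R e _ _ e1 be0 e3.
have [Y0 Y00 hY] := @tail_bound_small R e _ _ e1 be1' e3.
pose a := Num.min la X0; pose b := Num.max lb (- Y0).
have aX : a <= X0 by rewrite /a ge_min lexx orbT.
have bX : - b <= Y0 by rewrite lerNl /b le_max lexx orbT.
have ab : a <= b by lra.
exists a, b, 0; split; [by rewrite ge_min lexx|by rewrite le_max lexx|].
move=> z z0 z1; rewrite mul0r subr0.
have [a' [b' [aa bb ab' hP]]] := h z _ a b z0 z1 e3.
have lf c d : rlip c d (mellin be e z) by exact: rlip_mellin.
move: hP; rewrite (rint_split aa (le_trans ab bb))// (rint_split ab bb)//.
have h1 : `|rint a' a (mellin be e z)| <= eta / 3.
  apply: le_trans (hX _ aX); apply: low_tail => // x _; exact: mellin_low.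
have h2 : `|rint b b' (mellin be e z)| <= eta / 3.
  apply: le_trans (hY _ bX); apply: high_tail => // x _; exact: mellin_high.
move: h1 h2; set x1 := rint a' a _; set x2 := rint b b' _; set x3 := rint a b _.
by rewrite !ler_norml => /andP[? ?] /andP[? ?] /andP[? ?]; apply/andP; split; lra.
Qed.

Lemma line_integral_gt0 A : (forall a b : R, a <= b ->
  `|A - rint a b (mellin be 0 1)| <= tail_bound 0 be a + tail_bound 0 (1 - be) (- b)) -> 0 < A.
Proof.
move=> hA; have lf c d : rlip c d (mellin be 0 1) by exact: rlip_mellin.
have jp x : 0 <= mellin be 0 1 x.
  by rewrite /mellin expr0 mulr1 mul1r mulr_ge0 ?expR_ge0// invr_ge0 addr_ge0 ?expR_ge0.
pose k : R := (1 + expR 1)^-1.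
have k0 : 0 < k by rewrite invr_gt0 addr_gt0 ?expR_gt0.
have r01 : k <= rint 0 1 (mellin be 0 1).
  rewrite -subr_ge0; have -> : rint 0 1 (mellin be 0 1) - k = rint 0 1 (fun x => mellin be 0 1 x + - k).
    by rewrite rintD// ?rint_cst//; [ring|exact: rlip_cst].
  apply: rint_ge0 => //; first by apply: rlipD => //; exact: rlip_cst.
  move=> x /andP[x0 x1]; rewrite subr_ge0 /mellin expr0 mulr1 mul1r -[k]mul1r ler_pM ?(ltW k0)//.
    by rewrite -expR0 ler_expR mulr_ge0// ltW.
  by rewrite lef_pV2 ?posrE ?addr_gt0 ?expR_gt0// lerD2l ler_expR.
have k4 : 0 < k / 4 by rewrite divr_gt0.
have [X0 X00 hX] := @tail_bound_small R 0 _ _ isT be0 k4.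
have [Y0 Y00 hY] := @tail_bound_small R 0 _ _ isT be1' k4.
have bX : - (1 - Y0) <= Y0 by lra.
have ab : X0 <= 1 - Y0 by lra.
have := hA _ _ ab; have := hX _ (lexx _); have := hY _ bX.
have h1 : 1 <= 1 - Y0 by lra.
have h01 : (0 : R) <= 1 by [].
rewrite (rint_split X00 (le_trans h01 h1))// (rint_split h01 h1)//.
have p1 : 0 <= rint X0 0 (mellin be 0 1) by apply: rint_ge0.
have p2 : 0 <= rint 1 (1 - Y0) (mellin be 0 1) by apply: rint_ge0.
by rewrite ler_norml => ? ? /andP[? ?]; lra.
Qed.

(** A0 and A1 are the integrals over the line of the kernel with z = 1 and e = 0, 1. *)
Lemma full_line_frac : exists A0 A1, [/\ 0 < A0, full_line be 0 (fun z => A0 * expR (be * ln z)) &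
  full_line be 1 (fun z => (A1 + A0 * ln z) * expR (be * ln z))].
Proof.
have [A0 h0] := @line_integral 0 isT; have [A1 h1] := @line_integral 1 isT.
have lf e c d : rlip c d (mellin be e 1) by exact: rlip_mellin.
exists A0, A1; split; first exact: (line_integral_gt0 h0).
  apply: full_line_limit => // z eta a0 b0 z0 z1 eta0.
  pose P := expR (be * ln z); have P0 : 0 < P by exact: expR_gt0.
  have e1 : 0 < eta / 2 / P by rewrite !divr_gt0.
  have [X0 X00 hX] := @tail_bound_small R 0 _ _ isT be0 e1.
  have [Y0 Y00 hY] := @tail_bound_small R 0 _ _ isT be1' e1.
  pose a := Num.min a0 (X0 + ln z); pose b := Num.max b0 (- Y0 + ln z).
  have aX : a - ln z <= X0 by rewrite lerBlDr /a ge_min lexx orbT.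
  have bX : - (b - ln z) <= Y0 by rewrite lerNl lerBrDr /b le_max lexx orbT.
  have ab' : a - ln z <= b - ln z by lra.
  have ab : a <= b by move: ab'; rewrite lerD2r.
  exists a, b; split => //; [by rewrite ge_min lexx|by rewrite le_max lexx|].
  rewrite rint_shift// (_ : (fun t => _) = (fun t => P * mellin be 0 1 t)); last first.
    by apply/funext => t; rewrite expr0 mul1r.
  rewrite rintZ// mulrC -/P -mulrBl normrM (gtr0_norm P0) -ler_pdivlMr// distrC.
  apply: le_trans (h0 _ _ ab') _.
  have -> : eta / P = eta / 2 / P + eta / 2 / P by field; rewrite gt_eqF.
  by rewrite lerD ?hX ?hY.
apply: full_line_limit => // z eta a0 b0 z0 z1 eta0.
pose P := expR (be * ln z); have P0 : 0 < P by exact: expR_gt0.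
pose L := 1 + `|ln z|; have L0 : 0 < L by rewrite ltr_pwDl.
have e1 : 0 < eta / 4 / P / L by rewrite !divr_gt0.
have [X0 X00 hX] := @tail_bound_small R 0 _ _ isT be0 e1.
have [Y0 Y00 hY] := @tail_bound_small R 0 _ _ isT be1' e1.
have [X1 X10 hX1] := @tail_bound_small R 1 _ _ isT be0 e1.
have [Y1 Y10 hY1] := @tail_bound_small R 1 _ _ isT be1' e1.
pose a := Num.min a0 (Num.min X0 X1 + ln z).
pose b := Num.max b0 (- Num.min Y0 Y1 + ln z).
have aX' : a - ln z <= Num.min X0 X1 by rewrite lerBlDr /a ge_min lexx orbT.
have bX' : - (b - ln z) <= Num.min Y0 Y1 by rewrite lerNl lerBrDr /b le_max lexx orbT.
have [aX aX1] : a - ln z <= X0 /\ a - ln z <= X1.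
  by move: aX'; rewrite le_min => /andP.
have [bX bX1] : - (b - ln z) <= Y0 /\ - (b - ln z) <= Y1.
  by move: bX'; rewrite le_min => /andP.
have ab' : a - ln z <= b - ln z by lra.
have ab : a <= b by move: ab'; rewrite lerD2r.
exists a, b; split => //; [by rewrite ge_min lexx|by rewrite le_max lexx|].
rewrite rint_shift//.
rewrite (_ : (fun t => _) = (fun t => P * (mellin be 1 1 t + ln z * mellin be 0 1 t))); last first.
  by apply/funext => t; rewrite /mellin expr1 expr0 /P; ring.
have lZ : rlip (a - ln z) (b - ln z) (fun t => ln z * mellin be 0 1 t).
  by apply: rlipM => //; exact: rlip_cst.
rewrite rintZ//; last exact: rlipD.
rewrite rintD// rintZ// [_ * P]mulrC -mulrBr normrM (gtr0_norm P0) mulrC -ler_pdivlMr//.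
set I1 := rint _ _ (mellin be 1 1); set I0 := rint _ _ (mellin be 0 1).
have -> : I1 + ln z * I0 - (A1 + A0 * ln z) = - (A1 - I1) - ln z * (A0 - I0) by ring.
have e2 : tail_bound 1 be (a - ln z) + tail_bound 1 (1 - be) (- (b - ln z)) <= eta / 2 / P / L.
  have -> : eta / 2 / P / L = eta / 4 / P / L + eta / 4 / P / L by field; rewrite !gt_eqF.
  by rewrite lerD ?hX1 ?hY1.
have e3 : tail_bound 0 be (a - ln z) + tail_bound 0 (1 - be) (- (b - ln z)) <= eta / 2 / P / L.
  have -> : eta / 2 / P / L = eta / 4 / P / L + eta / 4 / P / L by field; rewrite !gt_eqF.
  by rewrite lerD ?hX ?hY.
have q1 := le_trans (h1 _ _ ab') e2; have q0 := le_trans (h0 _ _ ab') e3.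
apply: le_trans (ler_normB _ _) _; rewrite normrN normrM.
have q2 := ler_wpM2l (normr_ge0 (ln z)) q0.
apply: le_trans (lerD q1 q2) _.
have -> : eta / 2 / P / L + `|ln z| * (eta / 2 / P / L) = eta / 2 / P.
  by rewrite /L; field; rewrite !gt_eqF// ltr_pwDl.
by rewrite ler_wpM2r ?invr_ge0 ?(ltW P0)//; lra.
Qed.

End Fractional.

End LineIntegral.

(** * The size of the errors *)
Section Constants.
Context {R : realType}.
Variables (sigma alpha lc : R).
Hypothesis sigma_gt0 : 0 < sigma.
Hypothesis alpha_gt0 : 0 < alpha.
Implicit Types (S t L z : R) (e : nat).

Let nu : R := 4 * pi ^+ 2 / sigma.
Let a : R := sigma * alpha.

(** The error of the quadrature and of the truncation on the left in terms of S = sqrt N1, up to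
a constant. *)
Definition rate e S : R :=
  if sigma * alpha <= 4 * pi ^+ 2 / sigma then (1 + S) ^+ e * expR (- (sigma * alpha * S))
  else expR (- (4 * pi ^+ 2 / sigma * S)).

Lemma linexp_le (k S : R) : 0 < k -> 0 <= S -> S * expR (- (k * S)) <= k^-1.
Proof.
move=> k0 S0; rewrite expRN ler_pdivrMr ?expR_gt0// ler_pdivlMl//.
by have := expR_ge1Dx (k * S); lra.
Qed.

(** Above the critical sigma the exponent sigma alpha exceeds 4 pi^2 / sigma, and the excess
absorbs the factor 1 + S. *)
Lemma rate_slack e : (e <= 1)%N -> exists2 K : R, 0 <= K & forall S, 0 <= S ->
  (1 + S) ^+ e * expR (- (sigma * alpha * S)) <= K * rate e S.
Proof.
move=> e1; rewrite /rate.
case: (boolP (sigma * alpha <= 4 * pi ^+ 2 / sigma)) => [_|].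
  by exists 1 => // S S0; rewrite mul1r.
rewrite -ltNge => h; have k0 : 0 < a - nu by rewrite subr_gt0.
exists (1 + (a - nu)^-1); first by rewrite addr_ge0// invr_ge0 ltW.
move=> S S0; have -> : expR (- (sigma * alpha * S)) = expR (- ((a - nu) * S)) * expR (- (nu * S)).
  by rewrite -expRD; congr expR; rewrite /a; ring.
rewrite mulrA ler_wpM2r ?expR_ge0//.
have E1 : expR (- ((a - nu) * S)) <= 1 by rewrite expR_le1 oppr_le0 mulr_ge0// ltW.
have h2 := linexp_le k0 S0; have ki : 0 <= (a - nu)^-1 by rewrite invr_ge0 ltW.
by case: e e1 => [|[|]]// _; rewrite ?expr0 ?expr1 ?mul1r; lra.
Qed.

(** The exponent is affine in t, with slope sigma alpha - 4 pi^2 / sigma; for a positive slope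
it is measured from t = S, and its decay for t < S absorbs the logarithm. *)
Lemma Lam_rate e L : (e <= 1)%N -> 1 <= L -> exists2 K : R, 0 <= K & forall S t,
  0 <= S -> 0 <= t -> t <= S + L ->
  expR (alpha * (lc + sigma * (t - S)) - 4 * pi ^+ 2 / sigma * t) * logb lc sigma S t ^+ e <=
  K * rate e S.
Proof.
move=> e1 L1; have p := @pi_gt0 R.
pose c1 : R := `|lc| + 2 * pi; have c10 : 0 <= c1 by rewrite addr_ge0// mulr_ge0// ltW.
have sL : 0 <= sigma * L by rewrite mulr_ge0 ?(ltW sigma_gt0)//; lra.
have Ealc : 0 <= expR (alpha * lc) by exact: expR_ge0.
rewrite /rate; case: (boolP (sigma * alpha <= 4 * pi ^+ 2 / sigma)) => h.
  exists (expR (alpha * lc) * (c1 + sigma * L) ^+ e); first by rewrite mulr_ge0 ?exprn_ge0// addr_ge0.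
  move=> S t S0 t0 tS.
  have lb0 : 0 <= logb lc sigma S t.
    by rewrite /logb !addr_ge0 ?mulr_ge0 ?(ltW sigma_gt0) ?(ltW p).
  rewrite [X in _ <= _ * X]mulrC [leRHS]mulrACA -expRD -exprMn.
  apply: ler_pM; rewrite ?exprn_ge0 ?expR_ge0//.
    rewrite ler_expR -subr_ge0.
    have -> : alpha * lc - sigma * alpha * S - (alpha * (lc + sigma * (t - S)) - 4 * pi ^+ 2 / sigma * t) =
      (4 * pi ^+ 2 / sigma - sigma * alpha) * t by ring.
    by rewrite mulr_ge0// subr_ge0.
  rewrite lerXn2r ?nnegrE//; first by rewrite mulr_ge0// addr_ge0//; lra.
  rewrite /logb; have tSL : `|t - S| <= S + L by rewrite ler_norml; apply/andP; split; lra.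
  have h1 := ler_wpM2l (ltW sigma_gt0) tSL.
  have h2 : sigma * S <= sigma * L * S.
    by rewrite -mulrA ler_wpM2l ?(ltW sigma_gt0)// ler_peMl.
  have h3 := mulr_ge0 c10 S0.
  have -> : `|lc| + sigma * `|t - S| + 2 * pi = c1 + sigma * `|t - S| by rewrite /c1; ring.
  have -> : (c1 + sigma * L) * (1 + S) = c1 + (c1 * S + (sigma * L * S + sigma * L)) by ring.
  rewrite lerD2l (le_trans h1)// mulrDr -[leLHS]add0r lerD// lerD2r//.
rewrite -ltNge in h; have k0 : 0 < a - nu by rewrite subr_gt0.
set k := a - nu in k0 *.
have sk : 0 <= sigma / k by rewrite divr_ge0// ltW.
have B0 : 0 <= c1 + sigma * L + sigma / k := addr_ge0 (addr_ge0 c10 sL) sk.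
exists (expR (alpha * lc) * (expR (k * L) * (c1 + sigma * L + sigma / k) ^+ e)).
  by apply: mulr_ge0 => //; apply: mulr_ge0 (expR_ge0 _) _; rewrite exprn_ge0// B0.
move=> S t S0 t0 tS.
have lb0 : 0 <= logb lc sigma S t.
  by rewrite /logb !addr_ge0 ?mulr_ge0 ?(ltW sigma_gt0) ?(ltW p).
have -> : expR (alpha * (lc + sigma * (t - S)) - 4 * pi ^+ 2 / sigma * t) =
  expR (alpha * lc) * (expR (k * (t - S)) * expR (- (4 * pi ^+ 2 / sigma * S))).
  by rewrite -!expRD; congr expR; rewrite /k /a /nu; ring.
rewrite -[leLHS]mulrA -[leRHS]mulrA ler_wpM2l// mulrAC ler_wpM2r ?expR_ge0//.
set B := c1 + sigma * L + sigma / k in B0 *.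
have eL : 1 <= expR (k * L) by rewrite -expR0 ler_expR mulr_ge0 ?(ltW k0)//; lra.
have [tS1|tS1] := leP 0 (t - S).
  apply: ler_pM; rewrite ?expR_ge0 ?exprn_ge0//.
    by rewrite ler_expR ler_wpM2l ?(ltW k0)//; lra.
  rewrite lerXn2r ?nnegrE//.
  rewrite /logb (ger0_norm tS1).
  have : sigma * (t - S) <= sigma * L by rewrite ler_wpM2l ?(ltW sigma_gt0)//; lra.
  by rewrite /B /c1; lra.
have E1 : expR (k * (t - S)) <= 1 by rewrite expR_le1 pmulr_rle0// ltW.
have d0 : 0 <= S - t by lra.
have lin := linexp_le k0 d0.
have EE : - (k * (S - t)) = k * (t - S) by ring.
rewrite EE in lin.
apply: (@le_trans _ _ (1 * B ^+ e)); last first.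
  by rewrite ler_wpM2r// exprn_ge0.
rewrite mul1r; have E0 := expR_ge0 (k * (t - S)).
case: e e1 => [|[|]]// _; rewrite ?expr0 ?expr1 ?mulr1//.
rewrite /logb (ltr0_norm tS1).
have -> : `|lc| + sigma * - (t - S) + 2 * pi = c1 + sigma * (S - t) by rewrite /c1; ring.
rewrite mulrDr.
have h1 : expR (k * (t - S)) * c1 <= c1 by rewrite ler_piMl.
have h2 : expR (k * (t - S)) * (sigma * (S - t)) <= sigma / k.
  by rewrite mulrCA [expR _ * _]mulrC ler_wpM2l// ltW.
by rewrite /B; lra.
Qed.

Lemma tail_bound_rate e : (e <= 1)%N -> exists2 K : R, 0 <= K & forall S, 0 <= S ->
  tail_bound e alpha (lc + sigma * (sq 0 - S)) <= K * rate e S.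
Proof.
move=> e1; have [K K0 hK] := rate_slack e1.
pose k : R := `|lc| + sigma + 2 / alpha.
have a2 : 0 <= 2 / alpha by rewrite divr_ge0// ltW.
have k0 : 0 <= k by rewrite /k !addr_ge0// ltW.
have G0 : 0 <= k ^+ e * (2 / alpha) * expR (alpha * (lc + sigma)).
  by apply: mulr_ge0 (expR_ge0 _); apply: mulr_ge0 => //; exact: exprn_ge0.
exists (k ^+ e * (2 / alpha) * expR (alpha * (lc + sigma)) * K); first exact: mulr_ge0.
move=> S S0; apply: (@le_trans _ _ (k ^+ e * (2 / alpha) * expR (alpha * (lc + sigma)) *
   ((1 + S) ^+ e * expR (- (sigma * alpha * S))))); last first.
  by rewrite -[leRHS]mulrA ler_wpM2l ?hK.
have q1 := @sq0_le R; have q0 := @sq_ge0 R 0.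
rewrite /tail_bound mulrACA -[leRHS]mulrA mulrAC -mulrA.
rewrite [leRHS](_ : _ = (k * (1 + S)) ^+ e * (2 / alpha * (expR (alpha * (lc + sigma)) * expR (- (sigma * alpha * S))))); last first.
  by rewrite exprMn; ring.
apply: ler_pM.
- by rewrite exprn_ge0// addr_ge0.
- by rewrite mulr_ge0 ?expR_ge0.
- rewrite lerXn2r ?nnegrE ?addr_ge0//; first by rewrite mulr_ge0// addr_ge0.
  have h1 : `|lc + sigma * (sq 0 - S)| <= `|lc| + sigma * (1 + S).
    rewrite (le_trans (ler_normD _ _))// lerD2l normrM (gtr0_norm sigma_gt0).
    rewrite ler_wpM2l ?(ltW sigma_gt0)// ler_norml; apply/andP; split; lra.
  have h2 : 0 <= `|lc| * S by rewrite mulr_ge0.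
  have h3 := mulr_ge0 a2 S0.
  by rewrite /k; lra.
rewrite [leLHS]mulrC ler_wpM2l// -expRD ler_expR.
have : alpha * (sigma * (sq 0 - S)) <= alpha * (sigma * (1 - S)).
  by rewrite ler_wpM2l ?(ltW alpha_gt0)// ler_wpM2l ?(ltW sigma_gt0)// lerD2r.
lra.
Qed.

(** How far beyond S = sqrt N1 the summation goes: then y >= exp 1 at the end of the
segment of integration, and the real part of the pole of q is at most that end minus 2 for all
z <= 1. *)
Definition L0 : R := 3 + (`|lc| + 1) / sigma.

Lemma choose_M (N1 : nat) : let S := Num.sqrt N1%:R in exists M : nat,
  [/\ (N1 <= M)%N, 3 <= sq M :> R, S + L0 <= sq M, sq M <= S + (L0 + 1) &
      M%:R <= (S + (L0 + 1)) ^+ 2].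
Proof.
move=> S; have S0 : 0 <= S by exact: sqrtr_ge0.
have l3 : 3 <= L0 by rewrite /L0 lerDl divr_ge0 ?addr_ge0// ltW.
have SL : 0 <= S + L0 by lra.
pose M := (Num.truncn ((S + L0) ^+ 2)).+1.
have M1 : (S + L0) ^+ 2 < M%:R by exact: truncnS_gt.
have M2 : M%:R <= (S + L0) ^+ 2 + 1.
  by rewrite -natr1 lerD2r truncn_le// exprn_ge0.
have SS : S ^+ 2 = N1%:R by rewrite sqr_sqrtr.
exists M.
have m1 : S + L0 <= sq M.
  rewrite -(@ler_pXn2r _ 2)// ?nnegrE ?sq_ge0// sq2; lra.
have p2 : (S + L0) ^+ 2 + 2 * (S + L0) + 1 = (S + (L0 + 1)) ^+ 2 by ring.
split => //; try lra.
- rewrite -(ler_nat R) -SS (le_trans _ (ltW M1))// lerXn2r ?nnegrE//; lra.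
- have q : 0 <= S + (L0 + 1) by lra.
  by rewrite -(@ler_pXn2r _ 2)// ?nnegrE ?sq_ge0// sq2; lra.
Qed.

End Constants.

(** * Approximants with N1 poles *)
Section Approximants.
Context {R : realType}.
Variables (sigma C : R).
Hypothesis sigma_gt0 : 0 < sigma.
Hypothesis C_gt0 : 0 < C.
Implicit Types (E z alpha be : R) (f Phi : R -> R) (e m n : nat).

Let c := Num.min C 1.

(** The ratio of the expansions around 1/2: all poles that are expanded have
|y| >= min (C, 1). *)
Definition geo : R := (1 + 2 * Num.min C 1)^-1.

Lemma cmin_gt0 : 0 < c.
Proof. by rewrite lt_min C_gt0 ltr01. Qed.

Lemma geo_gt0 : 0 < geo.
Proof. by have := cmin_gt0; rewrite /c /geo => h; rewrite invr_gt0; lra. Qed.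

Lemma geo_lt1 : geo < 1.
Proof. by have := cmin_gt0; rewrite /c /geo => h; rewrite invf_lt1; lra. Qed.

Lemma geo_ge : 1 / 3 <= geo.
Proof.
have c0 := cmin_gt0; have c1 : c <= 1 by rewrite ge_min lexx orbT.
have h1 : 0 < 1 + 2 * c by lra.
have h2 : 1 + 2 * c <= 3 by lra.
by rewrite /geo -/c div1r lef_pV2 ?posrE.
Qed.

(** The fractions are z / (z + y) instead of 1 / (z + y), again to have exactness at z = 0. *)
Definition ratz N1 n f E := exists b : nat -> R,
  polyz n (fun z => f z - \sum_(0 <= j < N1) b j * (z / (z + expR (lq sigma (ln C) N1 j)))) E.

Lemma ratzD N1 n f g E E' : ratz N1 n f E -> ratz N1 n g E' ->
  ratz N1 n (fun z => f z + g z) (E + E').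
Proof.
move=> [b hb] [b' hb']; exists (fun j => b j + b' j).
apply: polyz_ext (polyzD hb hb') => z _ _.
rewrite addrACA -opprD -big_split /=; congr (_ - _).
by apply: eq_bigr => j _; rewrite mulrDl.
Qed.

Lemma ratzZ N1 n f E (k : R) : ratz N1 n f E -> ratz N1 n (fun z => k * f z) (`|k| * E).
Proof.
move=> [b hb]; exists (fun j => k * b j).
apply: polyz_ext (polyzZ k hb) => z _ _.
rewrite mulrBr mulr_sumr; congr (_ - _).
by apply: eq_bigr => j _; exact: mulrA.
Qed.

Lemma ratz_le N1 n f E E' : E <= E' -> ratz N1 n f E -> ratz N1 n f E'.
Proof. by move=> EE [b hb]; exists b; exact: polyz_le hb. Qed.

Lemma ratz_ext N1 n f g E : (forall z, 0 < z -> z <= 1 -> f z = g z) ->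
  ratz N1 n f E -> ratz N1 n g E.
Proof.
by move=> e [b hb]; exists b; apply: polyz_ext hb => z z0 z1; rewrite e.
Qed.

(** Quadrature and truncation errors, then the geometric errors: the factor in S bounds the
number of fractions moved to the polynomial. *)
Definition err alpha e N1 n : R :=
  rate sigma alpha e (Num.sqrt N1%:R) + (1 + Num.sqrt N1%:R) ^+ 2 * geo ^+ n.

Lemma rate_ge0 alpha e (S : R) : 0 <= S -> 0 <= rate sigma alpha e S.
Proof.
move=> S0; rewrite /rate; case: ifP => _; last exact: expR_ge0.
by rewrite mulr_ge0 ?expR_ge0// exprn_ge0// addr_ge0.
Qed.

(** The integral is compared on one side with the fractions, by [sum_to_rational], and on the
other with (- z)^m Phi z, by [J_polyz]. *)
Lemma base_approx alpha m be e Phi : full_line be e Phi -> (e <= 1)%N -> 0 < be -> be <= 1 ->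
  alpha = m%:R + be ->
  exists2 K : R, 0 <= K & forall N1 n,
    ratz N1 (n.+1 + m) (fun z => (- z) ^+ m * Phi z) (K * err alpha e N1 n).
Proof.
move=> hfull e1 be0 be1 aE.
have p := @pi_gt0 R.
have alpha_gt0 : 0 < alpha by rewrite aE ltr_wpDl// ler0n.
set lc := ln C; pose L : R := L0 sigma lc + 1.
have l3 : 3 <= L0 sigma lc by rewrite /L0 lerDl divr_ge0 ?addr_ge0// ltW.
have L1 : 1 <= L by rewrite /L; lra.
have [KL KL0 hL] := Lam_rate alpha lc sigma_gt0 e1 L1.
have [Kt Kt0 ht] := tail_bound_rate lc sigma_gt0 alpha_gt0 e1.
pose lmax : R := lc + sigma * L.
pose W : R := expR (alpha * lmax) * (`|lc| + sigma * L + 2 * pi) ^+ e.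
have sL0 : 0 <= sigma * L by rewrite mulr_ge0 ?(ltW sigma_gt0)//; lra.
have W0 : 0 <= W by rewrite mulr_ge0 ?expR_ge0// exprn_ge0// !addr_ge0// mulr_ge0// ltW.
have c0 := cmin_gt0; have c1 : c <= 1 by rewrite ge_min lexx orbT.
have clc : c <= expR lc by rewrite lnK ?posrE// ge_min lexx.
have H0 := @height_ge0 R sigma sigma_gt0.
have g0 := geo_gt0; have g1 := ltW geo_lt1.
(* T bounds the tail beyond the last node, K1 and Kt the terms with the rate, K2 the fractions
   moved to the polynomial and K3 the vertical side *)
pose T : R := (`|lmax| + 2) * 2.
have T0 : 0 <= T by rewrite mulr_ge0// addr_ge0.
pose K1 : R := 2 * `|contour_cst sigma| * KL.
pose K2 : R := L ^+ 2 * (sigma * W) * c^-1.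
pose K3 : R := 2 * sigma * W * 2 * height sigma.
have K10 : 0 <= K1 by rewrite !mulr_ge0.
have K20 : 0 <= K2.
  apply: mulr_ge0; last by rewrite invr_ge0 ltW.
  by apply: mulr_ge0; [exact: sqr_ge0|rewrite mulr_ge0// ltW].
have K30 : 0 <= K3.
  by apply: mulr_ge0 => //; apply: mulr_ge0 => //; apply: mulr_ge0 => //; rewrite mulr_ge0// ltW.
exists (K1 + Kt + (K2 + K3 + (1 + T))); first by rewrite !addr_ge0.
move=> N1 n; pose S : R := Num.sqrt N1%:R; have S0 : 0 <= S by exact: sqrtr_ge0.
have [M [N1M M3 SM MS MS2]] := choose_M lc sigma_gt0 N1.
rewrite -/S -/lc -/L in SM MS MS2.
have dML : `|sq M - S| <= L by move: SM MS l3; clear; rewrite /L => ? ? ?; rewrite ger0_norm; lra.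
have LS0 : 0 <= S + L by rewrite addr_ge0// (le_trans _ L1).
have LS1 : S + L <= L * (1 + S) by rewrite mulrDr mulr1 addrC lerD2l ler_peMl.
pose LY : R := lc + sigma * (sq M - S).
have LYs : 3 * sigma + 1 <= LY.
  rewrite /LY; have : sigma * L0 sigma lc <= sigma * (sq M - S).
    by rewrite ler_wpM2l ?(ltW sigma_gt0)//; lra.
  have -> : sigma * L0 sigma lc = 3 * sigma + `|lc| + 1.
    by rewrite /L0; field; rewrite gt_eqF.
  have := ler_norm (- lc); rewrite normrN; lra.
have LY1 : 1 <= LY by have := sigma_gt0; lra.
have LY2 : 3 * sigma <= LY by lra.
have LY0 : 0 <= LY by exact: le_trans LY1.
have LYm : LY <= lmax by rewrite /LY /lmax lerD2l ler_wpM2l ?(ltW sigma_gt0)//; lra.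
have LamP (t : R) : 0 <= t -> t <= sq M ->
  expR (alpha * (lc + sigma * (t - S)) - 4 * pi ^+ 2 / sigma * t) *
    logb lc sigma S t ^+ e <= KL * rate sigma alpha e S.
  by move=> t0 tM; apply: hL => //; exact: le_trans MS.
have h1 := sum_to_rational sigma_gt0 alpha_gt0 LY1 LY2 N1M M3 c0 c1 clc LamP (n.+1 + m).
have lalb : lc + sigma * (sq 0 - S) <= LY.
  by rewrite /LY lerD2l ler_wpM2l ?(ltW sigma_gt0)// lerD2r sq_le.
have h2 := J_polyz m n hfull e1 be0 be1 lalb LY1 geo_ge.
rewrite -aE in h2.
exists (bq sigma alpha lc N1 e).
have h3 := polyzD h1 (polyzZ (-1) h2).
rewrite normrN1 mul1r in h3.
apply: polyz_le (polyz_ext _ h3); last first.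
  move=> z z0 z1; rewrite Jq_mellin//.
  by rewrite -/S -/LY; ring.
set r := rate sigma alpha e S; set q : R := (1 + S) ^+ 2 * geo ^+ n.
have r0 : 0 <= r by exact: rate_ge0.
have gn0 : 0 <= geo ^+ n by rewrite exprn_ge0// ltW.
have S1 : 1 <= (1 + S) ^+ 2 by rewrite exprn_ege1// lerDl.
have q0 : 0 <= q by rewrite mulr_ge0// (le_trans _ S1).
have gq : geo ^+ n <= q by rewrite ler_peMl.
have gn' : geo ^+ (n.+1 + m) <= geo ^+ n.
  by rewrite ler_wiXn2l ?(ltW g0)// addSn (leq_trans (leqnSn n))// ltnS leq_addr.
have gn'0 : 0 <= geo ^+ (n.+1 + m) by rewrite exprn_ge0// ltW.
have W1 : expR (alpha * LY) * logb lc sigma S (sq M) ^+ e <= W.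
  have b0 : 0 <= logb lc sigma S (sq M).
    by rewrite /logb !addr_ge0 ?mulr_ge0 ?(ltW sigma_gt0) ?(ltW p).
  apply: ler_pM; rewrite ?expR_ge0 ?exprn_ge0//.
    by rewrite ler_expR ler_wpM2l// ltW.
  rewrite lerXn2r ?nnegrE//; first by rewrite !addr_ge0// mulr_ge0// ltW.
  by rewrite /logb lerD2r lerD2l ler_wpM2l// ltW.
have W10 : 0 <= expR (alpha * LY) * logb lc sigma S (sq M) ^+ e.
  rewrite mulr_ge0 ?expR_ge0// exprn_ge0//.
  by rewrite /logb !addr_ge0 ?mulr_ge0 ?(ltW sigma_gt0) ?(ltW p).
have T1 : tail_bound e 1 (- LY) <= T.
  have E1 : expR (1 * - LY) <= 1 by rewrite expR_le1 mul1r oppr_le0.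
  have l2 : `|LY| <= `|lmax| by rewrite !ger0_norm// (le_trans LY0).
  have n0 := normr_ge0 LY.
  rewrite /tail_bound normrN divr1 -[leRHS]mulr1 ler_pM ?expR_ge0// ?mulr_ge0 ?exprn_ge0 ?addr_ge0//.
  rewrite /T ler_wpM2r//; case: (e) e1 => [|[|]]// _; rewrite ?expr0 ?expr1.
    by rewrite -[leLHS]add0r lerD// ler1n.
  by rewrite lerD2r.
have t1 := ht S S0; rewrite -/r in t1.
have b1 : 2 * contour_cst sigma * (KL * r) <= K1 * r.
  rewrite /K1 -[2 * `|_| * KL * r]mulrA ler_wpM2r ?(mulr_ge0 KL0 r0)// ler_wpM2l//.
  exact: ler_norm.
have b2 : M%:R * (sigma * (expR (alpha * LY) * logb lc sigma S (sq M) ^+ e)) *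
    (geo ^+ (n.+1 + m) * c^-1) <= K2 * q.
  have -> : K2 * q = ((L * (1 + S)) ^+ 2 * (sigma * W)) * (geo ^+ n * c^-1).
    by rewrite /K2 /q exprMn; ring.
  apply: ler_pM.
  - by rewrite mulr_ge0// mulr_ge0// ltW.
  - by rewrite mulr_ge0// invr_ge0 ltW.
  - apply: ler_pM; rewrite ?ler0n// ?(mulr_ge0 (ltW sigma_gt0) W10)//.
      by apply: le_trans MS2 _; rewrite lerXn2r ?nnegrE// (le_trans LS0).
    by rewrite ler_wpM2l// ltW.
  - by rewrite ler_wpM2r// invr_ge0 ltW.
have b3 : 2 * sigma * (expR (alpha * LY) * logb lc sigma S (sq M) ^+ e) * 2 *
    geo ^+ (n.+1 + m) * height sigma <= K3 * q.
  have -> : K3 * q = 2 * sigma * W * 2 * q * height sigma by rewrite /K3; ring.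
  have s2 : 0 <= 2 * sigma by rewrite mulr_ge0// ltW.
  apply: ler_wpM2r => //; apply: ler_pM => //.
  - by rewrite mulr_ge0// mulr_ge0.
  - by rewrite ler_wpM2r// ler_wpM2l.
  - exact: le_trans gn' gq.
have b4 : geo ^+ n * (1 + tail_bound e 1 (- LY)) <= (1 + T) * q.
  rewrite mulrC; apply: ler_pM => //; last by rewrite lerD2l.
  by rewrite addr_ge0// tail_bound_ge0.
rewrite /err -/S -/r -/q.
apply: (@le_trans _ _ ((K1 * r + K2 * q + K3 * q) + ((1 + T) * q + Kt * r))).
  by apply: lerD; [apply: lerD => //; exact: lerD|exact: lerD].
rewrite -subr_ge0.
have -> : (K1 + Kt + (K2 + K3 + (1 + T))) * (r + q) - (K1 * r + K2 * q + K3 * q + ((1 + T) * q + Kt * r)) =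
  (K1 + Kt) * q + (K2 + K3 + (1 + T)) * r by ring.
by rewrite addr_ge0// mulr_ge0// !addr_ge0.
Qed.

End Approximants.

(** * Powers and logarithms *)
Section PowerAndLog.
Context {R : realType}.
Variables (sigma C : R).
Hypothesis sigma_gt0 : 0 < sigma.
Hypothesis C_gt0 : 0 < C.
Implicit Types (E z alpha be : R) (e m n : nat).

Lemma err_mono alpha N1 n : err sigma C alpha 0 N1 n <= err sigma C alpha 1 N1 n.
Proof.
rewrite /err lerD2r /rate; case: ifP => _ //.
by rewrite expr0 expr1 ler_wpM2r ?expR_ge0// lerDl sqrtr_ge0.
Qed.

Lemma expR_split m be z : 0 < z ->
  (- z) ^+ m * expR (be * ln z) = (-1) ^+ m * expR ((m%:R + be) * ln z).
Proof.
move=> z0; have E : expR (m%:R * ln z) = z ^+ m.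
  by rewrite expRM_natl lnK ?posrE.
by rewrite [in LHS]exprNn -mulrA [(_ + be) * _]mulrDl expRD E.
Qed.

Lemma split_exponent alpha : 0 < alpha ->
  (exists m, alpha = m%:R + 1) \/
  (exists m be, [/\ alpha = m%:R + be, 0 < be & be < 1]).
Proof.
move=> a0; pose t := Num.truncn alpha.
have ta : t%:R <= alpha by rewrite truncn_le ltW.
have at1 : alpha < t.+1%:R by exact: truncnS_gt.
have [E|E] := eqVneq alpha t%:R.
  left; exists t.-1; rewrite natr1 prednK//.
  by rewrite -(ltr_nat R) -E.
right; exists t, (alpha - t%:R); split; first by rewrite addrC subrK.
  by rewrite subr_gt0 lt_neqAle eq_sym E.
by rewrite ltrBlDl natr1.
Qed.

Lemma sign_sqr m : (-1) ^+ m * (-1) ^+ m = 1 :> R.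
Proof. by rewrite -expr2 sqrr_sign. Qed.

Lemma approx_pow alpha m be : alpha = m%:R + be -> 0 < be -> be < 1 ->
  exists2 K : R, 0 <= K & forall N1 n,
    ratz sigma C N1 (n.+1 + m) (fun z => expR (alpha * ln z)) (K * err sigma C alpha 0 N1 n).
Proof.
move=> aE be0 be1; have [A0 [A1 [A00 h0 _]]] := full_line_frac be0 be1.
have [K K0 hK] := base_approx sigma_gt0 C_gt0 h0 isT be0 (ltW be1) aE.
exists (`|(-1) ^+ m / A0| * K); first by rewrite mulr_ge0.
move=> N1 n; rewrite -mulrA; apply: ratz_ext (ratzZ _ (hK N1 n)) => z z0 z1.
have -> : (- z) ^+ m * (A0 * expR (be * ln z)) = A0 * ((- z) ^+ m * expR (be * ln z)) by ring.
rewrite expR_split// -aE; have := sign_sqr m.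
set s := (-1) ^+ m; set X := expR _ => ss.
transitivity (s * s * X); last by rewrite ss mul1r.
by field; rewrite gt_eqF.
Qed.

(** For fractional be the kernel with e = 1 produces z^alpha (A1 + A0 log z), from which the
approximant of z^alpha is subtracted; for be = 1 the kernel with e = 0 already produces the
logarithm. *)
Lemma approx_log alpha : 0 < alpha -> exists m, exists2 K : R, 0 <= K & forall N1 n,
  ratz sigma C N1 (n.+1 + m) (fun z => expR (alpha * ln z) * ln z) (K * err sigma C alpha 1 N1 n).
Proof.
move=> a0; case: (split_exponent a0) => [[m aE]|[m [be [aE be0 be1]]]]; exists m.
  have [K K0 hK] := base_approx sigma_gt0 C_gt0 (@full_line_one R) isT ltr01 (lexx 1) aE.
  exists K => // N1 n; apply: ratz_le (ler_wpM2l K0 (err_mono _ _ _)) _.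
  have -> : K * err sigma C alpha 0 N1 n = `|- (-1) ^+ m| * (K * err sigma C alpha 0 N1 n).
    by rewrite normrN normrX normrN1 expr1n mul1r.
  apply: ratz_ext (ratzZ _ (hK N1 n)) => z z0 z1.
  have := expR_split m 1 z0; rewrite -aE mul1r lnK ?posrE// => h.
  transitivity ((-1) ^+ m * ((- z) ^+ m * z) * ln z); first by ring.
  by rewrite h mulrA sign_sqr mul1r.
have [A0 [A1 [A00 _ h1]]] := full_line_frac be0 be1.
have [K K0 hK] := base_approx sigma_gt0 C_gt0 h1 isT be0 (ltW be1) aE.
have [K' K0' hK'] := approx_pow aE be0 be1.
exists (`|(-1) ^+ m / A0| * K + `|- (A1 / A0)| * K'); first by rewrite addr_ge0// mulr_ge0.
move=> N1 n.
have e1 := err_mono alpha N1 n.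
have hP := ratz_le (ler_wpM2l K0' e1) (hK' N1 n).
have hS := ratzD (ratzZ ((-1) ^+ m / A0) (hK N1 n)) (ratzZ (- (A1 / A0)) hP).
rewrite mulrDl -!mulrA; apply: ratz_ext hS => z z0 z1.
have := expR_split m be z0; rewrite -aE; set X := expR (alpha * _); set Y := expR _ => h.
have -> : (- z) ^+ m * ((A1 + A0 * ln z) * Y) = (A1 + A0 * ln z) * ((- z) ^+ m * Y) by ring.
rewrite h; have := sign_sqr m; set s := (-1) ^+ m => ss.
transitivity (s * s * (A1 + A0 * ln z) / A0 * X - A1 / A0 * X); first by field; rewrite gt_eqF.
by rewrite ss; field; rewrite gt_eqF.
Qed.

(** The degree N2; the minimum with N matters for small N only. *)
Definition deg2 (c0 N : nat) : nat := minn N (c0 * (Num.truncn (Num.sqrt (N%:R : R))).+1).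

Lemma sqrt_nat_ge0 N : 0 <= Num.sqrt (N%:R : R). Proof. exact: sqrtr_ge0. Qed.

Lemma deg2_le c0 N : (deg2 c0 N)%:R <= c0%:R * (Num.sqrt (N%:R : R) + 1).
Proof.
apply: (@le_trans _ _ (c0 * (Num.truncn (Num.sqrt (N%:R : R))).+1)%:R).
  by rewrite ler_nat geq_minr.
by rewrite natrM ler_wpM2l// -natr1 lerD2r truncn_le// sqrt_nat_ge0.
Qed.

(** A degree of order sqrt N costs a bounded amount in sqrt N1. *)
Lemma sqrt_sub c0 N : Num.sqrt (N%:R : R) - 2 * c0%:R <= Num.sqrt (N - deg2 c0 N)%:R.
Proof.
set S := Num.sqrt N%:R; set S1 := Num.sqrt _.
have S0 : 0 <= S by exact: sqrtr_ge0.
have S10 : 0 <= S1 by exact: sqrtr_ge0.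
have c00 : 0 <= c0%:R :> R by [].
case: (posnP N) => [N0|N0].
  have -> : S = 0 by rewrite /S N0 sqrtr0.
  by apply: le_trans S10; rewrite sub0r oppr_le0 mulr_ge0.
have S1' : 1 <= S by rewrite -(sqrtr1 R) ler_wsqrtr// ler1n.
have [//|h] := leP (S - 2 * c0%:R) S1.
have dle : (deg2 c0 N <= N)%N by exact: geq_minl.
have e1 : S1 ^+ 2 = S ^+ 2 - (deg2 c0 N)%:R by rewrite !sqr_sqrtr// natrB.
have d1 := deg2_le c0 N; rewrite -/S in d1.
have h3 : (S1 + 2 * c0%:R) * S < S * S.
  by rewrite ltr_pM2r//; lra.
have h4 : S1 * S1 <= S1 * S by rewrite ler_wpM2l//; lra.
have h5 : c0%:R * 1 <= c0%:R * S :> R by rewrite ler_wpM2l.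
rewrite !expr2 in e1; lra.
Qed.

End PowerAndLog.
Arguments deg2 R c0 N : clear implicits.
Arguments sqrt_sub R c0 N : clear implicits.
Arguments deg2_le R c0 N : clear implicits.

(** * Errors in terms of N *)
Section Asymptotics.
Context {R : realType}.
Variables (sigma C alpha : R).
Hypothesis sigma_gt0 : 0 < sigma.
Hypothesis C_gt0 : 0 < C.
Hypothesis alpha_gt0 : 0 < alpha.
Implicit Types (e m n N c : nat).

Let nu : R := 4 * pi ^+ 2 / sigma.

(** The bounds of the statement for z^alpha (e = 0, without the factor kappa) and z^alpha log z
(e = 1). *)
Definition goal_err e N : R :=
  if sigma * alpha <= 4 * pi ^+ 2 / sigma
  then Num.sqrt N%:R ^+ e * expR (- (sigma * alpha * Num.sqrt N%:R))
  else expR (- (4 * pi ^+ 2 / sigma * Num.sqrt N%:R)).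

Lemma nu_gt0 : 0 < nu.
Proof. by rewrite /nu divr_gt0// mulr_gt0// exprn_gt0// pi_gt0. Qed.

Lemma goal_err_ge0 e N : 0 <= goal_err e N.
Proof.
rewrite /goal_err; case: ifP => _; last exact: expR_ge0.
by rewrite mulr_ge0 ?expR_ge0// exprn_ge0// sqrtr_ge0.
Qed.

Lemma le_sqrt_nat (c N : nat) : (c ^ 2 <= N)%N -> c%:R <= Num.sqrt N%:R :> R.
Proof.
move=> h; rewrite -(@ler_pXn2r _ 2)// ?nnegrE ?sqrtr_ge0// sqr_sqrtr//.
by rewrite -natrX ler_nat.
Qed.

Lemma sqrt_sub_le c N : Num.sqrt (N - deg2 R c N)%:R <= Num.sqrt (N%:R : R).
Proof. by rewrite ler_wsqrtr// ler_nat leq_subr. Qed.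

Lemma deg2_large c N : ((2 * c) ^ 2 <= N)%N ->
  deg2 R c N = (c * (Num.truncn (Num.sqrt (N%:R : R))).+1)%N.
Proof.
move=> h; apply/minn_idPr; rewrite -(ler_nat R) natrM.
have S0 : 0 <= Num.sqrt (N%:R : R) by exact: sqrtr_ge0.
have h2 := le_sqrt_nat h; rewrite natrM in h2.
have t1 : (Num.truncn (Num.sqrt (N%:R : R)))%:R <= Num.sqrt (N%:R : R) by rewrite truncn_le.
have e2 : Num.sqrt (N%:R : R) ^+ 2 = N%:R by rewrite sqr_sqrtr.
case: (posnP c) => [->|c0]; first by rewrite mul0r.
have c1 : 1 <= c%:R :> R by rewrite ler1n.
set S := Num.sqrt _ in S0 h2 t1 e2 *; rewrite -e2 expr2 -natr1.
apply: (@le_trans _ _ (S / 2 * (S * 2))); last by rewrite le_eqVlt; apply/orP; left; apply/eqP; field.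
by apply: ler_pM => //; rewrite ?addr_ge0//; lra.
Qed.

Lemma deg2_bigO c N : ((4 * c) ^ 2 <= N)%N -> (0 < N)%N ->
  (deg2 R c N)%:R <= 4 * c%:R * Num.sqrt (N - deg2 R c N)%:R :> R.
Proof.
move=> h N0; have h1 := le_sqrt_nat h; rewrite natrM in h1.
have h2 := sqrt_sub R c N; have h3 := deg2_le R c N.
have S1 : 1 <= Num.sqrt (N%:R : R) by rewrite -{1}(sqrtr1 R) ler_wsqrtr// ler1n.
apply: le_trans h3 _; rewrite [4 * _]mulrC -mulrA ler_wpM2l//; lra.
Qed.

(** Large enough for geo^N2 to beat (1 + sqrt N)^2 times the inverse of either target rate,
the margin 2 in the numerator being for the square. *)
Definition c_deg : nat :=
  (Num.truncn ((sigma * alpha + nu + 2) / (- ln (geo C)))).+1.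

Lemma geo_pow c N : ((2 * c_deg) ^ 2 <= N)%N ->
  geo C ^+ deg2 R c_deg N <= expR (- ((sigma * alpha + nu + 2) * Num.sqrt N%:R)).
Proof.
move=> h; have g0 := geo_gt0 C_gt0; have g1 := geo_lt1 C_gt0.
have l0 : 0 < - ln (geo C) by rewrite oppr_gt0 ln_lt0// g0.
have -> : geo C ^+ deg2 R c_deg N = expR (- ((deg2 R c_deg N)%:R * - ln (geo C))).
  by rewrite mulrN opprK expRM_natl lnK ?posrE.
rewrite ler_expR lerN2 deg2_large// natrM mulrAC.
have h1 : sigma * alpha + nu + 2 <= c_deg%:R * - ln (geo C).
  rewrite -ler_pdivrMr//; exact: ltW (truncnS_gt _).
apply: ler_pM => //; rewrite ?sqrtr_ge0//.
  by rewrite addr_ge0// addr_ge0 ?(ltW nu_gt0)// mulr_ge0// ltW.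
exact: ltW (truncnS_gt _).
Qed.

Lemma err_asym m e : (e <= 1)%N -> exists N0, exists2 K : R, 0 <= K & forall N, (N0 <= N)%N ->
  (m < deg2 R c_deg N)%N /\
  err sigma C alpha e (N - deg2 R c_deg N) (deg2 R c_deg N - m.+1) <= K * goal_err e N.
Proof.
move=> e1; have g0 := geo_gt0 C_gt0; have g1 := geo_lt1 C_gt0.
have sa : 0 < sigma * alpha by rewrite mulr_gt0.
have nu0 := nu_gt0; have gm : 0 < geo C ^+ m.+1 by rewrite exprn_gt0.
pose K1 : R := 2 * expR (2 * c_deg%:R * (sigma * alpha + nu)).
(* so that N2 is not truncated by N, N2 > m and sqrt N >= 1 *)
exists ((2 * c_deg) ^ 2 + m.+1 ^ 2 + 1)%N; exists (K1 + geo C ^- m.+1).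
  by rewrite addr_ge0 ?mulr_ge0 ?expR_ge0// invr_ge0 ltW.
move=> N hN.
have hN1 : ((2 * c_deg) ^ 2 <= N)%N by apply: leq_trans hN; rewrite -addnA leq_addr.
have hN2 : (m.+1 ^ 2 <= N)%N by apply: leq_trans hN; rewrite addnAC leq_addl.
have hN3 : (0 < N)%N by apply: leq_trans hN; rewrite addn1.
set S : R := Num.sqrt N%:R.
have S1 : 1 <= S by rewrite -(sqrtr1 R) ler_wsqrtr// ler1n.
have md : (m < deg2 R c_deg N)%N.
  rewrite deg2_large// (@leq_trans (Num.truncn (Num.sqrt (N%:R : R))).+1)//.
    rewrite -(ltr_nat R) (lt_le_trans _ (le_trans (le_sqrt_nat hN2) (ltW (truncnS_gt _))))//.
    by rewrite ltr_nat.
  by rewrite leq_pmull.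
split=> //; rewrite /err mulrDl.
have s1 := sqrt_sub R c_deg N; have s2 := sqrt_sub_le c_deg N; rewrite -/S in s1 s2.
set T : R := Num.sqrt (N - _)%:R in s1 s2 *.
have T0 : 0 <= T by exact: sqrtr_ge0.
have cd0 : 0 <= 2 * c_deg%:R :> R by rewrite mulr_ge0.
apply: lerD.
  have X (k : R) : 0 <= k -> k <= sigma * alpha + nu ->
      expR (- (k * T)) <= expR (2 * c_deg%:R * (sigma * alpha + nu)) * expR (- (k * S)).
    move=> k0 kk; rewrite -expRD ler_expR.
    have h1 : 2 * c_deg%:R * k <= 2 * c_deg%:R * (sigma * alpha + nu) by rewrite ler_wpM2l.
    have h2 : k * (S - 2 * c_deg%:R) <= k * T by rewrite ler_wpM2l.
    lra.
  rewrite /rate /goal_err -/S; case: ifP => _.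
    have -> : K1 * (S ^+ e * expR (- (sigma * alpha * S))) = 2 * S ^+ e *
      (expR (2 * c_deg%:R * (sigma * alpha + nu)) * expR (- (sigma * alpha * S))).
      by rewrite /K1; ring.
    rewrite ler_pM ?exprn_ge0 ?expR_ge0 ?addr_ge0//.
      by case: (e) e1 => [|[|]]// _; rewrite ?expr0 ?expr1; lra.
    by apply: X; [exact: ltW|rewrite lerDl ltW].
  apply: le_trans (X nu (ltW nu0) _) _; first by rewrite lerDr ltW.
  by rewrite ler_wpM2r ?expR_ge0// /K1 ler_peMl ?expR_ge0// ler1n.
have -> : geo C ^+ (deg2 R c_deg N - m.+1) = geo C ^- m.+1 * geo C ^+ deg2 R c_deg N.
  by rewrite -{2}(subnKC md) exprD mulKf// gt_eqF.
rewrite mulrCA ler_wpM2l ?invr_ge0 ?(ltW gm)//.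
apply: (@le_trans _ _ (expR (2 * S) * expR (- ((sigma * alpha + nu + 2) * S)))).
  rewrite ler_pM ?sqr_ge0 ?exprn_ge0 ?(ltW g0)//; last exact: (@geo_pow 0).
  rewrite (_ : expR (2 * S) = expR S ^+ 2) ?lerXn2r ?nnegrE ?expR_ge0 ?addr_ge0//.
    by rewrite (le_trans _ (expR_ge1Dx S))// lerD2l.
  by rewrite expRM_natl.
rewrite -expRD /goal_err -/S; case: ifP => _.
  rewrite -[leLHS]mul1r ler_pM ?expR_ge0 ?exprn_ege1//.
  by rewrite ler_expR; have := mulr_ge0 (ltW nu0) (le_trans ler01 S1); lra.
by rewrite ler_expR -/nu; have := mulr_ge0 (ltW sa) (le_trans ler01 S1); lra.
Qed.

End Asymptotics.

(** * Poles of the approximants *)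
Section Poles.
Context {R : realType}.
Implicit Types (z w p : R[i]).

(** The norm of R[i] has values in R[i] itself, on the real axis; here it is traded for the
real-valued modulus. *)
Lemma near_punctured w (Q : set R[i]) :
  (\forall z \near (w : R[i]^o)^', Q z) <->
  exists2 d : R, 0 < d & forall z, z != w -> normc (z - w) < d -> Q z.
Proof.
split.
  rewrite /dnbhs /= /within /= => -/nbhs_ballP [e /= e0 h].
  have [Im0 Re0] : Im e = 0 /\ 0 < Re e.
    by move: e0; case: (e) => x y; rewrite ltcE /= => /andP[/eqP -> ->].
  have eE : e = (Re e)%:C by case: (e) Im0 => x y /= ->.
  exists (Re e) => // z zw zd; apply: h => //.
  rewrite -ball_normE /ball_ /= eE -normrN opprB.
  by rewrite (_ : `|z - w| = (normc (z - w))%:C)// ltcR.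
move=> [d d0 h]; rewrite /dnbhs /= /within /=; apply/nbhs_ballP.
exists d%:C; first by rewrite /= ltcR.
move=> z; rewrite -ball_normE /ball_ /= -normrN opprB.
by rewrite (_ : `|z - w| = (normc (z - w))%:C)// ltcR => zd zw; apply: h.
Qed.

Lemma is_poleP (f : R[i] -> R[i]) w : is_pole f w <-> forall A : R,
  exists2 d : R, 0 < d & forall z, z != w -> normc (z - w) < d -> A <= normc (f z).
Proof.
rewrite /is_pole; split.
  by move=> /cvgryPge h A; apply/near_punctured; exact: h.
by move=> h; apply/cvgryPge => A; apply/near_punctured; exact: h.
Qed.

Definition bounded_near w (f : R[i] -> R[i]) := exists B, exists2 d : R, 0 < d &
  forall z, normc (z - w) < d -> normc (f z) <= B.

Lemma bounded_near_not_pole f w : bounded_near w f -> ~ is_pole f w.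
Proof.
move=> [B [d d0 hB]] /is_poleP/(_ (B + 1))[d' d'0 h].
pose t := Num.min d d' / 2.
have m0 : 0 < Num.min d d' by rewrite lt_min d0.
have t0 : 0 < t by rewrite divr_gt0.
have td : t < d by rewrite (@lt_le_trans _ _ (Num.min d d')) ?ge_min ?lexx// /t; lra.
have td' : t < d' by rewrite (@lt_le_trans _ _ (Num.min d d')) ?ge_min ?lexx ?orbT// /t; lra.
have zw : normc (w + t%:C - w) = t by rewrite addrC addKr normcR gtr0_norm.
have h1 := hB (w + t%:C); have h2 := h (w + t%:C); rewrite zw in h1 h2.
have zn : w + t%:C != w by rewrite -subr_eq0 addrC addKr fmorph_eq0 gt_eqF.
by have := h1 td; have := h2 zn td'; lra.
Qed.

Lemma bounded_nearD w f g : bounded_near w f -> bounded_near w g ->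
  bounded_near w (fun z => f z + g z).
Proof.
move=> [B [d d0 hB]] [B' [d' d'0 hB']]; exists (B + B'), (Num.min d d').
  by rewrite lt_min d0.
by move=> z; rewrite lt_min => /andP[zd zd']; rewrite (le_trans (normcD _ _))// lerD ?hB ?hB'.
Qed.

Lemma bounded_near0 w : bounded_near w (fun=> 0).
Proof. by exists 0, 1 => // z _; rewrite normc0. Qed.

Lemma bounded_near_sum w (I : Type) (r : seq I) (P : pred I) (F : I -> R[i] -> R[i]) :
  (forall i, P i -> bounded_near w (F i)) -> bounded_near w (fun z => \sum_(i <- r | P i) F i z).
Proof.
move=> hF; elim: r => [|i r IH].
  by under eq_fun do rewrite big_nil; exact: bounded_near0.
under eq_fun do rewrite big_cons.
by case Pi : (P i) => //; apply: bounded_nearD => //; exact: hF.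
Qed.

Lemma sqr_dist w z : normc (z - w) <= 1 ->
  normc (z ^+ 2 - w ^+ 2) <= normc (z - w) * (1 + 2 * normc w).
Proof.
move=> z1; rewrite subr_sqr normcM ler_wpM2l ?normc_ge0//.
have -> : z + w = (z - w) + 2 * w by ring.
by rewrite (le_trans (normcD _ _))// normcM (normc_natr 2) lerD2r.
Qed.

Lemma bounded_near_poly w (P : {poly R[i]}) : bounded_near w (fun z => P.[z ^+ 2]).
Proof.
exists (\sum_(i < size P) normc P`_i * ((1 + normc w) ^+ 2) ^+ i), 1 => // z z1.
rewrite horner_coef (le_trans (normc_sum _ _ _))//; apply: ler_sum => i _.
rewrite normcM ler_wpM2l ?normc_ge0// !normcX lerXn2r ?nnegrE ?exprn_ge0 ?normc_ge0 ?addr_ge0 ?normc_ge0//.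
rewrite lerXn2r ?nnegrE ?normc_ge0 ?addr_ge0 ?normc_ge0//.
by rewrite -{1}(subrK w z) (le_trans (normcD _ _))// lerD2r ltW.
Qed.

Lemma bounded_near_frac w (a p : R[i]) : w ^+ 2 != p -> bounded_near w (fun z => a / (z ^+ 2 - p)).
Proof.
move=> wp; pose m := normc (w ^+ 2 - p).
have m0 : 0 < m by rewrite normc_gt0 subr_eq0.
have k0 : 0 < 1 + 2 * normc w by rewrite ltr_pwDl// mulr_ge0// normc_ge0.
exists (normc a * (m / 2)^-1), (Num.min 1 (m / 2 / (1 + 2 * normc w))).
  by rewrite lt_min ltr01 !divr_gt0.
move=> z; rewrite lt_min => /andP[z1 z2].
rewrite normcM ler_wpM2l ?normc_ge0// normcV.
have h : normc (z ^+ 2 - w ^+ 2) <= m / 2.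
  by apply: le_trans (sqr_dist (ltW z1)) _; rewrite -ler_pdivlMr// ltW.
have h2 : m <= normc (z ^+ 2 - p) + normc (z ^+ 2 - w ^+ 2).
  rewrite /m (_ : w ^+ 2 - p = (z ^+ 2 - p) - (z ^+ 2 - w ^+ 2)); last by ring.
  exact: normcB.
by rewrite lef_pV2 ?posrE; lra.
Qed.

Lemma frac_pole w (a : R[i]) g : a != 0 -> w != 0 -> bounded_near w g ->
  is_pole (fun z => a / (z ^+ 2 - w ^+ 2) + g z) w.
Proof.
move=> a0 w0 [B [d d0 hB]]; apply/is_poleP => A.
have na : 0 < normc a by rewrite normc_gt0.
have nw : 0 < normc w by rewrite normc_gt0.
have k0 : 0 < 1 + 2 * normc w by rewrite ltr_pwDl// mulr_ge0// normc_ge0.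
pose T := `|A| + `|B| + 1; have T0 : 0 < T by rewrite ltr_wpDl// addr_ge0.
(* the radius |w| excludes - w, where the fraction has the value 0 *)
exists (Num.min (Num.min 1 d) (Num.min (normc w) (normc a / T / (1 + 2 * normc w)))).
  by rewrite !lt_min ltr01 d0 nw !divr_gt0.
move=> z zw; rewrite !lt_min => /andP[/andP[z1 zd] /andP[znw z2]].
have hz : normc (z ^+ 2 - w ^+ 2) <= normc a / T.
  by apply: le_trans (sqr_dist (ltW z1)) _; rewrite -ler_pdivlMr// ltW.
have nz : z ^+ 2 - w ^+ 2 != 0.
  rewrite subr_sqr mulf_neq0 ?subr_eq0//.
  apply: contraTneq znw => zN; rewrite -leNgt.
  have -> : z - w = - (2 * w) + (z + w) by ring.
  by rewrite zN addr0 normcN normcM (normc_natr 2) ler_peMl ?normc_ge0// ler1n.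
have hT : T <= normc (a / (z ^+ 2 - w ^+ 2)).
  rewrite normcM normcV ler_pdivlMr ?normc_gt0// mulrC -ler_pdivlMr//.
have hg := hB z zd.
have h : normc (a / (z ^+ 2 - w ^+ 2)) <= normc (a / (z ^+ 2 - w ^+ 2) + g z) + normc (g z).
  by rewrite -{1}(addrK (g z) (a / _)) normcB.
have := ler_norm A; have := ler_norm B; rewrite /T in hT; lra.
Qed.

Lemma tapered_pole_lt0 (C sigma : R) n1 j : 0 < C -> tapered_pole C sigma n1 j < 0.
Proof. by move=> C0; rewrite /tapered_pole mulNr oppr_lt0 mulr_gt0 ?expR_gt0. Qed.

Lemma tapered_pole_inj (C sigma : R) n1 j k : 0 < C -> 0 < sigma ->
  tapered_pole C sigma n1 j = tapered_pole C sigma n1 k -> j = k.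
Proof.
move=> C0 s0; have C1 : - C != 0 by rewrite oppr_eq0 gt_eqF.
have s1 : - sigma != 0 by rewrite oppr_eq0 gt_eqF.
rewrite /tapered_pole => /(mulfI C1)/expR_inj/(mulfI s1)/addrI/oppr_inj h.
have : (j%:R : R) = k%:R.
  by rewrite -[j%:R]sqr_sqrtr// -[k%:R]sqr_sqrtr// h.
by move=> /eqP; rewrite eqr_nat => /eqP.
Qed.

Lemma lightning_pole_sqr (C sigma : R) n1 s j : 0 < C ->
  tapered_lightning_pole C sigma n1 s j ^+ 2 = (tapered_pole C sigma n1 j)%:C.
Proof.
move=> C0; rewrite /tapered_lightning_pole !exprMn sqrr_sign mul1r -rmorphXn exprMn.
rewrite sqr_sqrtr ?(ltW C0)// -expRM_natl.
have -> : 'i%C ^+ 2 = -1 :> R[i] by rewrite sqr_i.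
set X := expR _; have -> : tapered_pole C sigma n1 j = - (C * X).
  by rewrite /tapered_pole mulNr /X; congr (- (C * expR _)); field.
by rewrite mulN1r [RHS]rmorphN.
Qed.

Lemma lightning_pole_root (C sigma : R) n1 j w : 0 < C -> w ^+ 2 = (tapered_pole C sigma n1 j)%:C ->
  exists s, w = tapered_lightning_pole C sigma n1 s j.
Proof.
move=> C0; rewrite -(lightning_pole_sqr sigma n1 false j C0) => /eqP.
rewrite eqf_sqr => /orP[/eqP ->|/eqP ->]; first by exists false.
by exists true; rewrite /tapered_lightning_pole expr1 expr0 mul1r !mulN1r mulNr.
Qed.

(** The p_j are distinct and negative, so the two square roots of p_j are distinct, nonzero, and
make a single fraction unbounded; away from the square roots of the p_j with a_j != 0 the
function is bounded. *)
Lemma lightning_is_pole (C sigma : R) n1 (a : nat -> R[i]) P w : 0 < C -> 0 < sigma ->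
  is_pole (fun z => lightning_fun C sigma n1 a P (z ^+ 2)) w <->
  exists s j, [/\ (1 <= j <= n1)%N, a j != 0 & w = tapered_lightning_pole C sigma n1 s j].
Proof.
move=> C0 s0; split; last first.
  move=> [s [j [/andP[j1 jn] aj ->]]]; set W := tapered_lightning_pole _ _ _ _ _.
  have W2 := lightning_pole_sqr sigma n1 s j C0; rewrite -/W in W2.
  have Wn : W != 0.
    rewrite -sqrf_eq0 W2 fmorph_eq0 lt_eqF//; exact: tapered_pole_lt0.
  rewrite (_ : (fun z => _) = (fun z => a j / (z ^+ 2 - W ^+ 2) +
    (\sum_(1 <= k < n1.+1 | k != j) a k / (z ^+ 2 - (tapered_pole C sigma n1 k)%:C) + P.[z ^+ 2]))); last first.
    apply/funext => z; rewrite /lightning_fun addrA W2; congr (_ + _).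
    rewrite (bigD1_seq j) ?iota_uniq ?mem_index_iota ?j1 ?ltnS//.
  apply: frac_pole => //; apply: bounded_nearD; last exact: bounded_near_poly.
  apply: bounded_near_sum => k kj; apply: bounded_near_frac; rewrite W2.
  apply: contra kj => /eqP/(fmorph_inj _)/(tapered_pole_inj C0 s0) ->; exact: eqxx.
move=> hp; apply: contrapT => hn; apply: (bounded_near_not_pole _ hp).
apply: bounded_nearD; last exact: bounded_near_poly.
rewrite (_ : (fun z => _) = (fun z => \sum_(k <- index_iota 1 n1.+1 | (1 <= k < n1.+1)%N)
   a k / (z ^+ 2 - (tapered_pole C sigma n1 k)%:C))); last first.
  by apply/funext => z; rewrite big_nat.
apply: bounded_near_sum => k kn.
have [ak|ak] := eqVneq (a k) 0.
  by under eq_fun do rewrite ak mul0r; exact: bounded_near0.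
apply: bounded_near_frac; apply/eqP => /(lightning_pole_root C0)[s ws].
by apply: hn; exists s, k; split => //; rewrite -ltnS.
Qed.

End Poles.

(** * The theorem *)
Section Assembly.
Context {R : realType}.
Variables (sigma C alpha : R).
Hypothesis sigma_gt0 : 0 < sigma.
Hypothesis C_gt0 : 0 < C.
Hypothesis alpha_gt0 : 0 < alpha.
Implicit Types (x z : R) (f : R -> R).

(** z / (z + y) = 1 - y / (z + y): the constants go to the polynomial, so the residues are
- b_j y_j. *)
Lemma ratz_lightning N1 n f E : ratz sigma C N1 n f E -> f 0 = 0 ->
  exists (a : nat -> R[i]) (P : {poly R[i]}), (size P <= n.+1)%N /\
    forall z, 0 <= z <= 1 -> normc (lightning_fun C sigma N1 a P z%:C - (f z)%:C) <= E.
Proof.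
move=> [b [Q sQ hQ]] f0.
pose y j := expR (lq sigma (ln C) N1 j).
pose a j : R[i] := (- (b j.-1 * y j.-1))%:C.
pose P0 : {poly R} := 'X * Q + (\sum_(0 <= j < N1) b j)%:P.
exists a, (map_poly (real_complex R) P0); split.
  rewrite size_map_poly (leq_trans (size_polyD _ _))// geq_max.
  rewrite (leq_trans (size_polyMleq _ _)) ?size_polyX//=.
  by rewrite (leq_trans (size_polyC_leq1 _)).
move=> z /andP[z0 z1].
have yE j : tapered_pole C sigma N1 j.+1 = - y j.
  by rewrite /tapered_pole /y /lq expRD lnK ?posrE// mulNr; congr (- (_ * expR _)); ring.
have E1 : lightning_fun C sigma N1 a (map_poly (real_complex R) P0) z%:C =
  (\sum_(0 <= j < N1) b j * (z / (z + y j)) + z * Q.[z])%:C.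
  rewrite /lightning_fun horner_map big_add1 /=.
  rewrite /P0 hornerD hornerC hornerM hornerX.
  have -> : \sum_(0 <= j < N1) a j.+1 / (z%:C - (tapered_pole C sigma N1 j.+1)%:C) =
     (\sum_(0 <= j < N1) - (b j * (y j / (z + y j))))%:C.
    rewrite rmorph_sum /=; apply: eq_bigr => j _; rewrite yE /a /= -rmorphB opprK.
    by rewrite -fmorphV -rmorphM; congr (_%:C); rewrite mulNr mulrA.
  rewrite -rmorphD; congr (_%:C); rewrite addrCA addrC; congr (_ + _).
  rewrite -big_split /=; apply: eq_bigr => j _.
  have yj : 0 < y j by exact: expR_gt0.
  by field; rewrite gt_eqF// ltr_wpDl.
rewrite E1 -rmorphB normcR distrC.
have [->|zn] := eqVneq z 0; last first.
  by rewrite opprD addrA; apply: hQ => //; rewrite lt_neqAle eq_sym zn.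
rewrite f0 mul0r addr0 sub0r normrN big1 ?normr0; last by move=> j _; rewrite mul0r mulr0.
exact: le_trans (normr_ge0 _) (hQ 1 ltr01 (lexx 1)).
Qed.

Let n2 := deg2 R (c_deg sigma C alpha).

Lemma lightning_sequences f g (N0 : nat) (K : R) : f 0 = 0 ->
  (forall N, (N0 <= N)%N -> ratz sigma C (N - n2 N) (n2 N) f (K * g N)) ->
  exists (a : nat -> nat -> R[i]) (P : nat -> {poly R[i]}),
    (forall N, (size (P N) <= (n2 N).+1)%N) /\
    forall N, (N0 <= N)%N -> forall z, 0 <= z <= 1 ->
      normc (lightning_fun C sigma (N - n2 N) (a N) (P N) z%:C - (f z)%:C) <= K * g N.
Proof.
move=> f0 h.
have H N : exists aP : (nat -> R[i]) * {poly R[i]}, (size aP.2 <= (n2 N).+1)%N /\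
  ((N0 <= N)%N -> forall z, 0 <= z <= 1 ->
     normc (lightning_fun C sigma (N - n2 N) aP.1 aP.2 z%:C - (f z)%:C) <= K * g N).
  have [hN|hN] := leqP N0 N; last by exists (fun=> 0, 0); split => //=; rewrite size_poly0.
  by have [a [P [sP hP]]] := ratz_lightning (h N hN) f0; exists (a, P).
have [F hF] := choice H.
exists (fun N => (F N).1), (fun N => (F N).2); split => N; first by case: (hF N).
by case: (hF N).
Qed.

Lemma powR_exp z : 0 < z -> z `^ alpha = expR (alpha * ln z).
Proof. by move=> z0; rewrite /powR gt_eqF. Qed.

Lemma log_sequences : exists (a : nat -> nat -> R[i]) (P : nat -> {poly R[i]}) (N0 : nat) (K : R),
  [/\ forall N, (size (P N) <= (n2 N).+1)%N, 0 <= K &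
    forall N, (N0 <= N)%N -> forall z, 0 <= z <= 1 ->
      normc (lightning_fun C sigma (N - n2 N) (a N) (P N) z%:C - (z `^ alpha * ln z)%:C) <=
      K * goal_err sigma alpha 1 N].
Proof.
have [m [K K0 hK]] := approx_log sigma_gt0 C_gt0 alpha_gt0.
have [N0 [K' K'0 hN]] := err_asym sigma_gt0 C_gt0 alpha_gt0 m (isT : (1 <= 1)%N).
pose f z := z `^ alpha * ln z.
have f0 : f 0 = 0 by rewrite /f powR0 ?mul0r// gt_eqF.
have [N hNN|a [P [sP hP]]] := @lightning_sequences f (goal_err sigma alpha 1) N0 (K * K') f0.
  have [md hE] := hN N hNN; rewrite -/n2 in md hE.
  have := hK (N - n2 N)%N (n2 N - m.+1)%N; rewrite addSnnS subnK// => hr.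
  rewrite -mulrA; apply: ratz_le (ler_wpM2l K0 hE) _.
  by apply: ratz_ext hr => z z0 z1; rewrite /f powR_exp.
by exists a, P, N0, (K * K'); split => //; rewrite mulr_ge0.
Qed.

Lemma sin_natD m x : `|sin (m%:R * pi + x)| = `|sin x|.
Proof.
elim: m => [|m IH]; first by rewrite mul0r add0r.
rewrite -natr1 mulrDl mul1r addrAC sinD cospi sinpi mulr0 addr0 mulrN1 normrN.
exact: IH.
Qed.

Definition kappa : R := Num.max (`|sin (alpha * pi)| / (alpha * pi))
                       (`|sin (alpha * pi)| / ((1 - frac_part alpha) * pi)).

Lemma kappa_ge0 : 0 <= kappa.
Proof.
by rewrite le_max; apply/orP; left; rewrite divr_ge0// mulr_ge0 ?pi_ge0// ltW.
Qed.

Lemma pow_sequences : exists (a : nat -> nat -> R[i]) (P : nat -> {poly R[i]}) (N0 : nat) (K : R),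
  [/\ forall N, (size (P N) <= (n2 N).+1)%N, 0 <= K &
    forall N, (N0 <= N)%N -> forall z, 0 <= z <= 1 ->
      normc (lightning_fun C sigma (N - n2 N) (a N) (P N) z%:C - (z `^ alpha)%:C) <=
      K * (kappa * goal_err sigma alpha 0 N)].
Proof.
case: (split_exponent alpha_gt0) => [[m aE]|[m [be [aE be0 be1]]]].
  have [N0 [K' K'0 hN]] := err_asym sigma_gt0 C_gt0 alpha_gt0 m (isT : (0 <= 1)%N).
  (* alpha = m + 1 is an integer: kappa = 0 and the approximation has to be exact *)
  exists (fun _ _ => 0), (fun N => if (m < n2 N)%N then 'X^(m.+1) else 0), N0, 0; split => //.
    by move=> N; case: ifP => mN; rewrite ?size_poly0// size_polyXn.
  move=> N /hN[md _] z /andP[z0 z1]; rewrite -/n2 in md; rewrite md mul0r.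
  rewrite /lightning_fun big1 => [|j _]; last by rewrite mul0r.
  rewrite add0r hornerXn -rmorphXn aE natr1 powR_mulrn// subrr normc0//.
have [K K0 hK] := approx_pow sigma_gt0 C_gt0 aE be0 be1.
have [N0 [K' K'0 hN]] := err_asym sigma_gt0 C_gt0 alpha_gt0 m (isT : (0 <= 1)%N).
pose f z := z `^ alpha.
have f0 : f 0 = 0 by rewrite /f powR0// gt_eqF.
have k0 : 0 < kappa.
  rewrite lt_max; apply/orP; left; rewrite divr_gt0 ?mulr_gt0 ?pi_gt0// aE mulrDl sin_natD.
  rewrite normr_gt0 gt_eqF// sin_gt0_pi// mulr_gt0 ?pi_gt0//=.
  by rewrite gtr_pMl// pi_gt0.
have [N hNN|a [P [sP hP]]] := @lightning_sequences f (goal_err sigma alpha 0) N0 (K * K') f0.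
  have [md hE] := hN N hNN; rewrite -/n2 in md hE.
  have := hK (N - n2 N)%N (n2 N - m.+1)%N; rewrite addSnnS subnK// => hr.
  rewrite -mulrA; apply: ratz_le (ler_wpM2l K0 hE) _.
  by apply: ratz_ext hr => z z0 z1; rewrite /f powR_exp.
exists a, P, N0, (K * K' / kappa); split => //; first by rewrite !mulr_ge0// invr_ge0 ltW.
by move=> N hNN z zz; rewrite [X in _ <= X]mulrA divfK ?gt_eqF// hP.
Qed.

End Assembly.

Theorem corollary1p1 (R : realType) (alpha C sigma : R)
    (alpha_gt0 : 0 < alpha) (C_gt0 : 0 < C) (sigma_gt0 : 0 < sigma) :
  let sigma_opt := 2 * pi / Num.sqrt alpha in
  let eta := sigma_opt / sigma in
  let kappa := Num.max (`|sin (alpha * pi)| / (alpha * pi))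
                       (`|sin (alpha * pi)| / ((1 - frac_part alpha) * pi)) in
  exists (N1 N2 : nat -> nat) (a a' : nat -> nat -> R[i])
         (P P' : nat -> {poly R[i]}),
  let r N := lightning_fun C sigma (N1 N) (a N) (P N) in
  let r' N := lightning_fun C sigma (N1 N) (a' N) (P' N) in
  [/\ (* N = N1 + N2, N2 = O(sqrt N1), polynomials of degree at most N2 *)
      [/\ forall N, (N1 N + N2 N)%N = N,
          (fun N => (N2 N)%:R : R) =O_\oo (fun N => Num.sqrt (N1 N)%:R : R),
          forall N, (size (P N) <= (N2 N).+1)%N
        & forall N, (size (P' N) <= (N2 N).+1)%N],
      (* r_N and r'_N approximate z^alpha and z^alpha log z on [0, 1] *)
      uniform_bigO `[0, 1] (fun N z => r N z%:C - (z `^ alpha)%:C)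
        (fun N => kappa *
          if sigma <= sigma_opt
          then expR (- sigma * alpha * Num.sqrt N%:R)
          else expR (- (2 * pi * eta * Num.sqrt (N%:R * alpha))))
      /\
      uniform_bigO `[0, 1] (fun N z => r' N z%:C - (z `^ alpha * ln z)%:C)
        (fun N =>
          if sigma <= sigma_opt
          then Num.sqrt N%:R * expR (- sigma * alpha * Num.sqrt N%:R)
          else expR (- (2 * pi * eta * Num.sqrt (N%:R * alpha)))),
      (* poles of r_N(x^2) and r'_N(x^2); a residue a_j may vanish, as all
         those of r_N must when alpha is an integer *)
      (forall N (w : R[i]),
         is_pole (fun z => r N (z ^+ 2)) w <->
         exists s j, [/\ (1 <= j <= N1 N)%N, a N j != 0
                       & w = tapered_lightning_pole C sigma (N1 N) s j])
      /\
      (forall N (w : R[i]),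
         is_pole (fun z => r' N (z ^+ 2)) w <->
         exists s j, [/\ (1 <= j <= N1 N)%N, a' N j != 0
                       & w = tapered_lightning_pole C sigma (N1 N) s j]),
      uniform_bigO `[-1, 1]
        (fun N x => r N (x ^+ 2)%:C - (`|x| `^ (2 * alpha))%:C)
        (fun N => kappa *
          if sigma <= sigma_opt
          then expR (- sigma * alpha * Num.sqrt N%:R)
          else (expR (4 * pi ^+ 2 / sigma * Num.sqrt N%:R) - 1)^-1)
    & uniform_bigO `[-1, 1]
        (fun N x => r' N (x ^+ 2)%:C - (2 * `|x| `^ (2 * alpha) * ln `|x|)%:C)
        (fun N =>
          if sigma <= sigma_opt
          then Num.sqrt N%:R * expR (- sigma * alpha * Num.sqrt N%:R)
          else expR (- (4 * pi ^+ 2 / sigma * Num.sqrt N%:R)))].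
Proof.
move=> sigma_opt eta kap.
have [a [P [Np [Kp [sP Kp0 hp]]]]] := pow_sequences sigma_gt0 C_gt0 alpha_gt0.
have [a' [P' [Nl [Kl [sP' Kl0 hl]]]]] := log_sequences sigma_gt0 C_gt0 alpha_gt0.
rewrite -/(kappa alpha) in hp; rewrite (_ : kappa alpha = kap)// in hp.
have kap0 : 0 <= kap by exact: (kappa_ge0 alpha_gt0).
pose cd := c_deg sigma C alpha; pose n2 := deg2 R cd.
exists (fun N => N - n2 N)%N, n2, a, a', P, P'; cbv zeta.
have sqa : 0 < Num.sqrt alpha by rewrite sqrtr_gt0.
have p0 := @pi_gt0 R.
have optE : (sigma <= sigma_opt) = (sigma * alpha <= 4 * pi ^+ 2 / sigma).
  rewrite /sigma_opt !ler_pdivlMr//.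
  rewrite -(@ler_pXn2r _ 2)// ?nnegrE ?mulr_ge0 ?(ltW p0) ?(ltW sigma_gt0) ?(ltW sqa)//.
  rewrite !exprMn sqr_sqrtr ?(ltW alpha_gt0)// (_ : 2 ^+ 2 = 4 :> R); last by ring.
  by congr (_ <= _); ring.
have etaE N : 2 * pi * eta * Num.sqrt (N%:R * alpha) = 4 * pi ^+ 2 / sigma * Num.sqrt N%:R :> R.
  rewrite /eta /sigma_opt sqrtrM//; field; rewrite !gt_eqF//.
have powE N : (if sigma <= sigma_opt then expR (- sigma * alpha * Num.sqrt N%:R)
   else expR (- (4 * pi ^+ 2 / sigma * Num.sqrt N%:R))) = goal_err sigma alpha 0 N.
  by rewrite optE /goal_err expr0 mul1r !mulNr.
have logE N : (if sigma <= sigma_opt then Num.sqrt N%:R * expR (- sigma * alpha * Num.sqrt N%:R)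
   else expR (- (4 * pi ^+ 2 / sigma * Num.sqrt N%:R))) = goal_err sigma alpha 1 N.
  by rewrite optE /goal_err expr1 !mulNr.
have g0 e N := goal_err_ge0 sigma alpha e N.
have sq01 (x : R) : -1 <= x <= 1 -> 0 <= x ^+ 2 <= 1.
  move=> /andP[x1 x2]; rewrite sqr_ge0 /= -subr_ge0.
  have -> : 1 - x ^+ 2 = (1 - x) * (1 + x) by ring.
  by rewrite mulr_ge0; lra.
split.
- split => //.
  + by move=> N; rewrite subnK// geq_minl.
  + apply/eqO_exP; exists (4 * cd.+1%:R); first by rewrite mulr_gt0// ltr0n.
    exists ((4 * cd) ^ 2 + 1)%N => // N /= hN.
    have h1 : ((4 * cd) ^ 2 <= N)%N by apply: leq_trans hN; rewrite leq_addr.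
    have h2 : (0 < N)%N by apply: leq_trans hN; rewrite addn1.
    rewrite !ger0_norm ?sqrtr_ge0//.
    apply: le_trans (@deg2_bigO R cd N h1 h2) _.
    by rewrite ler_wpM2r ?sqrtr_ge0// ler_wpM2l// ler_nat.
- split.
  + exists Kp; exists Np => // N /= hN z; rewrite /= in_itv /= => zz.
    by rewrite etaE powE ger0_norm ?(mulr_ge0 kap0 (g0 _ _))//; exact: hp.
  + exists Kl; exists Nl => // N /= hN z; rewrite /= in_itv /= => zz.
    by rewrite etaE logE ger0_norm//; exact: hl.
- by split => N w; exact: lightning_is_pole.
- exists Kp; exists (Np + 1)%N => // N /= hN x; rewrite /= in_itv /= => /sq01 x01.
  have N1 : (0 < N)%N by apply: leq_trans hN; rewrite addn1.
  have hN' : (Np <= N)%N by apply: leq_trans hN; rewrite leq_addr.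
  have -> : `|x| `^ (2 * alpha) = (x ^+ 2) `^ alpha.
    by rewrite powRrM powR_mulrn// real_normK// num_real.
  apply: le_trans (hp N hN' _ x01) _; rewrite normrM (ger0_norm kap0).
  rewrite ler_wpM2l// ler_wpM2l// -powE; case: ifP => _.
    exact: ler_norm.
  (* exp (- t) <= 1 / (exp t - 1) *)
  apply: le_trans (ler_norm _); set t := 4 * _ / _ * _.
  have t0 : 0 < t by rewrite mulr_gt0 ?sqrtr_gt0 ?ltr0n// divr_gt0// mulr_gt0// exprn_gt0.
  rewrite expRN lef_pV2 ?posrE ?expR_gt0 ?subr_gt0 ?expR_gt1//; lra.
- exists Kl; exists Nl => // N /= hN x; rewrite /= in_itv /= => /sq01 x01.
  have -> : 2 * `|x| `^ (2 * alpha) * ln `|x| = (x ^+ 2) `^ alpha * ln (x ^+ 2).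
    have -> : `|x| `^ (2 * alpha) = (x ^+ 2) `^ alpha.
      by rewrite powRrM powR_mulrn// real_normK// num_real.
    have [->|x0] := eqVneq x 0.
      by rewrite expr0n /= powR0 ?gt_eqF// mulr0 !mul0r.
    rewrite -[in ln (x ^+ 2)](real_normK (num_real x)) lnXn ?normr_gt0//.
    by rewrite mulr2n; ring.
  by rewrite logE ger0_norm//; exact: hl.
Qed.
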